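(* Let $k_1,\dots,k_l\geq 1$ be integers and let $s_2,s_3,\dots$ be a sequence of non-negative integers with only finitely many non-zero elements. The coefficient of $R_2^{s_2}R_3^{s_3}\cdots$ in the generalized Kerov polynomial $K_{k_1,\dots,k_l}$ is equal to the number of triples $(\sigma_1,\sigma_2,q)$ with the following properties: (a') $\sigma_1,\sigma_2\in\mathfrak{S}(k_1+\cdots+k_l)$ are such that $\sigma_1\circ\sigma_2=(1,2,\dots,k_1)(k_1+1,k_1+2,\dots,k_1+k_2)\cdots$ and the group $\langle\sigma_1,\sigma_2\rangle$ acts transitively on the set $\{1,\dots,k_1+\cdots+k_l\}$; (b) $|C(\sigma_2)|=s_2+s_3+\cdots$; (c) $|C(\sigma_1)|+|C(\sigma_2)|=2s_2+3s_3+4s_4+\cdots$; (d) $q:C(\sigma_2)\rightarrow\{2,3,\dots\}$ is a coloring of the cycles of $\sigma_2$ such that each color $i\in\{2,3,\dots\}$ is used exactly $s_i$ times; (e) for every set $A\subset C(\sigma_2)$ with $A\neq\emptyset$ and $A\neq C(\sigma_2)$ there are more than $\sum_{i\in A}\big(q(i)-1\big)$ cycles of $\sigma_1$ which intersect $\bigcup A$.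
   Context: $\mathfrak{S}(k)$ is the symmetric group on $\{1,\dots,k\}$. For a permutation $\pi$, $C(\pi)$ is the set of its cycles (including fixed points), each cycle being identified with its support; for $A\subseteq C(\pi)$, $\bigcup A$ is the union of the supports of the cycles in $A$. Normalized characters. For a Young diagram (partition) $\lambda$ with $n$ boxes, let $\rho^\lambda$ be the corresponding irreducible representation of $\mathfrak{S}(n)$ (the one-row diagram giving the trivial representation). For $\pi\in\mathfrak{S}(k)$ put $\Sigma_\pi^\lambda=n(n-1)\cdots(n-k+1)\,\frac{\operatorname{Tr}\rho^\lambda(\pi)}{\dim\rho^\lambda}$ if $k\le n$ ($\pi$ being extended by fixed points to an element of $\mathfrak{S}(n)$) and $\Sigma_\pi^\lambda=0$ if $k>n$. For $k_1,\dots,k_l\ge1$ let $\Sigma_{k_1,\dots,k_l}^\lambda=\Sigma_\pi^\lambda$, where $\pi\in\mathfrak{S}(k_1+\cdots+k_l)$ is any permutation with cycle lengths $k_1,\dots,k_l$. Cumulants. The cumulants $\kappa^{\mathrm{id}}(\Sigma_{k_1},\dots,\Sigma_{k_l})$ are the functions of $\lambda$ related to the characters $\Sigma_{k_1,\dots,k_l}$ as classical cumulants are related to moments, i.e. defined recursively by $\Sigma_{k_1,\dots,k_l}=\sum_{\Pi}\prod_{b\in\Pi}\kappa^{\mathrm{id}}\big((\Sigma_{k_i})_{i\in b}\big)$, the sum being over all set partitions $\Pi$ of $\{1,\dots,l\}$ and the products being pointwise in $\lambda$. For example $\kappa^{\mathrm{id}}(\Sigma_r)=\Sigma_r$ and $\kappa^{\mathrm{id}}(\Sigma_r,\Sigma_s)=\Sigma_{r,s}-\Sigma_r\Sigma_s$.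 Free cumulants. View $\lambda=(\lambda_1\ge\lambda_2\ge\cdots)$ as the planar region $\bigcup_j\{(x,y):0<x<\lambda_j,\ j-1<y<j\}$. For $n\geq 2$ let $S_n^\lambda=(n-1)\iint_{(x,y)\in\lambda}(x-y)^{n-2}\,dx\,dy$, and let $G^\lambda(z)=\frac1z\exp\big(\sum_{n\ge2}S_n^\lambda z^{-n}\big)$ (the Cauchy transform of Kerov's transition measure of $\lambda$). The free cumulants $R_2^\lambda,R_3^\lambda,\dots$ are defined by $(G^\lambda)^{\langle-1\rangle}(z)-\frac1z=\sum_{n\ge 2}R_n^\lambda z^{n-1}$, where $\langle -1\rangle$ denotes compositional inverse. Generalized Kerov polynomial. It is known (from the work of Kerov) that there is a unique polynomial $K_{k_1,\dots,k_l}$ in indeterminates $R_2,R_3,\dots$, with integer coefficients, such that $(-1)^{l-1}\kappa^{\mathrm{id}}(\Sigma_{k_1},\dots,\Sigma_{k_l})=K_{k_1,\dots,k_l}(R_2^\lambda,R_3^\lambda,\dots)$ for every Young diagram $\lambda$; it is called the generalized Kerov polynomial. *)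

(* Defs.v *)
From HB Require Import structures.
From mathcomp Require Import all_boot all_order all_algebra all_fingroup.
From mathcomp Require Import mxrepresentation.
From mathcomp Require Import finmap monalg.
From mathcomp Require Import complex.
From mathcomp Require Import all_classical all_reals all_analysis.
From mathcomp Require Import finset.

Set Implicit Arguments.
Unset Strict Implicit.
Unset Printing Implicit Defensive.

Import Order.TTheory GRing.Theory Num.Theory.
Import numFieldNormedType.Exports.

Local Open Scope ring_scope.

Definition is_part (la : seq nat) : bool := sorted geq la && (0%N \notin la).

(* The boxes of [la] are numbered row by row by ['I_(sumn la)]: box [i] lies in
   row [reshape_index la i] and column [reshape_offset la i]. *)
Definition row_stab (la : seq nat) : {set 'S_(sumn la)} :=
  finset (fun p : 'S_(sumn la) =>
    [forall i, reshape_index la (p i) == reshape_index la i]).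

Definition col_stab (la : seq nat) : {set 'S_(sumn la)} :=
  finset (fun p : 'S_(sumn la) =>
    [forall i, reshape_offset la (p i) == reshape_offset la i]).

Section Specht.
Variables (F : fieldType) (la : seq nat).
Local Notation G := [set: 'S_(sumn la)]%G.

(* An element of the group algebra, as a row vector in the basis underlying
   [regular_repr]. *)
Definition young_symmetrizer : 'rV[F]_#|G| :=
  \sum_(p in row_stab la) \sum_(q in col_stab la)
    (-1) ^+ odd_perm q *: delta_mx 0 (gring_index G (p * q)%g).

Definition specht_dim : nat :=
  \rank (cyclic_mx (regular_repr F G) young_symmetrizer).

(* The ideal of the group algebra generated by the Young symmetrizer. It is a
   right ideal because [regular_repr] acts by right multiplication, but products
   of permutations in ['S_n] are taken in the order opposite to composition. *)
Definition specht_repr : mx_representation F G specht_dim :=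
  submod_repr (cyclic_mx_module (regular_repr F G) young_symmetrizer).

End Specht.

Section ExtendPerm.
Variables (k n : nat) (le_kn : (k <= n)%N) (p : 'S_k).

Definition ext_fun (i : 'I_n) : 'I_n :=
  if insub (i : nat) is Some j then widen_ord le_kn (p j) else i.

Lemma ext_fun_inj : injective ext_fun.
Proof.
move=> i j; rewrite /ext_fun.
case: insubP => [u _ ui|ik]; case: insubP => [v _ vj|jk] //.
- move=> /(congr1 val) /= /val_inj /perm_inj uv.
  by apply: val_inj; rewrite /= -ui -vj uv.
- by move=> /(congr1 val) /= e; rewrite -e ltn_ord in jk.
- by move=> /(congr1 val) /= e; rewrite e ltn_ord in ik.
Qed.

Definition ext_perm : 'S_n := perm ext_fun_inj.

End ExtendPerm.

Section BlockCycle.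
Variable ks : seq nat.
Local Notation N := (sumn ks).

Lemma block_cycle_subproof (i : 'I_N) :
  (flatten_index ks (reshape_index ks i)
     ((reshape_offset ks i).+1 %% nth 0 ks (reshape_index ks i)) < N)%N.
Proof.
apply/flatten_indexP/ltn_pmod/(leq_ltn_trans (leq0n _))/reshape_offsetP.
exact: ltn_ord.
Qed.

Definition block_cycle_fun (i : 'I_N) : 'I_N := Ordinal (block_cycle_subproof i).

Lemma block_cycle_inj : injective block_cycle_fun.
Proof.
move=> i j /(congr1 val) /= e.
have oi := reshape_offsetP (ltn_ord i); have oj := reshape_offsetP (ltn_ord j).
have mi := ltn_pmod (reshape_offset ks i).+1 (leq_ltn_trans (leq0n _) oi).
have mj := ltn_pmod (reshape_offset ks j).+1 (leq_ltn_trans (leq0n _) oj).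
have er : reshape_index ks i = reshape_index ks j.
  by rewrite -(flatten_indexKl mi) e (flatten_indexKl mj).
have eo : (reshape_offset ks i).+1 = (reshape_offset ks j).+1
    %[mod nth 0%N ks (reshape_index ks j)].
  by rewrite -[RHS](flatten_indexKr mj) -e er -er (flatten_indexKr mi) er.
apply: val_inj; rewrite /= -(reshape_indexK ks i) -(reshape_indexK ks j) er.
congr flatten_index; move: eo oi oj; rewrite er.
move: (reshape_offset _ _) (reshape_offset _ _) (nth _ _ _) => a b m.
move/eqP; have := eqn_modDr 1 b a m; rewrite !addn1 => -> /eqP eab lta ltb.
by rewrite -(modn_small lta) -(modn_small ltb).
Qed.

(* The permutation (0, 1, ..., k_1 - 1)(k_1, ..., k_1 + k_2 - 1)... *)
Definition block_cycle : 'S_N := perm block_cycle_inj.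

End BlockCycle.

Section NormalizedCharacter.
Variables (F : fieldType) (la : seq nat).
Local Notation n := (sumn la).

Definition norm_character (k : nat) (p : 'S_k) : F :=
  match @idP (k <= n)%N with
  | ReflectT le_kn =>
      (n ^_ k)%:R * (\tr (specht_repr F la (ext_perm le_kn p))
                     / (specht_dim F la)%:R)
  | ReflectF _ => 0
  end.

Definition norm_character_seq (ks : seq nat) : F :=
  norm_character (block_cycle ks).

End NormalizedCharacter.

Section Cumulants.
Variables (A : comNzRingType) (mom : seq nat -> A).

Definition subfamily (ks : seq nat) (b : {set 'I_(size ks)}) : seq nat :=
  [seq nth 0%N ks i | i : 'I_(size ks) <- enum b].

(* Solves the moment-cumulant relation [moment_cumulantE] below for the term of
   the one-block partition; [d] bounds the depth of the recursion. *)
Fixpoint cumulant_rec (d : nat) (ks : seq nat) : A :=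
  if d is d'.+1 then
    mom ks - \sum_(P : {set {set 'I_(size ks)}}
                     | partition P setT && (P != [set setT]))
               \prod_(b in P) cumulant_rec d' (subfamily b)
  else 0.

Definition cumulant (ks : seq nat) : A := cumulant_rec (size ks) ks.

Lemma size_subfamily (ks : seq nat) (b : {set 'I_(size ks)}) : size (subfamily b) = #|b|.
Proof. by rewrite size_map cardE. Qed.

Lemma card_block (ks : seq nat) (P : {set {set 'I_(size ks)}}) b :
  partition P setT -> P != [set setT] -> b \in P -> (0 < #|b| < size ks)%N.
Proof.
case/and3P=> _ /trivIsetP tP P0 PnT bP; apply/andP; split.
  by rewrite card_gt0; apply: contraNneq P0 => <-.
rewrite ltn_neqAle -[X in (_ <= X)%N]card_ord max_card andbT.
apply: contraNneq PnT => cb.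
have bT : b = setT by apply/eqP; rewrite eqEcard subsetT cardsT card_ord cb leqnn.
apply/eqP/setP => c; rewrite inE -bT; apply/idP/eqP => [cP|->//].
apply/eqP/negPn/negP => cb'; have := tP _ _ cP bP cb'.
rewrite bT disjoints_subset setCT subset0 => /eqP c0.
by move: P0; rewrite -c0 cP.
Qed.

Lemma cumulant_rec_stable d (ks : seq nat) : (0 < size ks <= d)%N ->
  cumulant_rec d ks = cumulant ks.
Proof.
elim/ltn_ind: d ks => -[|d] IH ks /andP[k0]; first by rewrite leqNgt k0.
rewrite /cumulant; case ek : (size ks) (k0) => [//|l] _ ld /=.
congr (_ - _); apply: eq_bigr => P /andP[PT PnT]; apply: eq_bigr => b bP.
have /andP[b0 bl] := card_block PT PnT bP.
have lb : (#|b| <= l)%N by rewrite -ltnS -ek.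
rewrite IH ?size_subfamily ?b0 //=; last exact: leq_trans lb ld.
have [eld|nld] := eqVneq l d.
  by rewrite eld IH ?size_subfamily ?b0 // -eld.
by rewrite IH ?size_subfamily ?b0 // ltnS ltnW // ltn_neqAle nld.
Qed.

Lemma moment_cumulantE (ks : seq nat) : ks != [::] ->
  mom ks = \sum_(P : {set {set 'I_(size ks)}} | partition P setT)
             \prod_(b in P) cumulant (subfamily b).
Proof.
rewrite -size_eq0 -lt0n => k0.
have PT : partition [set setT] [set: 'I_(size ks)].
  apply/and3P; split; last by rewrite inE eq_sym -card_gt0 cardsT card_ord.
    by rewrite /cover big_set1.
  by apply/trivIsetP => b c /set1P-> /set1P->; rewrite eqxx.
rewrite (bigD1 [set setT]) //= big_set1.
have -> : @subfamily ks setT = ks.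
  rewrite /subfamily.
  rewrite enum_setT -enumT -[RHS](mkseq_nth 0%N) /mkseq -val_enum_ord.
  by rewrite -map_comp.
rewrite -[cumulant ks](@cumulant_rec_stable (size ks).+1) ?k0 ?leqnSn //=.
rewrite -[LHS](subrK (\sum_(P | partition P [set: 'I_(size ks)]
    && (P != [set setT])) \prod_(b in P) cumulant (subfamily b))).
congr (_ - _ + _); apply: eq_bigr => P /andP[PP PnT]; apply: eq_bigr => b bP.
have /andP[b0 /ltnW bk] := card_block PP PnT bP.
by rewrite cumulant_rec_stable // size_subfamily b0.
Qed.

End Cumulants.

Section FormalPowerSeries.
Variable F : fieldType.
Implicit Types f g h : nat -> F.

Definition fps_one : nat -> F := fun n => (n == 0%N)%:R.
Definition fps_X : nat -> F := fun n => (n == 1%N)%:R.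
Definition fps_mul f g : nat -> F :=
  fun n => \sum_(i < n.+1) f i * g (n - i)%N.
Definition fps_pow f k : nat -> F := iter k (fps_mul f) fps_one.

Arguments fps_pow : simpl never.

(* [g 0 = 0] is required: then [f \o g = \sum_k f k * g^k] and the terms with
   [k > n] do not contribute to the [n]-th coefficient. *)
Definition fps_comp f g : nat -> F :=
  fun n => \sum_(k < n.+1) f k * fps_pow g k n.

Definition fps_exp g : nat -> F := fps_comp (fun k => (k`!%:R)^-1) g.

Definition fps_comp_inverse g h : Prop :=
  [/\ h 0%N = 0, fps_comp g h =1 fps_X & fps_comp h g =1 fps_X].

(* For [g = z + O(z^2)], the series [G(z) = g(1/z)] has compositional inverse
   [1/h], where [h] is that of [g]. Hence [1/h = 1/z + \sum_(n >= 2) r n z^(n-1)]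
   reads [h * (1 + \sum_(n >= 2) r n z^n) = z]. *)
Definition is_free_cumulants g (r : nat -> F) : Prop :=
  [/\ r 0%N = 0, r 1%N = 0 & exists2 h, fps_comp_inverse g h &
    fps_mul h (fun n => fps_one n + r n) =1 fps_X].

(* Existence and uniqueness of the free cumulants, by truncation to polynomials. *)
Local Notation trunc n f := (\poly_(i < n) f i).

Lemma fps_mul_trunc n f g i : (i < n)%N ->
  fps_mul f g i = (trunc n f * trunc n g)`_i.
Proof.
move=> lin; rewrite coefM; apply: eq_bigr => j _.
have lji : (j <= i)%N by rewrite -ltnS.
by rewrite !coef_poly (leq_ltn_trans lji lin) (leq_ltn_trans (leq_subr _ _) lin).
Qed.

Definition eqmod n (p q : {poly F}) := forall i, (i < n)%N -> p`_i = q`_i.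

Lemma eqmodM n p p' q q' : eqmod n p p' -> eqmod n q q' ->
  eqmod n (p * q) (p' * q').
Proof.
move=> ep eq i lin; rewrite !coefM; apply: eq_bigr => j _.
have lji : (j <= i)%N by rewrite -ltnS.
by rewrite ep ?eq ?(leq_ltn_trans (leq_subr _ _) lin) ?(leq_ltn_trans lji lin).
Qed.

Lemma eqmodX n p p' k : eqmod n p p' -> eqmod n (p ^+ k) (p' ^+ k).
Proof.
by move=> ep; elim: k => [//|k IH]; rewrite !exprS; apply: eqmodM.
Qed.

Lemma fps_pow_trunc n f k i : (i < n)%N ->
  fps_pow f k i = (trunc n f ^+ k)`_i.
Proof.
elim: k i => [|k IH] i lin; first by rewrite expr0 coef1.
rewrite [LHS](fps_mul_trunc _ _ lin) exprS; apply: (@eqmodM n) => // j ljn.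
by rewrite coef_poly ljn; apply: IH.
Qed.

Lemma fps_pow1 f n : fps_pow f 1 n = f n.
Proof. by rewrite (@fps_pow_trunc n.+1) // expr1 coef_poly ltnSn. Qed.

Lemma coef_pow_lt (p : {poly F}) k i : p`_0 = 0 -> (i < k)%N -> (p ^+ k)`_i = 0.
Proof.
move=> p0; elim: k i => // k IH i; rewrite ltnS => lik.
rewrite exprS coefM big_ord_recl p0 mul0r add0r big1 // => j _.
rewrite IH ?mulr0 //= /bump /= add1n.
have := ltn_ord j; case: i lik j => [|i] lik j /=; first by case: j.
by move=> lji; rewrite subSS (leq_ltn_trans (leq_subr _ _)).
Qed.

Lemma fps_comp_trunc n f g i : g 0%N = 0 -> (i < n)%N ->
  fps_comp f g i = (trunc n f \Po trunc n g)`_i.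
Proof.
move=> g0 lin; have n0 : (0 < n)%N by apply: leq_ltn_trans lin.
rewrite (_ : trunc n f \Po trunc n g
  = \sum_(k < n) f k *: trunc n g ^+ k); last first.
  by rewrite [trunc n f]poly_def raddf_sum /=; apply: eq_bigr => k _;
     rewrite linearZ /= comp_Xn_poly.
rewrite coef_sum /fps_comp (big_ord_widen n (fun k => f k * fps_pow g k i)) //.
rewrite [RHS](bigID (fun k : 'I_n => (k < i.+1)%N)) /= [X in _ + X]big1 ?addr0.
  by apply: eq_bigr => k _; rewrite coefZ (fps_pow_trunc _ _ lin).
move=> k; rewrite -leqNgt => lik.
by rewrite coefZ coef_pow_lt ?mulr0 // coef_poly n0.
Qed.

Lemma coef_compr0 (p t : {poly F}) : t`_0 = 0 -> (p \Po t)`_0 = p`_0.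
Proof.
move=> t0; rewrite -!horner_coef0 horner_comp; congr (_.[_]).
by rewrite horner_coef0.
Qed.

Lemma eqmod_comp n (p p' t t' : {poly F}) : t`_0 = 0 -> eqmod n p p' -> eqmod n t t' ->
  eqmod n (p \Po t) (p' \Po t').
Proof.
move=> t0 ep et i lin; transitivity ((p' \Po t)`_i).
  apply/eqP; rewrite -subr_eq0 -coefB -raddfB /= comp_polyE coef_sum.
  apply/eqP/big1 => k _; rewrite coefZ coefB.
  have [/ep->|lnk] := ltnP k n; first by rewrite subrr mul0r.
  by rewrite coef_pow_lt ?mulr0 // (leq_trans lin).
rewrite !comp_polyE !coef_sum; apply: eq_bigr => k _.
by rewrite !coefZ; congr (_ * _); apply: (@eqmodX n).
Qed.

Lemma fps_comp0 f g : fps_comp f g 0 = f 0%N.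
Proof. by rewrite /fps_comp big_ord1 mulr1. Qed.

Lemma fps_compA f g h : g 0%N = 0 -> h 0%N = 0 ->
  fps_comp f (fps_comp g h) =1 fps_comp (fps_comp f g) h.
Proof.
move=> g0 h0 i; have lii := ltnSn i.
have tr0 (k : nat -> F) : k 0%N = 0 -> (trunc i.+1 k)`_0 = 0.
  by rewrite coef_poly.
rewrite (fps_comp_trunc _ _ lii) ?fps_comp0 // (fps_comp_trunc _ h0 lii).
transitivity (((trunc i.+1 f \Po trunc i.+1 g) \Po trunc i.+1 h)`_i).
  rewrite -comp_polyA; apply: (@eqmod_comp i.+1) => //.
    by apply: tr0; rewrite fps_comp0.
  by move=> j lj; rewrite coef_poly lj; apply: fps_comp_trunc.
apply: (@eqmod_comp i.+1) => // [|j lj]; first exact: tr0.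
by rewrite coef_poly lj; apply/esym/fps_comp_trunc.
Qed.

Lemma trunc_X n : trunc n.+2 fps_X = 'X.
Proof.
apply/polyP => i; rewrite coef_poly coefX /fps_X.
by case: i => [|[|i]] //=; rewrite if_same.
Qed.

Lemma fps_compX f : fps_comp f fps_X =1 f.
Proof.
move=> i; rewrite (@fps_comp_trunc i.+2) ?trunc_X //.
by rewrite comp_polyXr coef_poly ltnW ?ltnS.
Qed.

Lemma fps_Xcomp f : f 0%N = 0 -> fps_comp fps_X f =1 f.
Proof.
move=> f0 i; rewrite (@fps_comp_trunc i.+2) ?trunc_X //.
by rewrite comp_polyX coef_poly ltnW ?ltnS.
Qed.

Lemma eq_fps_pow f f' k n : {in gtn n.+1, f =1 f'} ->
  fps_pow f k n = fps_pow f' k n.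
Proof.
move=> ef; rewrite !(@fps_pow_trunc n.+1) //.
suff -> : trunc n.+1 f = trunc n.+1 f' by [].
apply/polyP => i; rewrite !coef_poly; case: ltnP => // lin; exact: ef.
Qed.

Lemma eq_fps_comp f f' g g' : f =1 f' -> g =1 g' -> fps_comp f g =1 fps_comp f' g'.
Proof.
move=> ef eg n; apply: eq_bigr => k _; rewrite ef; congr (_ * _).
by apply: eq_fps_pow => i _; apply: eg.
Qed.

Lemma contraction_fix (Phi : (nat -> F) -> nat -> F) :
  (forall n f g, {in gtn n, f =1 g} -> {in gtn n.+1, Phi f =1 Phi g}) ->
  exists f, f =1 Phi f.
Proof.
move=> ctr; pose it n := iter n Phi (fun=> 0).
have itS n : {in gtn n, it n =1 it n.+1}.
  by elim: n => [//|n IH]; apply: ctr IH.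
have itE m d : {in gtn m, it m =1 it (d + m)%N}.
  elim: d => [//|d IH] i lim; rewrite IH // itS //=.
  exact: leq_trans lim (leq_addl _ _).
exists (fun n => it n.+1 n) => i.
apply: (ctr i) => [j lji|]; last exact: ltnSn.
by rewrite (itE j.+1 (i - j.+1)%N) ?subnK // unfold_in /=.
Qed.

Lemma fps_right_inverse g : g 0%N = 0 -> g 1%N = 1 ->
  exists2 h, h 0%N = 0 & fps_comp g h =1 fps_X.
Proof.
move=> g0 g1; pose z (h : nat -> F) n := if n is 0 then 0 else h n.
pose Phi h n := fps_X n - \sum_(k < n.+1 | (1 < k)%N) g k * fps_pow (z h) k n.
have [|h hE] := @contraction_fix Phi.
  move=> n f f' ef i; rewrite unfold_in /= ltnS => lin; congr (_ - _).
  apply: eq_bigr => -[k /= _] k1; congr (_ * _); case: k k1 => [|[|k]] // _.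
  rewrite !(@fps_pow_trunc i.+1) // !(exprS _ k.+1) !coefM; apply: eq_bigr => j _.
  have tr0 (u : nat -> F) : (trunc i.+1 (z u))`_0 = 0 by rewrite coef_poly.
  case: (posnP j) => [->|j0]; first by rewrite !tr0 !mul0r.
  case: (posnP (i - j)%N) => [->|ij0].
    by rewrite !coef_pow_lt ?mulr0.
  have ezf m : (m < n)%N -> (trunc i.+1 (z f))`_m = (trunc i.+1 (z f'))`_m.
    by move=> lmn; rewrite !coef_poly; case: ifP => //; case: m lmn => //= m; move/ef->.
  congr (_ * _); first by apply: ezf; rewrite (leq_trans _ lin) // -subn_gt0.
  by apply: (eqmodX _ ezf); rewrite (leq_trans _ lin) // ltn_subrL j0 (leq_trans j0) // -ltnS.
have h0 : h 0%N = 0.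
  by rewrite hE /Phi big_mkcond big_ord1 /= subr0.
exists h => // -[|n]; first by rewrite fps_comp0 g0.
have zh i : z h i = h i by case: i => [|i] //=; rewrite h0.
rewrite /fps_comp (bigID (fun k : 'I_n.+2 => (1 < k)%N)) /=.
have -> : \sum_(k < n.+2 | ~~ (1 < k)%N) g k * fps_pow h k n.+1 = h n.+1.
  rewrite big_mkcond !big_ord_recl big1 ?addr0 //= g0 mul0r add0r g1 mul1r.
  by rewrite fps_pow1 addr0.
rewrite addrC [h n.+1]hE /Phi -[RHS](subrK (\sum_(k < n.+2 | (1 < k)%N) g k * fps_pow h k n.+1)).
congr (_ - _ + _); apply: eq_bigr => k _; congr (_ * _).
by apply: eq_fps_pow => i _; rewrite zh.
Qed.

Lemma fps_inverse g : g 0%N = 0 -> g 1%N = 1 -> exists h, fps_comp_inverse g h.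
Proof.
move=> g0 g1; have [h h0 gh] := fps_right_inverse g0 g1; exists h; split=> //.
have h1 : h 1%N = 1.
  have := gh 1%N; rewrite /fps_comp !big_ord_recl big_ord0 /= g0 g1.
  by rewrite mul0r mul1r add0r addr0 fps_pow1.
have [k k0 hk] := fps_right_inverse h0 h1.
move=> n; rewrite -[RHS]hk; apply: eq_fps_comp => // i.
rewrite -(fps_compX g) -(eq_fps_comp (fun _ => erefl) hk) fps_compA //.
by rewrite (eq_fps_comp gh (fun _ => erefl)) fps_Xcomp.
Qed.

Lemma fps_inverse_uniq g h h' : g 0%N = 0 ->
  fps_comp_inverse g h -> fps_comp_inverse g h' -> h =1 h'.
Proof.
move=> g0 [h0 _ hg] [h'0 gh' _] n.
rewrite -(fps_compX h) -(eq_fps_comp (fun _ => erefl) gh') fps_compA //.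
by rewrite (eq_fps_comp hg (fun _ => erefl)) fps_Xcomp.
Qed.

Lemma fps_mul_inverse v : v 0%N = 1 -> exists w, fps_mul v w =1 fps_one.
Proof.
move=> v0; pose Phi w n := fps_one n - \sum_(i < n) v i.+1 * w (n - i.+1)%N.
have [|w wE] := @contraction_fix Phi.
  move=> n f f' ef i; rewrite unfold_in /= ltnS => lin; congr (_ - _).
  apply: eq_bigr => j _; rewrite ef // unfold_in /= (leq_trans _ lin) //.
  case: i lin j => [|i] lin j; first by case: j.
  by rewrite subSS ltnS leq_subr.
by exists w => n; rewrite /fps_mul big_ord_recl v0 mul1r subn0 wE subrK.
Qed.

Lemma is_free_cumulants_ex g : g 0%N = 0 -> g 1%N = 1 -> g 2%N = 0 ->
  exists r, is_free_cumulants g r.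
Proof.
move=> g0 g1 g2; have [h hP] := fps_inverse g0 g1.
have [h0 gh _] := hP.
have h1 : h 1%N = 1.
  have := gh 1%N; rewrite /fps_comp !big_ord_recl big_ord0 /= g0 g1.
  by rewrite mul0r mul1r add0r addr0 fps_pow1.
have h2 : h 2%N = 0.
  have := gh 2%N; rewrite /fps_comp !big_ord_recl big_ord0 /= g0 g1 g2.
  by rewrite !mul0r mul1r add0r !addr0 fps_pow1.
have [w wE] := @fps_mul_inverse (fun n => h n.+1) h1.
have w0 : w 0%N = 1.
  by have := wE 0%N; rewrite /fps_mul big_ord1 h1 mul1r.
have w1 : w 1%N = 0.
  have := wE 1%N; rewrite /fps_mul !big_ord_recl big_ord0 /= h1 h2.
  by rewrite mul0r !addr0 mul1r.
exists (fun n => w n - fps_one n); split; rewrite ?w0 ?w1 ?subrr ?subr0 //.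
exists h => // n; rewrite /fps_mul.
under eq_bigr do rewrite addrC subrK.
rewrite big_ord_recl h0 mul0r add0r; case: n => [|n]; first by rewrite big_ord0.
exact: wE.
Qed.

Lemma is_free_cumulants_uniq g r r' : g 0%N = 0 ->
  is_free_cumulants g r -> is_free_cumulants g r' -> r =1 r'.
Proof.
move=> g0 [r0 _ [h hP hr]] [r'0 _ [h' h'P hr']] n.
have eh := fps_inverse_uniq g0 hP h'P.
have [h0 gh _] := hP.
have h1 : h 1%N = 1.
  have := hr 1%N; rewrite /fps_mul !big_ord_recl big_ord0 /= h0 mul0r add0r r0.
  by rewrite !addr0 /fps_one mulr1.
elim/ltn_ind: n => n IH.
have := hr n.+1; rewrite -hr' /fps_mul !(big_ord_recl n.+1) -!eh h0 !mul0r !add0r.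
rewrite !(big_ord_recl n) /= -eh /bump /= !add1n subSS subn0 h1 !mul1r.
rewrite (eq_bigr (fun i : 'I_n => h' i.+2 *
  (fps_one (n.+1 - i.+2)%N + r' (n.+1 - i.+2)%N))) => [/addIr/addrI//|i _].
by rewrite !add1n eh IH // subSS ltn_subrL /= (leq_ltn_trans _ (ltn_ord i)).
Qed.

End FormalPowerSeries.

Section KerovPolynomial.
Variable R : realType.
Implicit Types la ks : seq nat.

Definition young_region la : set (R * R) :=
  [set p : R * R | exists j : nat, 0 < p.1 < (nth 0%N la j)%:R
                                   /\ j%:R < p.2 < j.+1%:R]%classic.

(* Zero for [n < 2]. *)
Definition shape_functional la (n : nat) : R :=
  n.-1%:R * \int[(lebesgue_measure \x lebesgue_measure)%E]_(p in young_region la)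
             (p.1 - p.2) ^+ (n - 2).

(* Coefficients of the Cauchy transform with respect to the powers of 1/z. *)
Definition cauchy_series la : nat -> R :=
  fps_mul (fps_X R) (fps_exp (shape_functional la)).

Definition free_cumulant la : nat -> R :=
  xget (fun=> 0) [set r | is_free_cumulants (cauchy_series la) r]%classic.

Lemma free_cumulantP la : is_free_cumulants (cauchy_series la) (free_cumulant la).
Proof.
suff [r rP] : exists r, is_free_cumulants (cauchy_series la) r.
  exact: (xgetPex (fun=> 0) (ex_intro _ r rP)).
have S0 : shape_functional la 0 = 0 by rewrite /shape_functional mul0r.
have S1 : shape_functional la 1 = 0 by rewrite /shape_functional mul0r.
apply: is_free_cumulants_ex; rewrite /cauchy_series /fps_mul !big_ord_recl big_ord0.
- by rewrite mul0r add0r.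
- by rewrite mul0r mul1r add0r addr0 /fps_exp fps_comp0 fact0 invr1.
rewrite !mul0r mul1r add0r !addr0 /fps_exp /fps_comp !big_ord_recl big_ord0.
by rewrite fps_pow1 S1 mulr0 /fps_pow /= ?mulr0 !addr0.
Qed.

(* The indeterminate of index [j] stands for [R_(j + 2)]. *)
Definition kerov_eval (K : {malg int[{cmonom nat}]}) (r : nat -> R) : R :=
  mmap intr (fun m : {cmonom nat} => \prod_(j <- finsupp m) r j.+2 ^+ m j) K.

Definition is_kerov_polynomial ks (K : {malg int[{cmonom nat}]}) : Prop :=
  forall la, is_part la ->
    (-1) ^+ (size ks).-1 * cumulant (norm_character_seq R[i] la) ks
    = (kerov_eval K (free_cumulant la))%:C%C.

End KerovPolynomial.

Section Triples.
Variables (ks : seq nat) (s : {cmonom nat}).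
Local Notation N := (sumn ks).

(* In ['S_N], [s2 * s1] is the composite of [s1] after [s2]. A coloring of the
   cycles of [s2] is extended by 0 outside [porbits s2]; as above, [s j] is the
   exponent of [R_(j + 2)]. *)
Record is_kerov_triple (s1 s2 : 'S_N) (q : {ffun {set 'I_N} -> nat}) : Prop := {
  kt_prod : (s2 * s1)%g = block_cycle ks;
  kt_trans : [transitive <<[set s1; s2]>>%g, on [set: 'I_N] | 'P];
  kt_cycles2 : #|porbits s2| = (\sum_(j <- finsupp s) s j)%N;
  kt_cycles12 :
    (#|porbits s1| + #|porbits s2|)%N = (\sum_(j <- finsupp s) j.+2 * s j)%N;
  kt_coloring : q \in pffun_on 0%N (mem (porbits s2)) (leq 2);
  kt_colors : forall j : nat, #|[set c in porbits s2 | q c == j.+2]| = s j;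
  kt_intersect : forall A : {set {set 'I_N}},
    A \subset porbits s2 -> A != set0 -> A != porbits s2 ->
    (\sum_(c in A) (q c - 1) < #|[set d in porbits s1 | d :&: cover A != set0]|)%N
}.

Definition kerov_triples : set ('S_N * 'S_N * {ffun {set 'I_N} -> nat}) :=
  [set t | is_kerov_triple t.1.1 t.1.2 t.2]%classic.

End Triples.

Arguments kerov_triples : clear implicits.

(* Main.v *)
Require Import Defs.
From mathcomp Require Import finmap monalg complex.
From mathcomp Require Import all_classical all_reals all_analysis measurable_realfun.
From mathcomp Require Import all_boot all_order all_algebra all_fingroup mxrepresentation.
From mathcomp Require Import ring lra zify.

(** The argument has three ingredients: a formula for characters as signed counts
of graph embeddings, the remark that the free cumulants are governed by the
same kind of counts, and a transfer principle which turns a linear relation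
between the counts into an identity between formal power series.

Characters.  For a pair of permutations [(s1, s2)] consider the bipartite graph
whose white vertices are the cycles of [s1], whose black vertices are the cycles
of [s2], and whose edges join intersecting cycles.  The normalized character of
[p] on a Young diagram is the sum over the factorizations [s2 * s1 = p] of the
sign of [s1] times the number of ways to send the white vertices to columns and
the black vertices to rows so that each point of the permuted set is sent to a
box of the diagram ([norm_character_placements]; the trace on the Specht module
is computed from the Young symmetrizer, whose coefficients are characterized by
their behaviour under row and column permutations).  Signs and counts are
multiplicative over the orbits of the group generated by [s1] and [s2], so that
passing to cumulants selects the transitive pairs ([cumulant_connected]).

Layers.  Filling the diagram row after row expresses the number of embeddings by
the function [g] which maps a set of black vertices to the number of white
vertices with all their neighbours in this set: it is a sum over chains of
black sets, one step per row, of the products of the powers [q ^ (g D - g A)]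
for a step from [A] to [D] in a row of length [q] ([layer_count],
[box_count_layers]).  The integrals which define the moments of a diagram are
combinations of such counts for complete bipartite graphs
([shape_functionalE]); by Lagrange inversion the free cumulants are polynomials
in the moments ([free_cumulants_lagrange], [expressible_poly]), and a product of
counts is the count of a disjoint union.  Hence the relation which defines the
Kerov polynomial is a linear relation between layer counts, of disjoint unions
of complete bipartite graphs on one side and of connected graphs of
factorizations on the other.

Transfer.  Such a relation survives the addition of [p] rows of length [q] to
the diagram, for all [p] and all large [q].  Both sides are polynomials in [p]
and [q], so each coefficient gives a new relation ([vanishes_layers]).
Iterating this, the functional [chi], attached to an arbitrary polynomial [X] in
one variable, also satisfies the relation ([vanishes_chi]).  It is a sum over
colorings of the black vertices by exponents of [X], weighted by signed sums
over chains of black sets [E] whose total color is at most [g E]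
([chi_colorings]).  These signed sums are reduced Euler characteristics of
posets.  For a connected graph the poset contracts to a cone unless every
proper nonempty set of black vertices has total color more than [g], which is
condition (e) for the complementary set ([chain_sum_connected],
[card_cycles_meeting]).  For a disjoint union of complete bipartite graphs it is
a boolean lattice when all components are balanced, and a cone otherwise
([chain_sum_union]), so that [chi] is a product of coefficients of powers of
[X].  When the coefficients of [X] are indeterminates, these are the moments
whose Lagrange inversion returns the indeterminates themselves
([lagrange_related_truncated]).  The relation thus becomes the equality of the
Kerov polynomial, in formal variables, with the sum over transitive
factorizations and strict colorings of the monomials of the colors; the signs
cancel by parity ([factorization_sign]).  Comparing coefficients gives the
theorem, a cycle of color [k] in the proof being one with [q = k + 1]. *)

Set Implicit Arguments.
Unset Strict Implicit.
Unset Printing Implicit Defensive.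

Import Order.TTheory GRing.Theory Num.Theory.
Local Open Scope ring_scope.

(** * Layer counts *)

(** The binomial theorem for the subsets of [A' :\: A]: expand a product over the
whole type in which an element of [A] or outside [A'] has a single choice. *)
Lemma sum_interval_expr (R : comNzSemiRingType) (T : finType) (x : R)
    (A A' : {set T}) : A \subset A' ->
  \sum_(D : {set T} | (A \subset D) && (D \subset A')) x ^+ #|A' :\: D|
  = (1 + x) ^+ #|A' :\: A|.
Proof.
move=> sAA'; pose F (i : T) : R := (i \in A')%:R.
pose G (i : T) : R := if i \in A then 0 else if i \in A' then x else 1.
transitivity (\prod_i (F i + G i)); last first.
  rewrite (bigID (mem (A' :\: A))) /= [X in _ * X]big1 => [|i].
    rewrite mulr1 (eq_bigr (fun=> 1 + x)) ?prodr_const // => i.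
    by rewrite !inE /F /G => /andP[/negbTE-> ->].
  rewrite inE negb_and negbK /F /G; case: ifP => [iA _|_ /=].
    by rewrite (subsetP sAA' _ iA) addr0.
  by move=> /negbTE->; rewrite add0r.
rewrite bigA_distr [RHS](bigID (fun D : {set T} => (A \subset D) && (D \subset A'))) /=.
rewrite [X in _ + X]big1 ?addr0 => [|D].
  apply: eq_bigr => D /andP[sAD sDA'].
  rewrite (bigID (mem (A' :\: D))) /= [X in _ * X]big1 => [|i].
    rewrite mulr1 (eq_bigr (fun=> x)) ?prodr_const // => i.
    rewrite !inE /G => /andP[iD ->]; rewrite (negbTE iD) ifN //.
    by apply: contra iD; apply/subsetP.
  rewrite inE negb_and negbK /F /G; case: ifP => [iD _|iD /= iA'].
    by rewrite (subsetP sDA' _ iD).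
  by rewrite (negbTE iA') ifN //; apply: contraFN iD; apply/subsetP.
rewrite negb_and => /orP[/subsetPn[i iA iD]|/subsetPn[i iD iA']].
  by rewrite (bigD1 i) //= (negbTE iD) /G iA mul0r.
by rewrite (bigD1 i) //= iD /F (negbTE iA') mul0r.
Qed.

Section LayerCount.
Variables (T : finType) (B : {set T}) (g : {set T} -> nat).

(** For a graph with black vertices [B] and, for each [D], [g D] white vertices with
all neighbours in [D], this counts the embeddings into the Young diagram [la] when
the black vertices of [A] are already placed: the black vertices of [D :\: A] go
to the first row, of length [x], and each of the white vertices which are
captured by [D] and not by [A] chooses one of its [x] columns. *)
Fixpoint layer_count (la : seq nat) (A : {set T}) : nat :=
  if la is x :: la' then
    \sum_(D : {set T} | (A \subset D) && (D \subset B))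
      x ^ (g D - g A) * layer_count la' D
  else (A == B).

Hypothesis g_mono : forall A D : {set T}, A \subset D -> (g A <= g D)%N.

Lemma layer_count_out la (A : {set T}) : ~~ (A \subset B) -> layer_count la A = 0%N.
Proof.
move=> nAB; case: la => [|x la] /=.
  by case: eqP => // AB; rewrite AB subxx in nAB.
rewrite big1 // => D /andP[sAD sDB]; case/negP: nAB; exact: subset_trans sDB.
Qed.

(** A black vertex placed among [p] equal rows chooses one of them, while the
widths only see the union [D] of the layers. This makes the count polynomial in
[p] and in [q]. *)
Lemma layer_count_nseq (R : comNzSemiRingType) p q la (A : {set T}) :
  (layer_count (nseq p q ++ la) A)%:R =
    \sum_(D : {set T} | (A \subset D) && (D \subset B))
      p%:R ^+ #|D :\: A| * q%:R ^+ (g D - g A) * (layer_count la D)%:R :> R.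
Proof.
elim: p A => [|p IH] A.
  have [sAB|nAB] := boolP (A \subset B); last first.
    rewrite layer_count_out // big1 // => D /andP[sAD sDB].
    by case/negP: nAB; exact: subset_trans sDB.
  rewrite (bigD1 A) ?subxx //= setDv cards0 subnn !mul1r big1 ?addr0 // => D.
  case/andP=> /andP[sAD sDB] nDA; rewrite expr0n cards_eq0 setD_eq0.
  by rewrite -[D \subset A]andbT -sAD -eqEsubset (negbTE nDA) !mul0r.
rewrite /= natr_sum.
under eq_bigr do rewrite natrM IH natrX mulr_sumr.
rewrite (exchange_big_dep (fun D : {set T} => (A \subset D) && (D \subset B))) /=.
  apply: eq_bigr => E /andP[sAE sEB].
  rewrite -natr1 addrC -(sum_interval_expr _ sAE) !mulr_suml.
  apply: eq_big => [D|D /andP[/andP[sAD sDB] /andP[sDE _]]].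
    case sAD: (A \subset D) => //=.
    by case sDE: (D \subset E); rewrite ?andbF //= sEB andbT (subset_trans sDE).
  rewrite mulrCA -!mulrA; congr (_ * _); rewrite !mulrA -exprD.
  by rewrite addnBA ?g_mono // subnK ?g_mono.
by move=> D E /andP[sAD sDB] /andP[sDE sEB]; rewrite (subset_trans sAD).
Qed.

End LayerCount.

(** * Linear relations between layer counts *)

(** The graphs enter the argument only through the monotone function which counts
the white vertices captured by a set of black vertices. *)
Record set_function := SetFunction {
  ground : finType;
  full : {set ground};
  height :> {set ground} -> nat;
  height_mono : forall A D : {set ground}, A \subset D -> (height A <= height D)%N }.

Section States.
Variables (J : Type) (family : J -> set_function).

(** States of different graphs have to be mixed in one linear combination. They
are indexed through a family, rather than packed with their graph, to keep
the type of states in a universe where sums over it can be exchanged. *)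
Record state := State { state_index : J; state_set : {set ground (family state_index)} }.

Definition state_fun (G : state) : set_function := family (state_index G).

Definition state_count (G : state) (la : seq nat) : nat :=
  layer_count (full (state_fun G)) (state_fun G) la (state_set G).

Definition state_height (G : state) : nat := state_fun G (state_set G).

Definition is_layer (G : state) (D : {set ground (state_fun G)}) : bool :=
  (state_set G \subset D) && (D \subset full (state_fun G)).

Definition layers (l e : nat) (G : state) : seq state :=
  [seq (State D : state) | D : {set ground (state_fun G)} <- index_enum _ & [&& is_layer D,
      #|D :\: state_set G| == l & (state_fun G D - state_height G)%N == e]].

Definition combo (F : Type) := seq (F * state).

Definition combo_layers F l e (c : combo F) : combo F :=
  flatten [seq [seq (aG.1, G') | G' <- layers l e aG.2] | aG <- c].

End States.

Lemma poly_nat_eq0 (F : numDomainType) n0 (p : {poly F}) :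
  (forall n, (n0 <= n)%N -> p.[n%:R] = 0) -> p = 0.
Proof.
move=> p0; apply/eqP; case: (eqVneq p 0) => // nz; exfalso.
(* A nonzero polynomial has fewer roots than its size. *)
pose rs : seq F := [seq i%:R | i <- iota n0 (size p)].
suff: (size rs < size p)%N by rewrite size_map size_iota ltnn.
apply: (max_poly_roots nz).
  apply/allP => _ /mapP[i ins ->]; rewrite /root p0 //.
  by move: ins; rewrite mem_iota => /andP[].
rewrite map_inj_uniq ?iota_uniq // => i j /eqP.
by rewrite eqr_nat => /eqP.
Qed.

Section Combos.
Variables (J : Type) (family : J -> set_function) (F : numFieldType).
Local Notation state := (state family).
Local Notation combo := (combo family F).
Implicit Types c : combo.

Definition vanishes c : Prop := forall la, sorted geq la && (0%N \notin la) ->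
  \sum_(aG <- c) aG.1 * (state_count aG.2 la)%:R = 0.

Lemma sum_combo_layers (V : lmodType F) (f : state -> V) l e c :
  \sum_(aG <- combo_layers l e c) aG.1 *: f aG.2
  = \sum_(aG <- c) \sum_(D : {set ground (state_fun aG.2)} | [&& is_layer D,
      #|D :\: state_set aG.2| == l & (state_fun aG.2 D - state_height aG.2)%N == e])
      aG.1 *: f (State (family := family) D).
Proof.
rewrite big_flatten big_map; apply: eq_bigr => -[a G] _ /=.
by rewrite big_map /layers big_map big_filter.
Qed.

(** Prepend [p] rows of length [q] to the diagrams of a relation. The result is
zero for all [p] and all large [q], hence as a polynomial in [p] and [q]; the
coefficient of [p ^ l * q ^ e] is the asserted relation. *)
Lemma vanishes_layers l e c : vanishes c -> vanishes (combo_layers l e c).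
Proof.
move=> c0 la laP.
pose term (aG : F * state) (D : {set ground (state_fun aG.2)}) : F :=
  aG.1 * (state_count (State (family := family) D) la)%:R.
pose Pe l' q := \sum_(aG <- c) \sum_(D : {set ground (state_fun aG.2)} |
   is_layer D && (#|D :\: state_set aG.2| == l'))
     term aG D * q%:R ^+ (state_fun aG.2 D - state_height aG.2).
have Pe0 q : (maxn 1 (head 0%N la) <= q)%N -> Pe l q = 0.
  rewrite geq_max => /andP[q0 lq].
  (* First extract the coefficient in [p], for fixed [q]: the rows have to be at least as long as the first row of [la]. *)
  pose P : {poly F} := \sum_(aG <- c) \sum_(D : {set ground (state_fun aG.2)} | is_layer D)
    (term aG D * q%:R ^+ (state_fun aG.2 D - state_height aG.2))
      *: 'X^#|D :\: state_set aG.2|.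
  have P0 : P = 0.
    apply: (@poly_nat_eq0 _ 0) => p _; rewrite -[RHS](c0 (nseq p q ++ la)).
      rewrite /P horner_sum; apply: eq_bigr => -[a G] _ /=.
      rewrite horner_sum /state_count layer_count_nseq ?mulr_sumr; last first.
        exact: height_mono.
      apply: eq_bigr => D _; rewrite hornerZ hornerXn /term /=.
      ring.
    case/andP: laP => so n0; rewrite mem_cat mem_nseq negb_or n0 andbT.
    rewrite [(0 == q)%N]eq_sym (gtn_eqF q0) andbF andbT.
    have : path geq q la by case: (la) so lq => //= y la' -> ->.
    elim: p => [|p IHp] sq //=.
    by elim: p {IHp} => //= p ->; rewrite leqnn.
  transitivity (P`_l); last by rewrite P0 coef0.
rewrite /P coef_sum.
  apply: eq_bigr => -[a G] _ /=; rewrite coef_sum big_mkcondr /=.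
  apply: eq_bigr => D _; rewrite coefZ coefXn eq_sym.
  by case: eqP => _; rewrite ?mulr1 ?mulr0.
pose Q : {poly F} := \sum_(aG <- c) \sum_(D : {set ground (state_fun aG.2)} |
   is_layer D && (#|D :\: state_set aG.2| == l))
     term aG D *: 'X^(state_fun aG.2 D - state_height aG.2).
have Q0 : Q = 0.
  apply: (@poly_nat_eq0 _ (maxn 1 (head 0%N la))) => q hq.
  rewrite -[RHS](Pe0 q) // /Q horner_sum; apply: eq_bigr => -[a G] _ /=.
  by rewrite horner_sum; apply: eq_bigr => D _; rewrite hornerZ hornerXn.
transitivity (Q`_e); last by rewrite Q0 coef0.
rewrite /Q coef_sum.
transitivity (\sum_(aG <- combo_layers l e c)
   aG.1 *: ((state_count aG.2 la)%:R : F^o)); first by [].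
rewrite (sum_combo_layers (fun G => (state_count G la)%:R)).
apply: eq_bigr => -[a G] _ /=; rewrite coef_sum.
under [LHS]eq_bigl do rewrite andbA.
rewrite big_mkcondr /=; apply: eq_bigr => D _; rewrite coefZ coefXn eq_sym.
by case: eqP => _; rewrite ?mulr1 ?mulr0.
Qed.

Variables (A : comAlgType F) (X : {poly A}).

(** Placing a layer of [l] black vertices is weighted by a coefficient of [X ^ l]. Its
degree need not be the number of captured white vertices: the total degree [u]
consumed so far may not exceed this number, and equality is required at the end
only. The alternating sum over chains of layers makes [chi] accessible to the
relations of [vanishes_layers]. The bound [n] on the number of layers makes the
recursion structural. *)
Fixpoint chi n (G : state) (t : nat) : A :=
  ((state_set G == full (state_fun G)) && (t == state_height G))%:R -
  (if n is n'.+1 then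
     \sum_(D : {set ground (state_fun G)} | is_layer D && (D != state_set G))
       \sum_(u < (state_fun G D).+1 | (t <= u)%N)
         (X ^+ #|D :\: state_set G|)`_(u - t) * chi n' (State (family := family) D) u
   else 0).

Lemma eq_big_all (V : nmodType) (I : Type) (P : pred I) (s : seq I) (f f' : I -> V) :
  all P s -> (forall i, P i -> f i = f' i) -> \sum_(i <- s) f i = \sum_(i <- s) f' i.
Proof.
move=> + ff; elim: s => [|i s IH] /=; first by rewrite !big_nil.
by rewrite !big_cons => /andP[/ff-> /IH->].
Qed.

Lemma all_height_layers l e h c :
  all (fun aG => state_height aG.2 == h) c ->
  all (fun aG => state_height aG.2 == (h + e)%N) (combo_layers l e c).
Proof.
elim: c => //= -[a G] c IH /andP[/eqP hG hc].
rewrite all_cat IH // andbT all_map /layers all_map all_filter /=.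
apply/allP => D _ /=.
apply/implyP => /and3P[hD _ /eqP <-]; rewrite /state_height /= -hG subnKC //.
by case/andP: hD => sD _; apply: height_mono.
Qed.

Lemma all_bounded (I : Type) (f : I -> nat) (s : seq I) :
  exists L, all (fun i => f i < L)%N s.
Proof.
elim: s => [|i s [L hL]]; first by exists 0%N.
exists (maxn L (f i).+1); rewrite /= leq_maxr /=; apply: sub_all hL => j /= jL.
by rewrite leq_max jL.
Qed.

Lemma vanishes_chi0 c t h : vanishes c ->
  all (fun aG => state_height aG.2 == h) c ->
  \sum_(aG <- c) aG.1 *: chi 0 aG.2 t = 0.
Proof.
move=> c0 hh; rewrite (eq_big_all (f' := fun aG : F * state =>
  (t == h)%:R * (aG.1 * (state_count aG.2 [::])%:R)%:A) hh).
  rewrite -mulr_sumr; under eq_bigr do rewrite -in_algE.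
  by rewrite -raddf_sum c0 //= scale0r mulr0.
move=> [a G] /= /eqP <-; rewrite subr0 /state_count /=.
by do 2 case: eqP => _ /=; rewrite ?mulr1 ?mulr0 ?mul1r ?mul0r ?scale0r ?scaler0.
Qed.

(** In the recursion for [chi] the layers can be grouped according to their size
[l] and the number [e] of captured vertices; each group is again a relation,
by [vanishes_layers], and its states have a common height, so that induction
applies to it. *)
Lemma vanishes_chi n c t h : vanishes c ->
  all (fun aG => state_height aG.2 == h) c ->
  \sum_(aG <- c) aG.1 *: chi n aG.2 t = 0.
Proof.
elim: n c t h => [|n IH] c t h c0 hh; first exact: vanishes_chi0 hh.
have -> : \sum_(aG <- c) aG.1 *: chi n.+1 aG.2 t = \sum_(aG <- c) aG.1 *: chi 0 aG.2 t
  - \sum_(aG <- c) aG.1 *: (\sum_(D : {set ground (state_fun aG.2)} |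
       is_layer D && (D != state_set aG.2))
       \sum_(u < (state_fun aG.2 D).+1 | (t <= u)%N)
         (X ^+ #|D :\: state_set aG.2|)`_(u - t) * chi n (State (family := family) D) u).
  by rewrite -sumrB; apply: eq_bigr => aG _; rewrite /= -scalerBr subr0.
rewrite (vanishes_chi0 _ c0 hh) sub0r.
have [L hL] := all_bounded (fun aG => #|ground (state_fun aG.2)|) c.
have [H hH] := all_bounded (fun aG => state_fun aG.2 (full (state_fun aG.2))) c.
pose f l G : A := \sum_(u < (state_height G).+1 | (t <= u)%N)
   (X ^+ l)`_(u - t) * chi n G u.
have f0 l e : \sum_(aG <- combo_layers l e c) aG.1 *: f l aG.2 = 0.
  have hc' := all_height_layers l e hh.
  transitivity (\sum_(aG <- combo_layers l e c) \sum_(u < (h + e).+1 | (t <= u)%N)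
     (X ^+ l)`_(u - t) * (aG.1 *: chi n aG.2 u)); last first.
    rewrite exchange_big /= big1 // => u _; rewrite -mulr_sumr.
    by rewrite (IH _ _ (h + e)%N) ?mulr0 //; apply: vanishes_layers.
  apply: (eq_big_all hc') => -[a G] /= /eqP eh; rewrite /f eh scaler_sumr; apply: eq_bigr => u _.
  by rewrite scalerAr.
transitivity (- \sum_(l < L | (0 < l)%N) \sum_(e < H) \sum_(aG <- combo_layers l e c)
   aG.1 *: f l aG.2); last first.
  by rewrite big1 ?oppr0 // => l _; rewrite big1.
congr (- _); under [RHS]eq_bigr do under eq_bigr do rewrite sum_combo_layers.
under [RHS]eq_bigr do rewrite exchange_big /=.
rewrite [RHS]exchange_big /=.
have hLH : all (fun aG => (#|ground (state_fun aG.2)| < L)%N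
   && (state_fun aG.2 (full (state_fun aG.2)) < H)%N) c by rewrite all_predI hL.
apply: (eq_big_all hLH) => -[a G] /= /andP[gL gH].
transitivity (\sum_(D : {set ground (state_fun G)} | is_layer D)
  \sum_(l < L | (0 < l)%N) \sum_(e < H) (if (#|D :\: state_set G| == l) &&
    ((state_fun G D - state_height G)%N == e) then a *: f l (State (family := family) D) else 0)).
  rewrite scaler_sumr big_mkcondr /=; apply: eq_bigr => D hD.
  have [sGD sDf] := andP hD.
  have kL : (#|D :\: state_set G| < L)%N by apply: leq_ltn_trans (max_card _) gL.
  have eH : (state_fun G D - state_height G < H)%N.
    by rewrite (leq_ltn_trans _ gH) // (leq_trans (leq_subr _ _)) ?height_mono.
  rewrite (eq_bigr (fun l : 'I_L => if l == Ordinal kL then a *: f l (State (family := family) D) else 0)).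
    rewrite -big_mkcondr /= (eq_bigl (fun l : 'I_L => (D != state_set G) && (l == Ordinal kL))).
      by case: (D != _); rewrite /= ?big_pred0_eq ?big_pred1_eq.
    move=> l /=; rewrite andbC [RHS]andbC; case: eqP => // ->.
    by rewrite card_gt0 setD_eq0 eqEsubset sGD andbT.
  move=> l _; rewrite -val_eqE /= eq_sym; case: eqP => _ /=; last by rewrite big1.
  by rewrite -big_mkcond (big_pred1 (Ordinal eH)).
rewrite exchange_big /=; apply: eq_bigr => l _.
rewrite exchange_big /=; apply: eq_bigr => e _.
by rewrite -big_mkcondr /=.
Qed.
End Combos.

(** * Weights as sums over colorings *)

Section Colorings.
Variables (T : finType) (M : nat).
Implicit Types (D E : {set T}) (k : {ffun T -> 'I_M.+1}).

Definition supported D k := [forall b, (b \notin D) ==> (k b == ord0)].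

Definition total k D : nat := \sum_(b in D) k b.

Definition splice D k1 k2 : {ffun T -> 'I_M.+1} :=
  [ffun b => if b \in D then k1 b else k2 b].

Lemma supportedP D k : reflect (forall b, b \notin D -> k b = ord0) (supported D k).
Proof.
apply: (iffP forallP) => h b; first by move=> bD; apply/eqP/(implyP (h b)).
by apply/implyP => /h ->.
Qed.

Lemma sum_supported_split (V : nmodType) D E (f : {ffun T -> 'I_M.+1} -> V) :
  D \subset E ->
  \sum_(k | supported E k) f k =
  \sum_(k1 | supported D k1) \sum_(k2 | supported (E :\: D) k2) f (splice D k1 k2).
Proof.
move=> sDE; pose p1 k := splice D k [ffun=> ord0]; pose p2 k := splice D [ffun=> ord0] k.
rewrite (partition_big p1 (supported D)) /=; last first.
  by move=> k _; apply/supportedP => b bD; rewrite !ffunE (negbTE bD).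
apply: eq_bigr => k1 /supportedP s1.
rewrite (reindex_onto (splice D k1) p2) /=; last first.
  move=> k /andP[_ /eqP <-]; apply/ffunP => b; rewrite !ffunE.
  by case: ifP => // bD; rewrite bD.
apply: eq_bigl => k2; apply/andP/supportedP => [[/andP[/supportedP s2 _] /eqP e] b|s2].
  rewrite inE negb_and negbK; case bD: (b \in D) => /= hb.
    by rewrite -e !ffunE bD.
  by have := s2 b hb; rewrite !ffunE bD.
split; last first.
  apply/eqP/ffunP => b; rewrite !ffunE; case: ifP => bD; last by rewrite bD.
  by rewrite s2 // inE bD.
apply/andP; split.
  apply/supportedP => b bE; rewrite ffunE ifN ?s2 //; first by rewrite inE (negbTE bE) andbF.
  by apply: contra bE; apply/subsetP.
by apply/eqP/ffunP => b; rewrite !ffunE; case bD: (b \in D) => //; rewrite s1 ?bD.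
Qed.

Lemma eq_total k k' D : {in D, k =1 k'} -> total k D = total k' D.
Proof. by move=> e; apply: eq_bigr => b /e ->. Qed.

Lemma totalD k D E : D \subset E -> total k E = (total k D + total k (E :\: D))%N.
Proof. by move=> sDE; rewrite /total (big_setID D) /= (setIidPr sDE). Qed.

(** Choosing a monomial in each factor of the power amounts to coloring its
factors by exponents. *)
Lemma coef_color_poly (A : comNzRingType) (x : nat -> A) D u :
  ((\poly_(j < M.+1) x j) ^+ #|D|)`_u =
  \sum_(k | supported D k && (total k D == u)) \prod_(b in D) x (k b).
Proof.
rewrite -prodr_const poly_def.
under eq_bigr do rewrite -(big_mkcond xpredT).
rewrite (big_distr_big ord0) coef_sum [RHS]big_mkcondr /=.
apply: eq_big => [k|k _].
  apply/pffun_onP/supportedP => [[/subsetP sD _] b bD|sD].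
    by apply/eqP; apply: contraNT bD => kb; exact: sD.
  split; last by move=> b _.
  by apply/subsetP => b; apply: contraLR => bD; rewrite unfold_in /= sD //= eqxx.
rewrite scaler_prod prodrXr coefZ coefXn eq_sym.
by case: eqP; rewrite ?mulr1 ?mulr0.
Qed.

End Colorings.

Section ChainSum.
Variables (R : pzRingType) (T : finType) (B : {set T}).
Implicit Types (Q : pred {set T}) (D E : {set T}).

(** When [B] is in [Q], this is the Moebius function of the interval from [D] to [B]
in the poset formed by [D] and the members of [Q], if [n] is at least the length
of the chains. *)
Fixpoint chain_sum Q n D : R :=
  (D == B)%:R - (if n is n'.+1 then
    \sum_(E : {set T} | [&& D \subset E, E \subset B, E != D & Q E]) chain_sum Q n' E
  else 0).

Lemma eq_chain_sum Q Q' n D :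
  (forall E, D \subset E -> Q E = Q' E) -> chain_sum Q n D = chain_sum Q' n D.
Proof.
elim: n D => [//|n IH] D eQ /=; congr (_ - _).
apply: eq_big => [E|E /and4P[sDE _ _ _]]; first by case sDE: (D \subset E); rewrite // eQ.
by apply: IH => E' sE; rewrite eQ // (subset_trans sDE).
Qed.
End ChainSum.

Section Evaluation.
Variables (J : Type) (family : J -> set_function) (F : numFieldType) (A : comAlgType F).
Variables (M : nat) (x : nat -> A) (j : J).
Local Notation T := (ground (family j)).
Local Notation B := (full (family j)).
Local Notation g := (height (s := family j)).
Local Notation X := (\poly_(i < M.+1) x i).

Lemma colorings_full (D : {set T}) t :
  \sum_(k : {ffun T -> 'I_M.+1} | supported (B :\: D) k)
    (\prod_(b in B :\: D) x (k b)) * ((t + total k (B :\: D))%N == g B)%:R * (D == B)%:R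
  = ((D == B) && (t == g D))%:R :> A.
Proof.
case: eqP => [->|_] /=; last by rewrite big1 // => k _; rewrite mulr0.
rewrite setDv (big_pred1 [ffun=> ord0]) => [|k].
  by rewrite big_set0 mul1r mulr1 /total big_set0 addn0.
apply/supportedP/eqP => [h|-> b _]; last by rewrite ffunE.
by apply/ffunP => b; rewrite h ?inE // ffunE.
Qed.

(** Expanding the powers of [X] layer by layer colors all the black vertices once
the last layer reaches [B]. For a fixed coloring, the degree conditions on the
layers say that their chain stays among the sets [E] of small total color. *)
Lemma chi_colorings n (D : {set T}) t : D \subset B ->
  chi X n (State (family := family) D) t =
  \sum_(k : {ffun T -> 'I_M.+1} | supported (B :\: D) k)
    (\prod_(b in B :\: D) x (k b)) * ((t + total k (B :\: D))%N == g B)%:R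
     * chain_sum A B (fun E => (t + total k (E :\: D) <= g E)%N) n D.
Proof.
elim: n D t => [|n IH] D t sDB /=.
  rewrite subr0 /state_height /state_fun /= -colorings_full.
  by apply: eq_bigr => k _; rewrite subr0.
under [RHS]eq_bigr do rewrite mulrBr.
rewrite sumrB /= colorings_full; congr (_ - _).
under [RHS]eq_bigr do rewrite mulr_sumr.
rewrite (exchange_big_dep (fun E => is_layer (G := State (family := family) D) E
  && (E != D))) /=; last first.
  by move=> k E _ /and4P[sDE sEB nED _]; rewrite /is_layer /state_fun /= sDE sEB nED.
apply: eq_bigr => E /andP[/andP[/= sDE sEB] nED].
have sED : E :\: D \subset B :\: D by apply: setSD.
rewrite (eq_bigl (fun k : {ffun T -> 'I_M.+1} => supported (B :\: D) k &&
  (t + total k (E :\: D) <= g E)%N)); last by move=> k; rewrite sDE sEB nED.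
rewrite big_mkcondr /= (sum_supported_split _ sED) /=.
have BDE : (B :\: D) :\: (E :\: D) = B :\: E.
  apply/setP => b; rewrite !inE; case bD: (b \in D) => //=.
  by rewrite (subsetP sDE b bD).
rewrite BDE /state_fun /=.
pose inner u := \sum_(k2 : {ffun T -> 'I_M.+1} | supported (B :\: E) k2)
  (\prod_(b in B :\: E) x (k2 b)) * ((u + total k2 (B :\: E))%N == g B)%:R
    * chain_sum A B (fun E' => (u + total k2 (E' :\: E) <= g E')%N) n E.
transitivity (\sum_(k1 : {ffun T -> 'I_M.+1} | supported (E :\: D) k1)
  if (t + total k1 (E :\: D) <= g E)%N
  then \prod_(b in E :\: D) x (k1 b) * inner (t + total k1 (E :\: D))%N else 0).
  under eq_bigr do rewrite coef_color_poly IH // mulr_suml.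
  rewrite (exchange_big_dep (supported (E :\: D))) /=; last by move=> u k _ /andP[].
  apply: eq_bigr => k1 s1; case: leqP => [ltE|gtE].
    rewrite (big_pred1 (@Ordinal (g E).+1 _ ltE)) //= => u; rewrite s1 /=; apply/esym.
    apply/eqP/andP => [->/=|[tu /eqP e]]; first by rewrite leq_addr addKn.
    by apply: val_inj; rewrite /= e subnKC.
  rewrite big_pred0 // => u; rewrite s1 /=; apply/negP => /andP[tu /eqP tot].
  by move: gtE; rewrite tot subnKC // ltnNge -ltnS ltn_ord.
apply: eq_bigr => k1 s1.
have t1 (k2 : {ffun T -> 'I_M.+1}) : total (splice (E :\: D) k1 k2) (E :\: D) = total k1 (E :\: D).
  by apply: eq_total => b bED; rewrite ffunE bED.
have t2 (k2 : {ffun T -> 'I_M.+1}) (E' : {set T}) : (E : {set T}) \subset E' ->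
    total (splice (E :\: D) k1 k2) (E' :\: D) = (total k1 (E :\: D) + total k2 (E' :\: E))%N.
  move=> sE; rewrite (totalD _ (setSD D sE)) t1; congr addn.
  rewrite -[RHS](_ : total k2 ((E' :\: D) :\: (E :\: D)) = _).
    by apply: eq_total => b; rewrite inE ffunE => /andP[/negbTE->].
  congr (total _ _); apply/setP => b; rewrite !inE; case bD: (b \in D) => //=.
  by rewrite (subsetP sDE b bD).
under [RHS]eq_bigr do rewrite t1.
case: ifP => hE; last by rewrite big1.
rewrite /inner mulr_sumr; apply: eq_bigr => k2 _.
rewrite !mulrA (t2 k2 B sEB) addnA; congr (_ * _ * _).
  rewrite [RHS](big_setID (E :\: D)) /= (setIidPr sED) BDE; congr (_ * _).
    by apply: eq_bigr => b bE; rewrite ffunE bE.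
  by apply: eq_bigr => b; rewrite !inE => /andP[/negbTE bE _]; rewrite ffunE inE bE andbF.
by apply: eq_chain_sum => E' sE; rewrite t2 // addnA.
Qed.

End Evaluation.

(** * Signed sums over chains of sets *)

Section ChainSumTheory.
Variables (R : pzRingType) (T : finType) (B : {set T}) (Q : pred {set T}).
Implicit Types (D E X : {set T}).
Local Notation c := (chain_sum R B Q #|B|).

Lemma chain_sum_stable n m D : D \subset B -> (#|B :\: D| <= n)%N -> (#|B :\: D| <= m)%N ->
  chain_sum R B Q n D = chain_sum R B Q m D.
Proof.
have no_above k E : E \subset B -> #|B :\: E| = 0%N ->
    chain_sum R B Q k E = (E == B)%:R.
  move=> sEB /eqP; rewrite cards_eq0 setD_eq0 => sBE.
  have -> : E = B by apply/eqP; rewrite eqEsubset sEB.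
  case: k => [|k] /=; first by rewrite subr0.
  rewrite big1 ?subr0 // => E' /and4P[h1 h2 /eqP[]].
  by apply/eqP; rewrite eqEsubset h2.
elim: n m D => [|n IH] [|m] D sDB; rewrite ?leqn0.
- by [].
- by move=> /eqP h _; rewrite !no_above.
- by move=> _ /eqP h; rewrite !no_above.
move=> hn hm /=; congr (_ - _); apply: eq_bigr => E /and4P[sDE sEB nED _].
have lt : (#|B :\: E| < #|B :\: D|)%N.
  apply: proper_card; rewrite properEneq setDS // andbT.
  apply: contraNneq nED => e; rewrite eqEsubset sDE andbT.
  apply/subsetP => b bE; apply: contraT => bD.
  have : b \in B :\: D by rewrite inE bD (subsetP sEB).
  by rewrite -e inE bE.
by apply: IH => //; rewrite -ltnS (leq_trans lt).
Qed.

Lemma chain_sumE D : D \subset B ->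
  c D = (D == B)%:R
    - \sum_(E : {set T} | [&& D \subset E, E \subset B, E != D & Q E]) c E.
Proof.
move=> sDB; rewrite (@chain_sum_stable #|B| #|B|.+1) //=.
- by rewrite subset_leq_card // subsetDl.
- by rewrite leqW // subset_leq_card // subsetDl.
Qed.

Lemma chain_sum_trivial : B != set0 -> Q B ->
  (forall E, E \subset B -> E != set0 -> E != B -> ~~ Q E) -> c set0 = -1.
Proof.
move=> B0 QB nQ; rewrite chain_sumE ?sub0set // eq_sym (negbTE B0) sub0r.
rewrite (big_pred1 B) => [|E].
  rewrite chain_sumE // eqxx big1 ?subr0 // => E /and4P[sBE sEB nE _].
  by case/eqP: nE; apply/eqP; rewrite eqEsubset sEB.
rewrite sub0set /=; apply/and3P/eqP => [[sEB nE0 QE]|->]; last by rewrite subxx.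
by apply/eqP/contraT => nEB; have := nQ E sEB nE0 nEB; rewrite QE.
Qed.

(** The map [E |-> E :&: X] retracts the poset onto the part below [X], so it is
contractible and the signed sum, a reduced Euler characteristic, is zero. The
proof is an induction on the fibers of the retraction. *)
Lemma chain_sum_cone X : B != set0 -> X \subset B -> X != B ->
  (forall E, E \subset B -> E != set0 -> Q E -> (E :&: X != set0) && Q (E :&: X)) ->
  c set0 = 0.
Proof.
move=> B0 sXB nXB hX.
pose P E := [&& E \subset B, E != set0 & Q E].
(* [S Y] is the sum over the fiber of the retraction above [Y]. *)
pose S Y := \sum_(E | P E && (E :&: X == Y)) c E.
have SE (Y : {set T}) : \sum_(E | P E && (Y \subset E :&: X)) c E =
            \sum_(Z | P Z && (Y \subset Z) && (Z \subset X)) S Z.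
  rewrite (partition_big (fun E => E :&: X)
    (fun Z => P Z && (Y \subset Z) && (Z \subset X))) /=; last first.
    move=> E /andP[/and3P[h1 h2 h3] sY]; rewrite sY subsetIr !andbT /P.
    have /andP[-> ->] := hX E h1 h2 h3; rewrite !andbT.
    by rewrite (subset_trans _ h1) // subsetIl.
  apply: eq_bigr => Z /andP[/andP[_ sYZ] _]; apply: eq_bigl => E.
  by case: (P E) => //=; case: eqP => [->|]; rewrite ?andbT ?andbF.
have S0 Y : P Y -> Y \subset X -> S Y = 0.
  have [n] := ubnP #|X :\: Y|; elim: n Y => // n IH Y hn PY sYX.
  have /and3P[sYB nY0 QY] := PY.
  have nYB : Y != B by apply: contraNneq nXB => e; rewrite eqEsubset sXB -e.
  have : \sum_(E | P E && (Y \subset E :&: X)) c E = 0.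
    rewrite (bigD1 Y) /=; last by rewrite PY subsetI subxx.
    rewrite (chain_sumE sYB) (negbTE nYB) sub0r addrC; apply/eqP.
    rewrite subr_eq0; apply/eqP/eq_bigl => E.
    rewrite subsetI sYX andbT /P; case sYE: (Y \subset E); rewrite ?andbF //= andbT.
    case: (E \subset B) => //=; have -> : E != set0; last by rewrite andbC.
    by apply: contraNneq nY0 => E0; rewrite -subset0 -E0.
  rewrite SE (bigD1 Y) /= ?PY ?subxx ?sYX // big1 ?addr0 // => Z.
  case/andP=> /andP[/andP[PZ sYZ] sZX] nZY; apply: IH => //.
  rewrite -ltnS (leq_trans _ hn) // ltnS; apply: proper_card.
  rewrite properEneq setDS // andbT.
  apply: contraNneq nZY => e; rewrite eqEsubset sYZ andbT.
  apply/subsetP => b bZ; apply: contraT => bY.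
  have : b \in X :\: Y by rewrite inE bY (subsetP sZX).
  by rewrite -e inE bZ.
rewrite chain_sumE ?sub0set // eq_sym (negbTE B0) sub0r.
rewrite (eq_bigl (fun E => P E && (set0 \subset E :&: X))) => [|E]; last first.
  by rewrite !sub0set andbT.
rewrite SE big1 ?oppr0 // => Z /andP[/andP[PZ _] sZX]; exact: S0.
Qed.

(** Here [Q] selects the unions of fibers of [f], a poset isomorphic to the subsets
of [I]. *)
Lemma chain_sum_boolean (I : finType) (f : T -> I) :
  (forall i, exists2 b, b \in B & f b = i) ->
  (forall E, E \subset B -> Q E = (E == B :&: f @^-1: (f @: E))) ->
  c set0 = (-1) ^+ #|I|.
Proof.
move=> fB QE; pose h (J : {set I}) := B :&: f @^-1: J.
have hJ J : f @: h J = J.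
  apply/setP => i; apply/imsetP/idP => [[b /[!inE] /andP[_ bJ] ->]//|iJ].
  by have [b bB fb] := fB i; exists b; rewrite // !inE bB fb.
have sh J : h J \subset B by apply: subsetIl.
have hT : h setT = B by apply/setP => b; rewrite !inE andbT.
have h_inj : injective h by move=> J K e; rewrite -[J]hJ e hJ.
have hS J K : (h J \subset h K) = (J \subset K).
  apply/idP/idP => [sJK|sJK]; last by rewrite setIS // preimsetS.
  by rewrite -[J]hJ -[K]hJ imsetS.
suff cE J : c (h J) = (-1) ^+ #|~: J|.
  by have := cE set0; rewrite setC0 cardsT /h preimset0 setI0.
have [n] := ubnP #|~: J|; elim: n J => // n IH J hn.
rewrite chain_sumE // -[X in h J == X]hT (inj_eq h_inj).
have -> : \sum_(E : {set T} | [&& h J \subset E, E \subset B, E != h J & Q E]) c E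
    = \sum_(K : {set I} | (J \subset K) && (K != J)) c (h K).
  rewrite (reindex_onto h (fun E => f @: E)) /= => [|E /and4P[_ sE _ QE']].
    apply: eq_bigl => K; rewrite hS (inj_eq h_inj) sh hJ eqxx andbT /=.
    by rewrite QE // hJ eqxx andbT.
  by move: QE'; rewrite QE // => /eqP e; rewrite /h -e.
transitivity ((J == setT)%:R
    - (\sum_(K : {set I} | (J \subset K) && (K \subset setT)) (-1) ^+ #|setT :\: K|
       - (-1) ^+ #|~: J|) : R).
  congr (_ - _); rewrite [X in _ = X - _](bigD1 J) ?subxx ?subsetT //= setTD.
  rewrite addrAC subrr add0r; apply: eq_big => [K|K /andP[sJK nKJ]]; first by rewrite subsetT andbT.
  rewrite setTD IH // -ltnS (leq_trans _ hn) // ltnS; apply: proper_card.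
  by rewrite properEneq setCS sJK andbT (inj_eq (can_inj setCK)).
have -> : \sum_(K : {set I} | (J \subset K) && (K \subset setT)) (-1) ^+ #|setT :\: K|
    = (J == setT)%:R :> R; last by rewrite subKr.
have := @sum_interval_expr int I (-1) J setT (subsetT _).
rewrite addrN expr0n cards_eq0 setD_eq0 subTset => /(congr1 (fun z : int => z%:~R : R)).
rewrite rmorph_sum rmorph_nat => e; rewrite -[RHS]e; apply: eq_bigr => K _.
by rewrite rmorphXn rmorphN1.
Qed.

End ChainSumTheory.

(** * The polynomial of a connected graph *)

Lemma totalUI (T : finType) (M : nat) (k : {ffun T -> 'I_M.+1}) (A D : {set T}) :
  (total k (A :|: D) + total k (A :&: D) = total k A + total k D)%N.
Proof.
rewrite (totalD k (subsetUl A D)) setDUl setDv set0U.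
by rewrite (totalD k (subsetIr A D)) setDIr setDv setU0 addnAC -addnA.
Qed.

Section ConnectedChain.
Variables (R : pzRingType) (S : set_function) (M : nat).
Local Notation T := (ground S).
Local Notation B := (full S).
Hypothesis B0 : B != set0.
Hypothesis g0 : S set0 = 0%N.
Hypothesis g_super : forall A D : {set _}, A \subset B -> D \subset B ->
  (S A + S D <= S (A :|: D) + S (A :&: D))%N.
Hypothesis g_conn : forall A : {set _}, A \subset B -> A != set0 -> A != B ->
  (S A + S (B :\: A) < S B)%N.

(** Condition (e) of the theorem, seen from the complementary set of black
vertices: see [card_cycles_meeting]. *)
Definition strict_coloring (k : {ffun T -> 'I_M.+1}) : bool :=
  [forall A : {set T}, [&& A \subset B, A != set0 & A != B] ==> (S A < total k A)%N].

(** If the coloring is not strict, choose a proper nonempty set [X] which maximizes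
[S X - total k X], and has the largest cardinal among these. Since [S] is
supermodular, intersecting with [X] preserves the condition
[total k E <= S E]; connectedness excludes the degenerate case in which [E] and
[X] are complementary. The poset is then a cone. *)
Lemma chain_sum_connected (k : {ffun T -> 'I_M.+1}) : total k B = S B ->
  chain_sum R B (fun E => (total k E <= S E)%N) #|B| set0 = - (strict_coloring k)%:R.
Proof.
move=> kB; case: (boolP (strict_coloring k)) => [/forallP h|].
  apply: chain_sum_trivial => // [|E sE nE0 nEB]; first by rewrite kB.
  by rewrite -ltnNge; apply: (implyP (h E)); rewrite sE nE0.
rewrite negb_forall => /existsP[A0]; rewrite negb_imply -leqNgt.
set proper_part := fun A : {set T} => [&& A \subset B, A != set0 & A != B].
case/andP=> P0 Q0.
(* The factor [#|T|.+1] makes the lexicographic comparison of the difference and of the cardinal a comparison of integers. *)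
pose w (A : {set T}) : int := ((S A)%:Z - (total k A)%:Z) * (#|T|.+1)%:Z + #|A|%:Z.
rewrite mulr0n oppr0.
have [X /and3P[sXB nX0 nXB] maxX] : exists2 X, proper_part X &
    forall A, proper_part A -> w A <= w X.
  by case: (@arg_maxP _ _ _ A0 proper_part w) => // X PX hX; exists X.
have maxv A : proper_part A -> (S A + total k X <= S X + total k A)%N.
  move=> /maxX; rewrite /w => hw; rewrite leqNgt; apply/negP => lt.
  have cX : (#|X| <= #|T|)%N := max_card (mem X).
  have : 0 <= ((S A)%:Z - (total k A)%:Z - ((S X)%:Z - (total k X)%:Z) - 1)
              * (#|T|.+1)%:Z by apply: mulr_ge0 => //; move: lt; clear; lia.
  by move: hw cX; clear; lia.
have maxm A : proper_part A -> (S X + total k A <= S A + total k X)%N ->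
    X \subset A -> A = X.
  move=> /maxX; rewrite /w => hw hv sXA; apply/esym/eqP; rewrite eqEcard sXA /=.
  have : 0 <= ((S A)%:Z - (total k A)%:Z - ((S X)%:Z - (total k X)%:Z))
              * (#|T|.+1)%:Z by apply: mulr_ge0 => //; move: hv; clear; lia.
  by move: hw; clear; lia.
refine (@chain_sum_cone R T B (fun E : {set T} => (total k E <= S E)%N) X B0 sXB nXB _) => E sEB nE0 QE.
have QX : (total k X <= S X)%N.
  by have := maxv _ P0; move: Q0; clear; lia.
have [->|nEB] := eqVneq E B; first by rewrite (setIidPr sXB) nX0.
have sup := g_super sEB sXB; have tot := totalUI k E X.
have sUB : E :|: X \subset B by rewrite subUset sEB.
have nU0 : E :|: X != set0.
  by apply: contraNneq nE0 => e; rewrite -subset0 -e subsetUl.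
(* If [E] and [X] are disjoint, their union is either everything, against connectedness, or a better choice than [X]. *)
have [eI|nI] := eqVneq (E :&: X) set0.
  rewrite eI g0 /total big_set0 in sup tot; rewrite -!/(total k _) in sup tot.
  have [eU|nU] := eqVneq (E :|: X) B.
    have eX : X = B :\: E.
      rewrite -eU setDUl setDv set0U; apply/esym/setDidPl.
      by rewrite -setI_eq0 setIC eI.
    have := g_conn sEB nE0 nEB; rewrite -eX; rewrite eU in tot.
    by move: tot QE QX; rewrite kB; clear; lia.
  have eUX : E :|: X = X.
    apply: maxm; rewrite ?subsetUr //; first by rewrite /proper_part sUB nU0 nU.
    have ar (a b c d e f : nat) : (a + b <= c + 0 -> d + 0 = e + f -> e <= a ->
      b + d <= c + f)%N by clear; lia.
    exact: ar sup tot QE.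
  by case/eqP: nE0; rewrite -eI; apply/esym/setIidPl; rewrite -eUX subsetUl.
have [eU|nU] := eqVneq (E :|: X) B; first last.
  have := maxv (E :|: X); rewrite /proper_part sUB nU0 nU => /(_ isT).
  by move: sup tot QE; clear; lia.
rewrite eU kB in sup tot; move: sup tot QE QX; clear; lia.
Qed.

End ConnectedChain.

Section ConnectedChi.
Variables (J : Type) (family : J -> set_function) (F : numFieldType) (A : comAlgType F).
Variables (M : nat) (x : nat -> A) (j : J).
Local Notation S := (family j).
Hypothesis B0 : full S != set0.
Hypothesis g0 : S set0 = 0%N.
Hypothesis g_super : forall A D : {set _}, A \subset full S -> D \subset full S ->
  (S A + S D <= S (A :|: D) + S (A :&: D))%N.
Hypothesis g_conn : forall A : {set _}, A \subset full S -> A != set0 -> A != full S ->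
  (S A + S (full S :\: A) < S (full S))%N.

Lemma chi_connected n : (#|full S| <= n)%N ->
  chi (\poly_(i < M.+1) x i) n (State (family := family) (set0 : {set ground S})) 0
  = - \sum_(k : {ffun ground S -> 'I_M.+1} | [&& supported (full S) k,
        total k (full S) == S (full S) & strict_coloring k])
      \prod_(b in full S) x (k b).
Proof.
move=> hn; rewrite chi_colorings ?sub0set // setD0 -sumrN [RHS]big_mkcondr /=.
rewrite big_mkcond [RHS]big_mkcond; apply: eq_bigr => k _; case: ifP => // _.
rewrite add0n; case: eqP => [e|_] /=; last by rewrite mulr0 mul0r.
rewrite mulr1 (@eq_chain_sum _ _ _ _ (fun E => total k E <= S E)%N).
  rewrite (@chain_sum_stable _ _ _ _ n #|full S|) ?setD0 ?sub0set //.
  rewrite chain_sum_connected //; case: ifP; rewrite ?mulrN1 ?mulr0n ?oppr0 ?mulr0 //.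
by move=> E _; rewrite add0n setD0.
Qed.
End ConnectedChi.

(** * Disjoint unions of complete bipartite graphs *)

Section DisjointUnion.
Variables (I J : finType) (Bs : I -> {set J}) (gs : I -> {set J} -> nat).
Hypothesis gs_mono : forall i (A D : {set J}), A \subset D -> (gs i A <= gs i D)%N.

Definition slice (A : {set I * J}) (i : I) : {set J} := [set j | (i, j) \in A].

Definition glue (f : {ffun I -> {set J}}) : {set I * J} := [set b | b.2 \in f b.1].

Definition union_full : {set I * J} := [set b | b.2 \in Bs b.1].

Definition union_height (A : {set I * J}) : nat := \sum_i gs i (slice A i).

Lemma slice_glue f i : slice (glue f) i = f i.
Proof. by apply/setP => j; rewrite !inE. Qed.

Lemma glue_slice A : glue [ffun i => slice A i] = A.
Proof. by apply/setP => -[i j]; rewrite !inE ffunE inE. Qed.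

Lemma slice_union_full i : slice union_full i = Bs i.
Proof. by apply/setP => j; rewrite !inE. Qed.

Lemma subset_slices (A D : {set I * J}) :
  (A \subset D) = [forall i, slice A i \subset slice D i].
Proof.
apply/subsetP/forallP => [sAD i|h [i j] bA].
  by apply/subsetP => j; rewrite !inE => /sAD.
by have := subsetP (h i) j; rewrite !inE; apply.
Qed.

Lemma union_height_mono (A D : {set I * J}) :
  A \subset D -> (union_height A <= union_height D)%N.
Proof. by rewrite subset_slices => /forallP h; apply: leq_sum => i _; apply: gs_mono. Qed.

(** The layers of a disjoint union are families of layers of the components, and
both the cardinal and the number of captured vertices are additive. *)
Lemma layer_count_union la (A : {set I * J}) :
  layer_count union_full union_height la A =
  (\prod_i layer_count (Bs i) (gs i) la (slice A i))%N.
Proof.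
elim: la A => [|q la IH] A /=.
  apply/esym; case: eqP => [->|nA].
    by rewrite big1 // => i _; rewrite slice_union_full eqxx.
  have [h|] := altP (@forallP _ (fun i => slice A i == Bs i)).
    case: nA; rewrite -[A]glue_slice -[RHS]glue_slice; congr glue.
    by apply/ffunP => i; rewrite !ffunE slice_union_full; apply/eqP.
  rewrite negb_forall => /existsP[i /negbTE hi].
  by rewrite (bigD1 i) //= hi.
rewrite bigA_distr_big_dep /=.
rewrite (reindex_onto glue (fun D => [ffun i => slice D i])) /=; last first.
  by move=> D _; rewrite glue_slice.
apply: eq_big => [f|f].
  rewrite !subset_slices; have -> : [ffun i => slice (glue f) i] = f.
    by apply/ffunP => i; rewrite ffunE slice_glue.
  rewrite eqxx andbT; apply/andP/familyP => [[/forallP h1 /forallP h2] i|h].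
    by rewrite unfold_in /= -[f i]slice_glue h1 -slice_union_full h2.
  split; apply/forallP => i; have := h i; rewrite unfold_in slice_glue ?slice_union_full;
    by case/andP.
move=> /andP[/andP[sAf sfB] _]; rewrite IH big_split /=; congr muln.
  rewrite -expn_sum; congr expn.
  rewrite /union_height -sumnB => [|i _]; first by apply: eq_bigr => i _; rewrite slice_glue.
  by apply: gs_mono; rewrite subset_slices in sAf; apply/forallP: i.
by apply: eq_bigr => i _; rewrite slice_glue.
Qed.
End DisjointUnion.

(** The number of embeddings of the complete bipartite graph with [l] black and
[e] white vertices: [r] is the lowest row used by the black vertices, and the
white vertices choose columns of this row. *)
Definition power_sum_shape (l e : nat) (la : seq nat) : nat :=
  \sum_(r < size la) (r.+1 ^ l - r ^ l) * nth 0%N la r ^ e.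

Section Bipartite.
Variables (J : finType) (B : {set J}) (e : nat).

Definition bipartite_height (A : {set J}) : nat := if B \subset A then e else 0%N.

Lemma bipartite_height_mono (A D : {set J}) :
  A \subset D -> (bipartite_height A <= bipartite_height D)%N.
Proof.
rewrite /bipartite_height => sAD; case: ifP => // sBA.
by rewrite (subset_trans sBA sAD).
Qed.

(** White vertices are captured only when all the black ones are placed, so the
widths of all rows but the last one used are irrelevant. *)
Lemma layer_count_bipartite la (A : {set J}) : A \subset B ->
  layer_count B bipartite_height la A =
  if A == B then 1%N else power_sum_shape #|B :\: A| e la.
Proof.
elim: la A => [|q la IH] A sAB /=.
  by case: eqP => // _; rewrite /power_sum_shape big_ord0.
case: eqP => [->|/eqP nAB].
  rewrite (big_pred1 B) => [|D]; last first.
    by rewrite /= -eqEsubset eq_sym.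
  by rewrite subnn IH // eqxx.
have sBA : (B \subset A) = false.
  by apply/negP => sBA; case/eqP: nAB; apply/eqP; rewrite eqEsubset sAB.
rewrite (bigD1 B) ?sAB ?subxx //= IH // eqxx muln1.
rewrite {1 2}/bipartite_height subxx sBA subn0.
rewrite [power_sum_shape _ _ _]/power_sum_shape /= big_ord_recl /=.
have c0 : (0 < #|B :\: A|)%N by rewrite card_gt0 setD_eq0 sBA.
rewrite exp1n exp0n // subn0 mul1n; congr addn.
under [RHS]eq_bigr do rewrite /bump leq0n add1n /=.
transitivity (\sum_(r < size la) \sum_(D : {set J} | (A \subset D) && (D \subset B))
  (r.+1 ^ #|B :\: D| - r ^ #|B :\: D|) * nth 0%N la r ^ e)%N.
  rewrite exchange_big /= [RHS](bigD1 B) ?sAB ?subxx //=.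
  rewrite [X in _ = (X + _)%N]big1 => [|r _]; last by rewrite setDv cards0 subnn.
  rewrite add0n; apply: eq_bigr => D /andP[/andP[sAD sDB] nDB].
  rewrite IH // (negbTE nDB) /bipartite_height sBA.
  rewrite ifN ?expn0 ?mul1n //; apply: contra nDB => sBD.
  by rewrite eqEsubset sDB.
apply: eq_bigr => r _; rewrite -big_distrl /=; congr muln.
have pows (z : nat) : (\sum_(D : {set J} | (A \subset D) && (D \subset B)) z ^ #|B :\: D|
   = z.+1 ^ #|B :\: A|)%N.
  have := sum_interval_expr z%:Z sAB; rewrite -[1 + _]/((1 + z)%N%:Z) add1n.
  rewrite -rmorphXn /=; under eq_bigr do rewrite -rmorphXn /=.
  by rewrite -rmorph_sum /= => -[].
by rewrite sumnB ?pows // => D _; case: #|_| => // n; rewrite leq_exp2r.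
Qed.
End Bipartite.

Section BipartiteUnion.
Variables (I J : finType) (Bs : I -> {set J}) (es : I -> nat).
Hypothesis Bs0 : forall i, Bs i != set0.
Local Notation B := (union_full Bs).
Local Notation gs := (fun i => bipartite_height (Bs i) (es i)).
Local Notation g := (union_height gs).

Lemma bipartite_union_mono (A D : {set I * J}) : A \subset D -> (g A <= g D)%N.
Proof. by apply: union_height_mono => i; apply: bipartite_height_mono. Qed.

Definition bipartite_union : set_function :=
  SetFunction B bipartite_union_mono.

Section Coloring.
Variables (M : nat) (k : {ffun I * J -> 'I_M.+1}).

Definition slice_total (E : {set I * J}) (i : I) : nat := \sum_(j in slice E i) k (i, j).

Lemma total_slices (E : {set I * J}) : total k E = (\sum_i slice_total E i)%N.
Proof.
rewrite /total /slice_total pair_big_dep /=.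
by apply: eq_big => [[i j]|[i j] _] //=; rewrite inE.
Qed.

Hypothesis k_pos : forall b, b \in B -> (0 < k b)%N.
Hypothesis k_total : total k B = g B.

Lemma g_full : g B = (\sum_i es i)%N.
Proof. by apply: eq_bigr => i _; rewrite /bipartite_height slice_union_full subxx. Qed.

Lemma slice_sub (E : {set I * J}) i : E \subset B -> slice E i \subset Bs i.
Proof. by rewrite subset_slices => /forallP/(_ i); rewrite slice_union_full. Qed.

Lemma slice_total_full (E : {set I * J}) i : Bs i \subset slice E i -> E \subset B ->
  slice_total E i = slice_total B i.
Proof.
move=> h sEB; suff e : slice E i = slice B i by rewrite /slice_total e.
by rewrite slice_union_full; apply/eqP; rewrite eqEsubset h slice_sub.
Qed.

Lemma slice_total_eq0 (E : {set I * J}) i : E \subset B -> (slice_total E i == 0%N) = (slice E i == set0).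
Proof.
move=> sEB; apply/eqP/eqP => [/eqP|e]; last by rewrite /slice_total e big_set0.
rewrite sum_nat_eq0 => /forallP h; apply/setP => j; rewrite in_set0; apply/negP => jE.
have := implyP (h j) jE; rewrite -leqn0 leqNgt k_pos //.
by apply: (subsetP sEB); rewrite inE in jE.
Qed.

(** A set [E] has total color at least its height as soon as every component is
balanced, with equality when [E] is a union of components: this gives a boolean
lattice. Otherwise keep only the components whose total color does not exceed
their height; dropping the others from [E] preserves the condition on [E], so
the poset is a cone. *)
Lemma chain_sum_union (R : pzRingType) :
  chain_sum R B (fun E => (total k E <= g E)%N) #|B| set0
  = ([forall i, slice_total B i == es i])%:R * (-1) ^+ #|I|.
Proof.
have [/forallP bal|] := boolP [forall i, slice_total B i == es i].
  rewrite mul1r; refine (@chain_sum_boolean R _ B (fun E : {set I * J} => (total k E <= g E)%N) I fst _ _)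
    => [i|E sEB].
    have [j jB] := set0Pn _ (Bs0 i); exists (i, j) => //.
    by rewrite inE.
  have le i : (bipartite_height (Bs i) (es i) (slice E i) <= slice_total E i)%N.
    rewrite /bipartite_height; case: ifP => // h.
    by rewrite slice_total_full // (eqP (bal i)).
  rewrite total_slices /union_height.
  transitivity (\sum_i slice_total E i ==
       \sum_i bipartite_height (Bs i) (es i) (slice E i))%N.
    by rewrite eqn_leq [X in _ = _ && X]leq_sum ?andbT.
  rewrite eq_sym; have [_ ->] : (\sum_i bipartite_height (Bs i) (es i) (slice E i) <=
     \sum_i slice_total E i ?= iff [forall i,
       bipartite_height (Bs i) (es i) (slice E i) == slice_total E i])%N.
    by apply: leqif_sum => i _; split.
  apply/forallP/eqP => [h|eE i].
    apply/setP => -[i j]; rewrite 3!inE.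
    apply/idP/andP => [ijE|[jB /imsetP[[i' j'] ijE /= ei]]].
      split; last by apply/imsetP; exists (i, j).
      by have := subsetP sEB _ ijE; rewrite inE.
    rewrite -{i'}ei in ijE; have := h i; rewrite /bipartite_height.
    case: ifP => [sB _|_]; first by have := subsetP sB j jB; rewrite inE.
    rewrite eq_sym slice_total_eq0 // => /eqP e0.
    have : j' \in slice E i by rewrite inE.
    by rewrite e0 inE.
  rewrite /bipartite_height; have [e0|] := eqVneq (slice E i) set0.
    rewrite e0 subset0 (negbTE (Bs0 i)) eq_sym slice_total_eq0 //.
    by rewrite e0.
  case/set0Pn => j; rewrite inE => ijE.
  have sB : Bs i \subset slice E i.
    apply/subsetP => j' j'B; rewrite inE eE 3!inE j'B /=.
    by apply/imsetP; exists (i, j).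
  by rewrite sB slice_total_full // eq_sym.
rewrite negb_forall => /existsP[i0 hi0]; rewrite mul0r.
pose X := [set b in B | (slice_total B b.1 <= es b.1)%N].
have sliceX i : slice X i = if (slice_total B i <= es i)%N then Bs i else set0.
  by apply/setP => j; rewrite !inE; case: ifP; rewrite ?andbT ?andbF ?inE.
have sXB : X \subset B by apply/subsetP => b /[!inE] /andP[].
have B0 : B != set0.
  by have /set0Pn[j jB] := Bs0 i0; apply/set0Pn; exists (i0, j); rewrite inE.
have nXB : X != B.
  apply: contraNneq hi0 => e.
  have le i : (slice_total B i <= es i)%N.
    have /set0Pn[j jB] := Bs0 i.
    have : (i, j) \in X by rewrite e inE.
    by rewrite !inE => /andP[].
  have /leqif_sum[_] : forall i, true ->
     (slice_total B i <= es i ?= iff (slice_total B i == es i))%N by move=> i _; split.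
  by rewrite -total_slices -g_full k_total eqxx => /esym/forallP/(_ i0).
refine (@chain_sum_cone R _ B (fun E : {set I * J} => (total k E <= g E)%N) X B0 sXB nXB _).
move=> E sEB nE0 QE; rewrite total_slices /union_height in QE.
(* The components which are dropped; a nonempty part of such a component always has total color more than its height. *)
pose neg i := (es i < slice_total B i)%N.
have hneg i : neg i -> (bipartite_height (Bs i) (es i) (slice E i) <= slice_total E i)%N.
  rewrite /bipartite_height /neg => ni; case: ifP => // h.
  by rewrite slice_total_full // ltnW.
have hneg' i : neg i -> slice E i != set0 ->
    (bipartite_height (Bs i) (es i) (slice E i) < slice_total E i)%N.
  rewrite /bipartite_height /neg => ni nEi; case: ifP => h.
    by rewrite slice_total_full.
  by rewrite lt0n slice_total_eq0.
have sliceEX i : slice (E :&: X) i = if neg i then set0 else slice E i.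
  have -> : slice (E :&: X) i = slice E i :&: slice X i by apply/setP => j; rewrite !inE.
  rewrite sliceX /neg ltnNge; case: (_ <= _)%N; last by rewrite setI0.
  by apply/setIidPl/slice_sub.
apply/andP; split.
  apply: contraTneq QE => e; rewrite -ltnNge.
  have sl i : ~~ neg i -> slice E i = set0.
    move=> ni; have := sliceEX i; rewrite (negbTE ni) => <-; rewrite e.
    by apply/setP => j; rewrite !inE.
  have /set0Pn[[i j] ijE] := nE0.
  have jE : slice E i != set0 by apply/set0Pn; exists j; rewrite inE.
  have ni : neg i by apply: contraNT jE => /sl ->.
  rewrite (bigD1 i) //= [X in (_ < X)%N](bigD1 i) //=.
  rewrite -addSn leq_add //; first exact: hneg'.
  apply: leq_sum => i' _; case ni' : (neg i'); first exact: hneg.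
  rewrite sl ?ni' // /bipartite_height subset0 (negbTE (Bs0 _)) //.
rewrite total_slices /union_height.
have key (f f' : I -> nat) : (forall i, neg i -> f' i <= f i)%N ->
   (\sum_i f i <= \sum_i f' i)%N ->
   (\sum_(i | ~~ neg i) f i <= \sum_(i | ~~ neg i) f' i)%N.
  move=> hle; rewrite (bigID neg) /= [X in (_ <= X)%N -> _](bigID neg) /=.
  have : (\sum_(i | neg i) f' i <= \sum_(i | neg i) f i)%N by apply: leq_sum.
  by clear; lia.
have {}key := key _ _ hneg QE.
rewrite (bigID neg) /= big1 => [|i ni]; last first.
  by rewrite /slice_total sliceEX ni big_set0.
rewrite add0n [X in (_ <= X)%N](bigID neg) /= [X in (_ <= X + _)%N]big1; last first.
  by move=> i ni; rewrite sliceEX ni /bipartite_height subset0 (negbTE (Bs0 _)).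
rewrite add0n (eq_bigr (slice_total E)) => [|i ni]; last first.
  by rewrite /slice_total sliceEX (negbTE ni).
apply: (leq_trans key); rewrite leq_eqVlt; apply/orP; left; apply/eqP.
by apply: eq_bigr => i ni; rewrite sliceEX (negbTE ni).
Qed.
End Coloring.
End BipartiteUnion.

Section ChiUnion.
Variables (K : Type) (family : K -> set_function) (F : numFieldType) (A : comAlgType F).
Variables (M : nat) (x : nat -> A) (c : K).
Variables (I J : finType) (Bs : I -> {set J}) (es : I -> nat).
Hypothesis Bs0 : forall i, Bs i != set0.
Hypothesis x0 : x 0%N = 0.
Local Notation B := (union_full Bs).
Local Notation X := (\poly_(i < M.+1) x i).

Lemma sum_union_colorings :
  \sum_(k : {ffun I * J -> 'I_M.+1} | supported B k && [forall i, slice_total k B i == es i])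
    \prod_(b in B) x (k b) = \prod_i (X ^+ #|Bs i|)`_(es i).
Proof.
under [RHS]eq_bigr do rewrite coef_color_poly.
rewrite bigA_distr_big_dep /=.
pose unc (f : {ffun I -> {ffun J -> 'I_M.+1}}) : {ffun I * J -> 'I_M.+1} :=
  [ffun b => f b.1 b.2].
pose cur (k : {ffun I * J -> 'I_M.+1}) : {ffun I -> {ffun J -> 'I_M.+1}} :=
  [ffun i => [ffun j => k (i, j)]].
rewrite (reindex_onto unc cur) /= => [|k _]; last first.
  by apply/ffunP => -[i j]; rewrite !ffunE.
apply: eq_big => [f|f _].
  have -> : cur (unc f) = f by apply/ffunP => i; apply/ffunP => j; rewrite !ffunE.
  rewrite eqxx andbT; apply/andP/familyP => [[/supportedP s /forallP t] i|h].
    rewrite unfold_in /=; apply/andP; split.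
      by apply/supportedP => j jB; have := s (i, j); rewrite inE ffunE; apply.
    rewrite -(eqP (t i)); apply/eqP; rewrite /slice_total slice_union_full.
    by apply: eq_bigr => j _; rewrite ffunE.
  split.
    apply/supportedP => -[i j]; rewrite inE ffunE /=.
    by have := h i; rewrite unfold_in /= => /andP[/supportedP s _]; apply: s.
  apply/forallP => i; have := h i; rewrite unfold_in /= => /andP[_ /eqP <-].
  rewrite /slice_total slice_union_full; apply/eqP.
  by apply: eq_bigr => j _; rewrite ffunE.
rewrite pair_big_dep /=; apply: eq_big => [[i j]|[i j] _]; first by rewrite inE.
by rewrite ffunE.
Qed.

Hypothesis famE : family c = bipartite_union Bs es.

(** Since [x 0 = 0], only colorings without the color 0 contribute, which is what
[chain_sum_union] requires. *)
Lemma chi_union n : (#|B| <= n)%N ->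
  chi X n (State (family := family) (set0 : {set ground (family c)})) 0 =
  \prod_i - (X ^+ #|Bs i|)`_(es i).
Proof.
rewrite -[LHS]/(chi X n (@State K family c set0) 0).
move=> hn; rewrite chi_colorings ?sub0set // famE /= setD0.
rewrite prodrN -sum_union_colorings big_distrr /= [RHS]big_mkcondr /=.
apply: eq_bigr => k sk; rewrite add0n.
have [/existsP[b /andP[bB /eqP kb]]|] := boolP [exists b, (b \in B) && (k b == ord0)].
  by rewrite (bigD1 b) //= kb x0 !(mul0r, mulr0) if_same.
rewrite negb_exists => /forallP kpos.
have k_pos b : b \in B -> (0 < k b)%N.
  by move=> bB; have := kpos b; rewrite bB /= -val_eqE lt0n.
have [e|ne] := eqVneq (total k B) (union_height (fun i => bipartite_height (Bs i) (es i)) B).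
  rewrite (@eq_chain_sum _ _ _ _ (fun E => total k E <=
     union_height (fun i => bipartite_height (Bs i) (es i)) E)%N); last first.
    by move=> E _; rewrite setD0 add0n.
  rewrite (@chain_sum_stable _ _ _ _ n #|B|) ?setD0 ?sub0set //.
  rewrite chain_sum_union //= mulr1.
  by case: ifP => _; rewrite ?mul1r ?mul0r ?mulr0 // mulrC.
rewrite mulr0 mul0r ifN //; apply: contra ne => /forallP h.
rewrite total_slices /union_height; apply/eqP; apply: eq_bigr => i _.
by rewrite (eqP (h i)) /bipartite_height slice_union_full subxx.
Qed.
End ChiUnion.

(** * The bipartite graph of a pair of permutations *)

Section PermGraph.
Variables (T : finType) (s1 s2 : {perm T}).
Implicit Types A D : {set {set T}}.
Local Notation B := (porbits s2).

Lemma porbits_block (s : {perm T}) c x : c \in porbits s -> x \in c -> c = porbit s x.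
Proof. by case/imsetP => y _ -> xy; apply/esym/eqP; rewrite eq_porbit_mem. Qed.

Lemma porbit_in (s : {perm T}) x : porbit s x \in porbits s.
Proof. exact: imset_f. Qed.

Lemma mem_cover_porbits A x : A \subset B -> (x \in cover A) = (porbit s2 x \in A).
Proof.
move=> sAB; apply/bigcupP/idP => [[c cA xc]|xA]; last by exists (porbit s2 x); rewrite ?porbit_id.
by rewrite -(porbits_block (subsetP sAB c cA) xc).
Qed.

Definition cycles_inside A : nat := #|[set w in porbits s1 | w \subset cover A]|.

Lemma cycles_inside_mono A D : A \subset D -> (cycles_inside A <= cycles_inside D)%N.
Proof.
move=> sAD; apply/subset_leq_card/subsetP => w; rewrite !inE => /andP[-> sw] /=.
apply: (subset_trans sw); apply/bigcupsP => c cA; apply: bigcup_sup.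
exact: (subsetP sAD).
Qed.

Definition perm_graph : set_function := SetFunction B cycles_inside_mono.

Lemma cycles_inside0 : cycles_inside set0 = 0%N.
Proof.
apply/eqP; rewrite cards_eq0; apply/eqP/setP => w; rewrite !inE /cover big_set0 subset0.
apply/negP => /andP[/imsetP[x _ ->] /eqP e].
by have := porbit_id s1 x; rewrite e inE.
Qed.

Lemma cycles_inside_full : cycles_inside B = #|porbits s1|.
Proof.
apply: eq_card => w; rewrite inE andb_idr // => _.
by apply/subsetP => x _; rewrite mem_cover_porbits ?porbit_in.
Qed.

(** A cycle inside both [A] and [D] is inside their intersection. *)
Lemma cycles_inside_super A D : A \subset B -> D \subset B ->
  (cycles_inside A + cycles_inside D <= cycles_inside (A :|: D) + cycles_inside (A :&: D))%N.
Proof.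
move=> sA sD; rewrite -cardsUI; apply: leq_add; apply: subset_leq_card.
  rewrite subUset; apply/andP; split; apply/subsetP => w; rewrite !inE => /andP[->] sw /=;
  apply: (subset_trans sw); apply/subsetP => x; rewrite !mem_cover_porbits ?subUset ?sA //;
  by rewrite inE => ->; rewrite ?orbT.
apply/subsetP => w; rewrite !inE => /andP[/andP[-> swA] /andP[_ swD]] /=.
apply/subsetP => x xw; rewrite mem_cover_porbits ?inE; last first.
  by rewrite (subset_trans _ sA) // subsetIl.
by rewrite -!mem_cover_porbits // (subsetP swA) // (subsetP swD).
Qed.

Lemma transitive_invariant (U : {set T}) :
  [transitive <<[set s1; s2]>>%g, on [set: T] | 'P] ->
  (forall x, x \in U -> s1 x \in U) -> (forall x, x \in U -> s2 x \in U) ->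
  U != set0 -> U = setT.
Proof.
move=> tr h1 h2 /set0Pn[x xU]; have actsU : [acts <<[set s1; s2]>>%g, on U | 'P].
  rewrite gen_subG; apply/subsetP => s; rewrite !inE => sE; apply/subsetP => y yU.
  by rewrite inE /= apermE; case/orP: sE => /eqP ->; [apply: h1|apply: h2].
apply/eqP; rewrite eqEsubset subsetT /= -(atransP tr x) ?inE //.
by rewrite acts_sub_orbit.
Qed.

Hypothesis tr : [transitive <<[set s1; s2]>>%g, on [set: T] | 'P].

(** Otherwise every cycle of [s1] would lie on one side, and the union of the cycles
in [A] would be invariant under both permutations. *)
Lemma cycles_inside_conn A : A \subset B -> A != set0 -> A != B ->
  (cycles_inside A + cycles_inside (B :\: A) < cycles_inside B)%N.
Proof.
move=> sAB nA0 nAB; rewrite cycles_inside_full /cycles_inside -cardsUI.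
set W1 := [set w in _ | _]; set W2 := [set w in _ | _ \subset cover (_ :\: _)].
have sDB : B :\: A \subset B by apply: subsetDl.
have cDE x : (x \in cover (B :\: A)) = (x \notin cover A).
  by rewrite !mem_cover_porbits // inE porbit_in andbT.
have -> : W1 :&: W2 = set0.
  apply/setP => w; rewrite !inE; apply/negP => /andP[/andP[/imsetP[x _ ->]]].
  move=> /subsetP/(_ x (porbit_id _ _)) xA /andP[_ /subsetP/(_ x (porbit_id _ _))].
  by rewrite cDE xA.
rewrite cards0 addn0; apply: proper_card; rewrite properE subUset.
apply/andP; split; first by apply/andP; split; apply/subsetP => w; rewrite inE => /andP[].
apply/negP => sW.
have hw x : x \in cover A -> porbit s1 x \subset cover A.
  move=> xA; have := subsetP sW (porbit s1 x) (porbit_in _ _).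
  rewrite !inE !porbit_in /= => /orP[//|/subsetP/(_ x (porbit_id _ _))].
  by rewrite cDE xA.
have UT : cover A = setT.
  apply: (transitive_invariant tr) => [x xA|x xA|].
  - by apply: (subsetP (hw x xA)); rewrite (mem_porbit s1 1).
  - rewrite mem_cover_porbits //; have := porbit_perm s2 1 x; rewrite expg1 => ->.
    by rewrite -mem_cover_porbits.
  have /set0Pn[c cA] := nA0; have /imsetP[x _ ec] := subsetP sAB c cA.
  by apply/set0Pn; exists x; rewrite mem_cover_porbits // -ec.
case/eqP: nAB; apply/eqP; rewrite eqEsubset sAB; apply/subsetP => c /imsetP[x _ ->].
by rewrite -mem_cover_porbits // UT inE.
Qed.

(** A cycle of [s1] misses the cycles of [s2] in [A] exactly when it lies inside the
remaining ones. This exchanges the two forms of condition (e). *)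
Lemma card_cycles_meeting A : A \subset B ->
  (#|[set d in porbits s1 | d :&: cover A != set0]| + cycles_inside (B :\: A)
   = #|porbits s1|)%N.
Proof.
move=> sAB; rewrite -(cardsID [set d | d :&: cover A != set0] (porbits s1)).
have cDE x : (x \in cover (B :\: A)) = (x \notin cover A).
  by rewrite !mem_cover_porbits ?subsetDl // inE porbit_in andbT.
congr (_ + _)%N; first by apply: eq_card => w; rewrite !inE.
apply: eq_card => w; rewrite !inE negbK andbC; congr (_ && _).
rewrite setI_eq0 disjoint_subset; apply/subsetP/subsetP => h x /h.
  by rewrite cDE inE.
by rewrite inE cDE.
Qed.

End PermGraph.

(** * Placements into the boxes of a Young diagram *)

Section BoxCount.
Local Open Scope nat_scope.
Variables (T : finType) (s1 s2 : {perm T}) (la : seq nat).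
Local Notation B := (porbits s2).
Local Notation g := (cycles_inside s1).

Definition respects_rows (f : T -> 'I_(sumn la)) : bool :=
  [forall x, reshape_index la (f (s2 x)) == reshape_index la (f x)].
Definition respects_cols (f : T -> 'I_(sumn la)) : bool :=
  [forall x, reshape_offset la (f (s1 x)) == reshape_offset la (f x)].

Definition box_count : nat :=
  #|[set f : {ffun T -> 'I_(sumn la)} | respects_rows f && respects_cols f]|.

Hypothesis la_sorted : sorted geq la.

Local Notation R := (size la).

Lemma nth_sorted i j : (i <= j)%N -> (nth 0 la j <= nth 0 la i)%N.
Proof.
move=> ij; have [jR|] := ltnP j R; last by move=> /(nth_default 0) ->.
by apply: (sorted_leq_nth (leT := geq)) => //; rewrite ?inE ?(leq_ltn_trans ij) //;
  [move=> a b c /= h1 h2; apply: leq_trans h2 h1 | move=> a /=].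
Qed.

Definition last_row (r : {ffun T -> 'I_R.+1}) (w : {set T}) : nat := \max_(x in w) r x.

Lemma leq_last_row (r : {ffun T -> 'I_R.+1}) (w : {set T}) x : x \in w -> (r x <= last_row r w)%N.
Proof. by move=> xw; apply: (leq_bigmax_cond (F := fun x => r x : nat)). Qed.

(** The points of [cover A] have been placed in rows above [m]; they are sent to row
0 as a default value which does not disturb [last_row]. *)
Definition row_assign (m : nat) (A : {set {set T}}) (r : {ffun T -> 'I_R.+1}) : bool :=
  [forall x, (r (s2 x) == r x) &&
    (if x \in cover A then r x == ord0 else (m <= r x < R)%N)].

(** Once the rows are chosen, a white vertex can use the columns which exist in
all rows of its neighbours, that is in the lowest of them, which is the shortest
one as the rows decrease. *)
Definition row_sum (m : nat) (A : {set {set T}}) : nat :=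
  \sum_(r | row_assign m A r)
    \prod_(w in porbits s1 | ~~ (w \subset cover A)) nth 0 la (last_row r w).

Let coverE (A : {set {set T}}) x : A \subset B -> (x \in cover A) = (porbit s2 x \in A)
  := @mem_cover_porbits T s2 A x.

Lemma row_sum_end (A : {set {set T}}) : A \subset B -> row_sum R A = (A == B).
Proof.
move=> sAB; rewrite /row_sum; case: eqP => [->|/eqP nAB].
  have cB x : x \in cover B by rewrite coverE // porbit_in.
  rewrite (big_pred1 [ffun=> ord0]) => [|r].
    rewrite big1 // => w /andP[_ /subsetPn[x _]]; by rewrite cB.
  apply/forallP/eqP => [h|-> x]; last by rewrite cB !ffunE !eqxx.
  by apply/ffunP => x; have := h x; rewrite cB ffunE => /andP[_ /eqP].
rewrite big_pred0 // => r; apply/negP => /forallP h; case/negP: nAB.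
rewrite eqEsubset sAB; apply/subsetP => c /imsetP[x _ ->].
rewrite -coverE //; apply/negPn/negP => xA.
have := h x; rewrite (negbTE xA) => /andP[_]; by case: ltngtP.
Qed.

Lemma s2_cover (A : {set {set T}}) x : A \subset B -> (s2 x \in cover A) = (x \in cover A).
Proof.
by move=> sAB; rewrite !coverE //; have := porbit_perm s2 1 x; rewrite expg1 => ->.
Qed.

(** Split the assignments according to the set [D] of black vertices that are placed
once row [m] is treated. The white vertices inside [D] and not inside [A] have
[m] as their lowest row. *)
Lemma row_sum_step m (A : {set {set T}}) : (m < R)%N -> A \subset B ->
  row_sum m A = \sum_(D : {set {set T}} | (A \subset D) && (D \subset B))
     nth 0 la m ^ (g D - g A) * row_sum m.+1 D.
Proof.
move=> mR sAB; have mR1 : (m < R.+1)%N by rewrite ltnW.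
(* The black vertices placed in row [m] or before. *)
pose dom (r : {ffun T -> 'I_R.+1}) := A :|: [set c in B | [forall x in c, r x == m :> nat]].
rewrite /row_sum (partition_big dom
  (fun D : {set {set T}} => (A \subset D) && (D \subset B))) /=; last first.
  move=> r _; rewrite subsetUl subUset sAB; apply/subsetP => c; by rewrite inE => /andP[].
apply: eq_bigr => D /andP[sAD sDB].
pose up (r : {ffun T -> 'I_R.+1}) : {ffun T -> 'I_R.+1} :=
  [ffun x => if x \in cover A then ord0 else if x \in cover D then Ordinal mR1 else r x].
pose down (r : {ffun T -> 'I_R.+1}) : {ffun T -> 'I_R.+1} :=
  [ffun x => if x \in cover D then ord0 else r x].
have cAD x : x \in cover A -> x \in cover D.
  by rewrite !coverE //; apply: (subsetP sAD).
have rinv r x y : (forall x, r (s2 x) = r x) -> y \in porbit s2 x -> r y = r x.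
  move=> inv /porbitP[i ->]; elim: i => [|i IHi]; first by rewrite expg0 perm1.
  by rewrite expgSr permM inv.
have domP r x : row_assign m A r -> dom r = D ->
    (x \in cover D) = (x \in cover A) || (r x == m :> nat).
  move=> /forallP h <-; have inv y : r (s2 y) = r y by have /andP[/eqP] := h y.
  rewrite !coverE //; last first.
    rewrite subUset sAB; apply/subsetP => c; by rewrite inE => /andP[].
  rewrite !inE porbit_in /=; congr (_ || _); apply/forallP/idP => [/(_ x)|/eqP e y].
    by rewrite porbit_id.
  by apply/implyP => yx; rewrite (rinv _ r x y inv yx) e.
rewrite (reindex_onto up down) /=; last first.
  move=> r /andP[hr /eqP hD]; apply/ffunP => x; rewrite !ffunE.
  rewrite (domP r x hr hD); have /andP[_] := forallP hr x.
  case: (x \in cover A) => [/eqP -> //|_] /=; case: eqP => // e.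
  by apply: val_inj.
have upP r : row_assign m.+1 D r ->
  row_assign m A (up r) && (dom (up r) == D) && (down (up r) == r).
  move=> /forallP h; apply/andP; split; last first.
    apply/eqP/ffunP => x; rewrite !ffunE; have /andP[_] := h x.
    case: ifP => [_ /eqP-> //|xD _]; by rewrite ifN //; apply: contraFN xD; apply: cAD.
  have inv x : up r (s2 x) = up r x.
    by rewrite !ffunE !s2_cover //; have /andP[/eqP -> _] := h x.
  apply/andP; split.
    apply/forallP => x; rewrite inv eqxx /= ffunE; case xA: (x \in cover A) => //=.
    case: ifP => [_ |xD]; first by rewrite /= ?leqnn ?mR.
    by have /andP[_] := h x; rewrite xD => /andP[/ltnW -> ->].
  apply/eqP/setP => c; rewrite !inE; case cA: (c \in A) => /=.
    by rewrite (subsetP sAD).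
  apply/andP/idP => [[cB /forallP hc]|cD].
    have /imsetP[x _ ex] := cB; have := hc x; rewrite ex porbit_id /= ffunE.
    rewrite !coverE // -ex cA; case: ifP => // cD.
    by have /andP[_] := h x; rewrite coverE // -ex cD => /andP[+ _] /eqP e; rewrite e ltnn.
  split; first exact: (subsetP sDB).
  apply/forallP => x; apply/implyP => xc.
  have ex := porbits_block (subsetP sDB c cD) xc.
  by rewrite ffunE !coverE // -ex cA cD.
rewrite (eq_bigl (row_assign m.+1 D)); last first.
  move=> r; apply/idP/idP; last exact: upP.
  move=> /andP[/andP[hr /eqP hD] /eqP e]; apply/forallP => x.
  have hx y := forallP hr y.
  have eD y : r y = if y \in cover D then ord0 else up r y by rewrite -{1}e ffunE.
  rewrite !eD s2_cover //; have /andP[/eqP -> upx] := hx x; rewrite eqxx /=.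
  have hd := domP _ x hr hD; case xD: (x \in cover D) in hd *; first by [].
  case xA: (x \in cover A) in hd upx *; first by [].
  case/andP: upx => le lt; rewrite lt andbT ltn_neqAle le andbT eq_sym.
  by rewrite /= in hd; rewrite -hd.
rewrite big_distrr /=; apply: eq_bigr => r /forallP hr.
rewrite (bigID (fun w : {set T} => w \subset cover D)) /=; congr muln.
  rewrite (eq_bigr (fun=> nth 0 la m)).
    rewrite prod_nat_const; congr expn.
    have -> : g D = (g A + #|[set w in porbits s1 | (w \subset cover D) && ~~ (w \subset cover A)]|)%N.
      rewrite /cycles_inside -(cardsID [set w : {set T} | w \subset cover A]); congr addn.
        apply: eq_card => w; rewrite !inE; case: (w \in _) => //=.
        rewrite andbC andb_idr // => sw; apply: (subset_trans sw).
        by apply/subsetP => x; apply: cAD.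
      by apply: eq_card => w; rewrite !inE; case: (w \in _); rewrite ?andbF //= andbC.
    rewrite addKn; apply: eq_card => w; rewrite !inE.
    by rewrite unfold_in -andbA [X in _ && X]andbC.
  move=> w /andP[/andP[_ nwA] wD]; congr nth.
  apply/eqP; rewrite eqn_leq; apply/andP; split.
    apply/bigmax_leqP => x xw; rewrite ffunE; case: ifP => // _.
    by rewrite (subsetP wD).
  have /subsetPn[x xw xA] := nwA.
  have := leq_last_row (up r) xw; by rewrite ffunE (negbTE xA) (subsetP wD).
apply: eq_big => [w|w /andP[/andP[_ _] nwD]].
  rewrite -andbA; congr andb; rewrite andb_idl //; apply: contra => wA.
  by apply: (subset_trans wA); apply/subsetP => x; apply: cAD.
congr nth; have /subsetPn[y yw yD] := nwD.
have hy : (m < r y)%N by have /andP[_] := hr y; rewrite (negbTE yD) => /andP[].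
apply/eqP; rewrite eqn_leq; apply/andP; split.
  apply/bigmax_leqP => x xw; rewrite ffunE; case: ifP => // xA.
  case: ifP => xD /=; last exact: leq_last_row.
  exact: leq_trans (ltnW hy) (leq_last_row r yw).
apply/bigmax_leqP => x xw; case xD: (x \in cover D).
  by have /andP[_] := hr x; rewrite xD => /eqP ->.
have := leq_last_row (up r) xw; rewrite ffunE xD ifN //; apply: contraFN xD; exact: cAD.
Qed.

Lemma row_sumE (A : {set {set T}}) : A \subset B -> layer_count B g la A = row_sum 0 A.
Proof.
suff h m : (m <= R)%N -> forall A : {set {set T}}, A \subset B ->
  layer_count B g (drop m la) A = row_sum m A by move=> sAB; rewrite -{1}(drop0 la); apply: h.
move=> mR; rewrite -(subKn mR); elim: (R - m)%N (leq_subr m R) => [|d IH] hd {}A sAB.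
  by rewrite subn0 drop_size row_sum_end.
have lt : (R - d.+1 < R)%N by rewrite ltn_subrL /= (leq_trans _ hd).
rewrite (drop_nth 0) // row_sum_step //=.
by apply: eq_bigr => D /andP[_ sDB]; rewrite subnSK // IH // ltnW.
Qed.

Lemma row_of_proof (f : T -> 'I_(sumn la)) x : (reshape_index la (f x) < R.+1)%N.
Proof. by rewrite ltnS ltnW // reshape_indexP. Qed.

Definition row_of (f : {ffun T -> 'I_(sumn la)}) : {ffun T -> 'I_R.+1} :=
  [ffun x => Ordinal (row_of_proof f x)].

(** For fixed rows a placement is a choice of one column for each cycle of [s1]. *)
Lemma row_fiber r : row_assign 0 set0 r ->
  #|[set f : {ffun T -> 'I_(sumn la)} | (respects_rows f && respects_cols f) && (row_of f == r)]|
  = \prod_(w in porbits s1) nth 0 la (last_row r w).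
Proof.
move=> /forallP hr; have {}hr x : r (s2 x) = r x /\ (r x < R)%N.
  by have := hr x; rewrite /cover big_set0 inE => /andP[/eqP].
set C := (nth 0 la 0).+1.
pose P := [pred w : {set T} | w \in porbits s1].
pose Q (w : {set T}) := [pred j : 'I_C | (j < nth 0 la (last_row r w))%N].
transitivity #|pfamily (ord0 : 'I_C) P Q|; last first.
  rewrite -sum1_card; transitivity (\prod_(w | P w) \sum_(j | Q w j) 1); last first.
    apply: eq_bigr => w _; have hC : (nth 0 la (last_row r w) <= C)%N.
      by rewrite ltnW // ltnS nth_sorted.
    by rewrite (big_ord_narrow hC) sum1_card card_ord.
  by rewrite (big_distr_big_dep (ord0 : 'I_C)) /=; apply: eq_bigr => h _; rewrite big1.
pose G (f : {ffun T -> 'I_(sumn la)}) : {ffun {set T} -> 'I_C} :=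
  [ffun w => if w \in porbits s1 then
     (if [pick x in w] is Some x then inord (reshape_offset la (f x)) else ord0) else ord0].
have off (f : T -> 'I_(sumn la)) x : (reshape_offset la (f x) < nth 0 la (reshape_index la (f x)))%N.
  exact: reshape_offsetP.
have inv f x y : respects_cols f -> y \in porbit s1 x ->
    reshape_offset la (f y) = reshape_offset la (f x).
  move=> /forallP h /porbitP[i ->]; elim: i => [|i IHi]; first by rewrite expg0 perm1.
  by rewrite expgSr permM (eqP (h _)).
have GE (f : {ffun T -> 'I_(sumn la)}) x : respects_cols f -> G f (porbit s1 x) = reshape_offset la (f x) :> nat.
  move=> hf; rewrite ffunE porbit_in; case: pickP => [y yx|/(_ x)]; last by rewrite porbit_id.
  by rewrite inordK ?(inv f x y) // (leq_trans (off f x)) // leqW // nth_sorted.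
rewrite -(card_in_imset (f := G)); last first.
  move=> f f'; rewrite !inE => /andP[/andP[_ cf] /eqP rf] /andP[/andP[_ cf'] /eqP rf'] e.
  apply/ffunP => x; apply: val_inj; rewrite /= -(reshape_indexK la (f x)) -(reshape_indexK la (f' x)).
  have := congr1 (fun h : {ffun {set T} -> 'I_C} => h (porbit s1 x) : nat) e; rewrite !GE // => ->.
  by have := congr1 (fun h : {ffun T -> 'I_R.+1} => h x : nat) (etrans rf (esym rf')); rewrite !ffunE /= => ->.
apply: eq_card => h; apply/imsetP/familyP => [[f + ->] w|hh].
  rewrite inE => /andP[/andP[_ cf] /eqP rf]; rewrite ffunE.
  case: ifP => [wP|wP]; last by rewrite /= ?wP inE.
  rewrite /= ?wP; have /imsetP[x _ ew] := wP.
  have := GE f x cf; rewrite ffunE -ew wP => e.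
  suff h' : (reshape_offset la (f x) < nth 0 la (last_row r w))%N.
    by rewrite -e in h'; exact: h'.
  suff [y yw ->] : exists2 y, y \in w & last_row r w = r y :> nat.
    rewrite ew in yw; rewrite -(inv f x y cf yw) -rf ffunE /=; exact: off.
  have w0 : (0 < #|mem w|)%N by rewrite ew; apply/card_gt0P; exists x; rewrite porbit_id.
  have [y yw ey] := eq_bigmax_cond (fun x => r x : nat) w0.
  by exists y; [exact: yw | exact: ey].
have hP x : (h (porbit s1 x) < nth 0 la (r x))%N.
  have := hh (porbit s1 x); rewrite /= porbit_in unfold_in /= => /leq_trans; apply.
  by apply: nth_sorted; apply: leq_last_row; rewrite porbit_id.
pose f : {ffun T -> 'I_(sumn la)} := [ffun x => Ordinal (flatten_indexP (hP x))].
have rf x : reshape_index la (f x) = r x by rewrite ffunE /= flatten_indexKl.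
have cf x : reshape_offset la (f x) = h (porbit s1 x) by rewrite ffunE /= flatten_indexKr.
have Cf : respects_cols f.
  apply/forallP => x; rewrite !cf; have := porbit_perm s1 1 x; rewrite expg1 => ->; exact: eqxx.
exists f.
  rewrite inE Cf andbT; apply/andP; split.
    by apply/forallP => x; rewrite !rf; have [-> _] := hr x.
  by apply/eqP/ffunP => x; apply: val_inj; rewrite ffunE /= rf.
apply/ffunP => w; apply: val_inj; case wP: (w \in porbits s1).
  by have /imsetP[x _ ->] := wP; apply: (etrans (esym (cf x)) (esym (GE f x Cf))).
have := hh w; rewrite [G _ _]ffunE ifF ?inE; last exact: wP.
by rewrite ifF; [move=> /eqP -> | exact: wP].
Qed.

(** The number of placements depends only on the graph of [(s1, s2)], through its
layers. *)
Lemma box_count_layers : box_count = layer_count B g la set0.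
Proof.
rewrite row_sumE ?sub0set // /box_count -sum1_card /row_sum.
rewrite (partition_big row_of (row_assign 0 set0)) /= => [|f]; last first.
  rewrite inE => /andP[/forallP hf _]; apply/forallP => x; rewrite /cover big_set0 inE.
  rewrite !ffunE -val_eqE /= (eqP (hf x)) eqxx; exact: reshape_indexP.
apply: eq_bigr => r hr.
rewrite (eq_bigl (mem (porbits s1))) => [|w]; last first.
  rewrite /= andb_idr // => /imsetP[x _ ->]; apply/subsetPn; exists x; first exact: porbit_id.
  by rewrite /cover big_set0 inE.
rewrite -row_fiber // -sum1_card; apply: eq_bigl => f; by rewrite !inE.
Qed.

End BoxCount.

(** * Sums over factorizations of a permutation *)

Section ExtendAlong.
Variables (T' T : finType) (t : T' -> T).
Hypothesis t_inj : injective t.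

Definition perm_along_fun (s : {perm T'}) (x : T) : T :=
  if [pick y | t y == x] is Some y then t (s y) else x.

Lemma perm_along_fun_in s y : perm_along_fun s (t y) = t (s y).
Proof.
rewrite /perm_along_fun; case: pickP => [z /eqP /t_inj -> //|/(_ y)].
by rewrite eqxx.
Qed.

Lemma perm_along_fun_out s x : x \notin codom t -> perm_along_fun s x = x.
Proof.
rewrite /perm_along_fun => xt; case: pickP => // z /eqP e.
by case/negP: xt; rewrite -e codom_f.
Qed.

Lemma perm_along_fun_inj s : injective (perm_along_fun s).
Proof.
have along x : x \in codom t -> perm_along_fun s x \in codom t.
  by case/codomP => y ->; rewrite perm_along_fun_in codom_f.
move=> x x'; case: (boolP (x \in codom t)) => [/codomP[y ->]|xt];
  case: (boolP (x' \in codom t)) => [/codomP[y' ->]|xt'].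
- by rewrite !perm_along_fun_in => /t_inj /perm_inj ->.
- by rewrite perm_along_fun_in (perm_along_fun_out _ xt') => e; rewrite -e codom_f in xt'.
- by rewrite perm_along_fun_in (perm_along_fun_out _ xt) => e; rewrite e codom_f in xt.
- by rewrite !perm_along_fun_out.
Qed.

Definition perm_along (s : {perm T'}) : {perm T} := perm (@perm_along_fun_inj s).

Lemma perm_alongE s y : perm_along s (t y) = t (s y).
Proof. by rewrite permE perm_along_fun_in. Qed.

Lemma perm_along_out s x : x \notin codom t -> perm_along s x = x.
Proof. by move=> xt; rewrite permE perm_along_fun_out. Qed.

Lemma perm_alongP (p : {perm T}) (s : {perm T'}) :
  (forall y, p (t y) = t (s y)) -> (forall x, x \notin codom t -> p x = x) ->
  p = perm_along s.
Proof.
move=> h1 h2; apply/permP => x; have [/codomP[y ->]|xt] := boolP (x \in codom t).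
  by rewrite h1 perm_alongE.
by rewrite h2 // perm_along_out.
Qed.

Lemma perm_along_inj : injective perm_along.
Proof. by move=> s s' e; apply/permP => y; apply: t_inj; rewrite -!perm_alongE e. Qed.

Lemma perm_alongM s s' : perm_along (s * s')%g = (perm_along s * perm_along s')%g.
Proof.
apply/esym/perm_alongP => [y|x xt]; first by rewrite !permM !perm_alongE.
by rewrite permM !perm_along_out.
Qed.

Lemma perm_along1 : perm_along 1%g = 1%g.
Proof. by apply/esym/perm_alongP => *; rewrite !perm1. Qed.

Lemma perm_along_tperm y z : perm_along (tperm y z) = tperm (t y) (t z).
Proof.
apply/esym/perm_alongP => [u|x xt]; first by rewrite inj_tperm.
by rewrite tpermD //; apply: contraNneq xt => <-; rewrite codom_f.
Qed.

Lemma odd_perm_along s : perm_along s = s :> bool.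
Proof.
have [ts -> _] := prod_tpermP s.
elim: ts => [|p ts IH]; first by rewrite !big_nil perm_along1 !odd_perm1.
rewrite !big_cons perm_alongM !odd_permM IH perm_along_tperm !odd_tperm.
by rewrite (inj_eq t_inj).
Qed.

Lemma perm_along_surj (p : {perm T}) : (forall x, x \notin codom t -> p x = x) ->
  exists s, p = perm_along s.
Proof.
move=> hp; have stab y : p (t y) \in codom t.
  apply/negPn/negP => h; have := hp _ h => /perm_inj e.
  by rewrite e codom_f in h.
pose f y := iinv (stab y).
have fE y : t (f y) = p (t y) by rewrite /f f_iinv.
have f_inj : injective f.
  by move=> y z e; apply: t_inj; apply: (@perm_inj _ p); rewrite -!fE e.
by exists (perm f_inj); apply: perm_alongP => // y; rewrite permE fE.
Qed.
End ExtendAlong.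

(** Split off the block which contains [x]. *)
Lemma sum_partition_rec (V : comPzRingType) (T : finType) (f : {set T} -> V)
    (S : {set T}) (x : T) : x \in S ->
  \sum_(P : {set {set T}} | partition P S) \prod_(b in P) f b =
  \sum_(b : {set T} | (x \in b) && (b \subset S))
    f b * \sum_(P : {set {set T}} | partition P (S :\: b)) \prod_(c in P) f c.
Proof.
move=> xS; rewrite (partition_big (fun P => pblock P x)
  (fun b : {set T} => (x \in b) && (b \subset S))) /=; last first.
  move=> P pP; rewrite mem_pblock (cover_partition pP) xS /=.
  by apply: (partitionS pP); rewrite pblock_mem // (cover_partition pP).
apply: eq_bigr => b /andP[xb bS]; rewrite mulr_sumr.
have disj P : partition P (S :\: b) -> b \notin P.
  move=> pP; apply/negP => bP; have := partitionS pP bP.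
  by move=> /subsetP/(_ x xb); rewrite inE xb.
rewrite (reindex_onto (fun P => b |: P) (fun P => P :\ b)) /=; last first.
  move=> P /andP[pP /eqP e]; rewrite setD1K // -e pblock_mem //.
  by rewrite (cover_partition pP).
apply: eq_big => [P|P /andP[_ /eqP e]]; last first.
  by rewrite big_setU1 //= -e !inE eqxx.
apply/idP/idP => [/andP[/andP[pP _] /eqP e]|pP].
  by rewrite -e; apply: (partitionD1 pP); rewrite !inE eqxx.
have nb := disj P pP; rewrite setU1K // eqxx andbT.
have pU : partition (b |: P) S.
  have -> : S = b :|: (S :\: b) by rewrite -{1}(setID S b) (setIidPr bS).
  apply: partitionU1 pP _ _; first by apply/set0Pn; exists x.
  by rewrite disjoint_sym disjoints_subset; apply/subsetP => y; rewrite !inE => /andP[].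
by rewrite pU (@def_pblock _ _ b) ?inE ?eqxx //; case/and3P: pU.
Qed.

Section PairSums.
Variables (T V : finType) (row col : V -> nat).
Implicit Types (D E b U : {set T}) (s : {perm T} * {perm T}) (p : {perm T}).

Definition stable U s : bool := [forall x in U, (s.1 x \in U) && (s.2 x \in U)].

Lemma stableP U s : reflect (forall x, x \in U -> s.1 x \in U /\ s.2 x \in U) (stable U s).
Proof.
apply: (iffP forallP) => [h x xU|h x].
  by have /implyP/(_ xU)/andP := h x.
by apply/implyP => /h[-> ->].
Qed.

Lemma perm_closed_inv (q : {perm T}) U x :
  (forall y, y \in U -> q y \in U) -> (q x \in U) = (x \in U).
Proof.
move=> h; apply/idP/idP => [qx|]; last exact: h.
have sub : q @: U \subset U by apply/subsetP => _ /imsetP[y yU ->]; apply: h.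
have e : q @: U = U by apply/eqP; rewrite eqEcard sub (card_imset _ (@perm_inj _ q)) leqnn.
by move: qx; rewrite -{1}e => /imsetP[y yU /perm_inj ->].
Qed.

Lemma stable_in U s x : stable U s -> ((s.1 x \in U) = (x \in U)) * ((s.2 x \in U) = (x \in U)).
Proof. by move=> /stableP h; split; apply: perm_closed_inv => y /h[]. Qed.

Lemma stableD U E s : stable U s -> stable E s -> stable (E :\: U) s.
Proof.
move=> sU sE; apply/stableP => x; rewrite !inE.
by rewrite !(stable_in x sU) !(stable_in x sE) => /andP[-> ->].
Qed.

Definition connected_on D s : bool :=
  [forall U : {set T}, [&& U \subset D, U != set0 & stable U s] ==> (U == D)].

Definition component s (x : T) : {set T} := \bigcap_(U : {set T} | (x \in U) && stable U s) U.

Lemma component_id s x : x \in component s x.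
Proof. by apply/bigcapP => U /andP[]. Qed.

Lemma component_stable s x : stable (component s x) s.
Proof.
apply/stableP => y /bigcapP h; split; apply/bigcapP => U /andP[xU sU];
by rewrite (stable_in y sU) h // xU.
Qed.

Lemma component_min s x U : x \in U -> stable U s -> component s x \subset U.
Proof. by move=> xU sU; apply: bigcap_inf; rewrite xU. Qed.

Lemma component_connected s x : connected_on (component s x) s.
Proof.
apply/forallP => U; apply/implyP => /and3P[sUC U0 sU].
rewrite eqEsubset sUC; have [xU|xU] := boolP (x \in U); first exact: component_min.
have /subsetP h : component s x \subset component s x :\: U.
  apply: component_min; first by rewrite inE xU component_id.
  exact: stableD sU (component_stable s x).
have /set0Pn[y yU] := U0; have := h y (subsetP sUC y yU).
by rewrite inE yU.
Qed.

Definition factors D p s : bool :=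
  [&& perm_on D s.1, perm_on D s.2 & [forall x in D, s.1 (s.2 x) == p x]].

(** Placements of the points of [D]; the value [None] outside [D] makes placements
on complementary sets combine freely. *)
Definition box_maps D s : {set {ffun T -> option V}} :=
  [set f : {ffun T -> option V} | [forall x, [&& (x \in D) == isSome (f x),
     omap row (f (s.2 x)) == omap row (f x) & omap col (f (s.1 x)) == omap col (f x)]]].

Definition pair_weight D s : int := (-1) ^+ odd_perm s.1 * #|box_maps D s|%:Z.

Definition all_sum D p : int := \sum_(s | factors D p s) pair_weight D s.

Definition connected_sum D p : int :=
  \sum_(s | factors D p s && connected_on D s) pair_weight D s.

Definition join_pair (s s' : {perm T} * {perm T}) : {perm T} * {perm T} :=
  (s.1 * s'.1, s.2 * s'.2)%g.

Lemma factors_stable D p s : factors D p s -> stable D s.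
Proof.
move=> /and3P[h1 h2 _]; apply/stableP => x xD.
by rewrite !perm_closed.
Qed.

Lemma join_permE D b (q q' : {perm T}) x : b \subset D -> perm_on b q -> perm_on (D :\: b) q' ->
  (q * q')%g x = if x \in b then q x else q' x.
Proof.
move=> sbD h h'; rewrite permM; case: ifP => xb; last by rewrite (out_perm h) ?xb.
by rewrite (out_perm h') // inE perm_closed // xb.
Qed.

Lemma card_box_maps_join D b s s' : b \subset D ->
  perm_on b s.1 -> perm_on b s.2 -> perm_on (D :\: b) s'.1 -> perm_on (D :\: b) s'.2 ->
  #|box_maps D (join_pair s s')| = (#|box_maps b s| * #|box_maps (D :\: b) s'|)%N.
Proof.
move=> sbD h1 h2 h1' h2'.
pose h (f : {ffun T -> option V} * {ffun T -> option V}) : {ffun T -> option V} :=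
  [ffun x => if x \in b then f.1 x else f.2 x].
rewrite -cardsX -(card_in_imset (f := h)); last first.
  move=> [f f'] [k k'] /=; rewrite !inE /= => /andP[/forallP hf /forallP hf'].
  move=> /andP[/forallP hk /forallP hk'] /ffunP e.
  have e1 : f = k.
    apply/ffunP => x; have := e x; rewrite !ffunE; case: ifP => // xb _.
    have /and3P[/eqP a _ _] := hf x; have /and3P[/eqP c _ _] := hk x.
    by move: a c; rewrite xb; case: (f x); case: (k x).
  have e2 : f' = k'.
    apply/ffunP => x; have := e x; rewrite !ffunE; case: ifP => // xb _.
    have /and3P[/eqP a _ _] := hf' x; have /and3P[/eqP c _ _] := hk' x.
    by move: a c; rewrite inE xb; case: (f' x); case: (k' x).
  by rewrite e1 e2.
apply: eq_card => f; apply/idP/imsetP.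
  rewrite inE => /forallP hf.
  pose f1 : {ffun T -> option V} := [ffun x => if x \in b then f x else None].
  pose f2 : {ffun T -> option V} := [ffun x => if x \in b then None else f x].
  exists (f1, f2); last by apply/ffunP => x; rewrite !ffunE; case: (x \in b).
  rewrite inE /=; apply/andP; split; rewrite inE; apply/forallP => x.
    rewrite !ffunE !perm_closed //; case: ifP => xb //=.
    have /and3P[a c e] := hf x; rewrite ?xb; move: a c e.
    by rewrite (subsetP sbD) //= !(join_permE _ sbD) // xb => -> -> ->.
  have out q : perm_on (D :\: b) q -> (q x \in b) = (x \in b).
    move=> hq; have [xE|xE] := boolP (x \in D :\: b).
      have := xE; rewrite -(perm_closed x hq) !inE => /andP[/negbTE-> _].
      by move: xE; rewrite !inE => /andP[/negbTE-> _].
    by rewrite (out_perm hq).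
  rewrite !ffunE !out //; case: ifP => xb /=; first by rewrite inE ?xb.
  have /and3P[a c e] := hf x; rewrite !inE ?xb /=; move: a c e.
  by rewrite !(join_permE _ sbD) // xb => -> -> ->.
move=> [[f1 f2]]; rewrite inE /= => /andP[]; rewrite !inE => /forallP hf1 /forallP hf2 ->.
apply/forallP => x; rewrite !ffunE /=.
have out q : perm_on (D :\: b) q -> x \notin b -> (q x \in b) = false.
  move=> hq xb; have [xE|xE] := boolP (x \in D :\: b).
    by have := xE; rewrite -(perm_closed x hq) !inE => /andP[/negbTE-> _].
  by rewrite (out_perm hq) //; apply/negbTE.
rewrite !(join_permE _ sbD) //; case: ifP => xb.
  rewrite !perm_closed // ?xb; have := hf1 x; rewrite ?xb => /and3P[a -> ->].
  by rewrite (subsetP sbD) ?andbT.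
rewrite !out ?xb //; have := hf2 x; rewrite inE xb /= => /and3P[-> -> ->] //.
Qed.

(** Both the sign and the number of placements are multiplicative over disjoint
stable sets. This is where the cumulant structure comes from. *)
Lemma pair_weight_join D b s s' : b \subset D ->
  perm_on b s.1 -> perm_on b s.2 -> perm_on (D :\: b) s'.1 -> perm_on (D :\: b) s'.2 ->
  pair_weight D (join_pair s s') = pair_weight b s * pair_weight (D :\: b) s'.
Proof.
move=> sbD h1 h2 h1' h2'; rewrite /pair_weight (card_box_maps_join sbD) //= odd_permM.
by rewrite signr_addb PoszM mulrACA.
Qed.

Definition restr_pair b s : {perm T} * {perm T} := (restr_perm b s.1, restr_perm b s.2).

Lemma stable_astabs U s : stable U s -> (s.1 \in ('N(U | 'P))%g) * (s.2 \in ('N(U | 'P))%g).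
Proof.
by move=> /stableP h; split; rewrite !inE; apply/subsetP => x xU;
  rewrite inE /= apermE; case: (h x xU).
Qed.

Lemma restr_pairE U s x : stable U s -> x \in U ->
  ((restr_pair U s).1 x = s.1 x) * ((restr_pair U s).2 x = s.2 x).
Proof. by move=> sU xU; rewrite /= !restr_permE // (stable_astabs sU). Qed.

Lemma restr_pair_on U s : perm_on U (restr_pair U s).1 && perm_on U (restr_pair U s).2.
Proof. by rewrite !restr_perm_on. Qed.

Lemma eq_connected_on D s s' : (forall x, x \in D -> s.1 x = s'.1 x /\ s.2 x = s'.2 x) ->
  connected_on D s = connected_on D s'.
Proof.
move=> e; apply: eq_forallb => U; case sUD: (U \subset D) => //=; case: (U != set0) => //=.
congr (_ ==> _); apply: eq_forallb => x; case xU: (x \in U) => //=.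
by have [-> ->] := e x (subsetP sUD x xU).
Qed.

Lemma join_restr D b p s : b \subset D -> factors D p s -> stable b s ->
  join_pair (restr_pair b s) (restr_pair (D :\: b) s) = s.
Proof.
move=> sbD fD sb; have sE := stableD sb (factors_stable fD).
have /andP[b1 b2] := restr_pair_on b s; have /andP[e1 e2] := restr_pair_on (D :\: b) s.
have /and3P[p1 p2 _] := fD.
have aux x : x \notin b -> x \notin D :\: b -> x \notin D.
  by move=> xb; rewrite inE xb.
rewrite [RHS]surjective_pairing; congr pair; apply/permP => x;
  rewrite (join_permE x sbD) //; case: ifP => xb; rewrite ?(restr_pairE sb xb) //;
  (have [xE|xE] := boolP (x \in D :\: b); first by rewrite (restr_pairE sE xE));
  by rewrite (out_perm _ xE) // (out_perm _ (aux x (negbT xb) xE)).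
Qed.

(** Split a factorization at the orbit [b] of a point. This is the recursion of
moments in terms of cumulants, with the sums over connected factorizations as
cumulants. *)
Lemma all_sum_rec D p x0 : x0 \in D ->
  all_sum D p = \sum_(b : {set T} | (x0 \in b) && (b \subset D))
    connected_sum b p * all_sum (D :\: b) p.
Proof.
move=> xD; rewrite /all_sum (partition_big (fun s => component s x0)
  (fun b : {set T} => (x0 \in b) && (b \subset D))) /=; last first.
  by move=> s fs; rewrite component_id component_min // (factors_stable fs).
apply: eq_bigr => b /andP[xb sbD].
rewrite /connected_sum big_distrlr /= pair_big /=.
rewrite (reindex_onto (fun q => join_pair q.1 q.2)
  (fun s => (restr_pair b s, restr_pair (D :\: b) s))) /=; last first.
  move=> s /andP[fs /eqP e]; apply: (@join_restr _ _ p) => //.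
  by rewrite -e component_stable.
apply: eq_big => [[s s']|[s s']] /=; last first.
  move=> /andP[_ /eqP [e e']]; have /andP[b1 b2] := restr_pair_on b (join_pair s s').
  have /andP[c1 c2] := restr_pair_on (D :\: b) (join_pair s s').
  by rewrite e in b1 b2; rewrite e' in c1 c2; rewrite (pair_weight_join sbD).
apply/idP/idP.
  move=> /andP[/andP[fD /eqP eb] /eqP [e e']].
  have sb : stable b (join_pair s s') by rewrite -eb component_stable.
  have sE := stableD sb (factors_stable fD).
  have := restr_pair_on b (join_pair s s'); have := restr_pair_on (D :\: b) (join_pair s s').
  have hb x := restr_pairE (x := x) sb; have hE x := restr_pairE (x := x) sE.
  rewrite e in hb *; rewrite e' in hE * => /andP[c1 c2] /andP[b1 b2].
  have /and3P[_ _ /forallP fp] := fD.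
  apply/andP; split; [apply/andP; split|]; rewrite /factors ?b1 ?b2 ?c1 ?c2 /=.
  - apply/forallP => x; apply/implyP => xb'.
    have := implyP (fp x) (subsetP sbD x xb'); rewrite -(hb x xb').2 -(hb (s.2 x) _).1 //.
    by rewrite perm_closed.
  - rewrite (@eq_connected_on _ _ (join_pair s s')) => [|x xb'].
      by rewrite -eb component_connected.
    by rewrite -(hb x xb').1 -(hb x xb').2.
  apply/forallP => x; apply/implyP => xE.
  have xD' : x \in D by move: xE; rewrite inE => /andP[].
  have := implyP (fp x) xD'; rewrite -(hE x xE).2 -(hE (s'.2 x) _).1 //.
  by rewrite perm_closed.
move=> /andP[/andP[/and3P[b1 b2 /forallP fb] cb] /and3P[c1 c2 /forallP fE]].
have sb : stable b (join_pair s s').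
  by apply/stableP => x xb'; rewrite !(join_permE _ sbD) // xb' !perm_closed.
have je (x : T) : x \in b -> (join_pair s s').1 x = s.1 x /\ (join_pair s s').2 x = s.2 x.
  by move=> xb'; rewrite !(join_permE _ sbD) // xb'.
have je' (x : T) : x \notin b -> (join_pair s s').1 x = s'.1 x /\ (join_pair s s').2 x = s'.2 x.
  by move=> xb'; rewrite !(join_permE _ sbD) // (negbTE xb').
have fD : factors D p (join_pair s s').
  apply/and3P; split.
  - by apply: perm_onM; [exact: subset_trans b1 sbD | exact: subset_trans c1 (subsetDl _ _)].
  - by apply: perm_onM; [exact: subset_trans b2 sbD | exact: subset_trans c2 (subsetDl _ _)].
  apply/forallP => x; apply/implyP => xD'; have [xb'|xb'] := boolP (x \in b).
    have [_ ->] := je x xb'; have [->] := je (s.2 x) (etrans (perm_closed x b2) xb').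
    by have := implyP (fb x) xb'.
  have xE : x \in D :\: b by rewrite inE xb'.
  have [_ ->] := je' x xb'.
  have nb : s'.2 x \notin b by have := perm_closed x c2; rewrite xE inE => /andP[].
  by have [-> _] := je' _ nb; have := implyP (fE x) xE.
have sE := stableD sb (factors_stable fD).
rewrite fD /=; apply/andP; split.
  rewrite eqEsubset component_min //=.
  have := forallP cb (component (join_pair s s') x0).
  have -> : stable (component (join_pair s s') x0) s.
    have cs : component (join_pair s s') x0 \subset b by apply: component_min.
    apply/stableP => x xC; have [<- <-] := je x (subsetP cs x xC).
    exact: (stableP _ _ (component_stable _ _)).
  rewrite component_min //= andbT => /implyP.
  have -> : component (join_pair s s') x0 != set0.
    by apply/set0Pn; exists x0; apply: component_id.
  by move=> /(_ isT)/eqP ->.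
apply/eqP; rewrite [in RHS](surjective_pairing s) [in RHS](surjective_pairing s').
have on1 (U : {set T}) (q q' : {perm T}) : perm_on U q -> perm_on U q' ->
    (forall x, x \in U -> q x = q' x) -> q = q'.
  move=> h h' e; apply/permP => x; have [xU|xU] := boolP (x \in U); first exact: e.
  by rewrite (out_perm h) // (out_perm h').
have /andP[r1 r2] := restr_pair_on b (join_pair s s').
have /andP[t1 t2] := restr_pair_on (D :\: b) (join_pair s s').
congr pair; congr pair.
- by apply: on1 r1 b1 _ => x xb'; rewrite (restr_pairE sb xb').1; case: (je x xb').
- by apply: on1 r2 b2 _ => x xb'; rewrite (restr_pairE sb xb').2; case: (je x xb').
- apply: on1 t1 c1 _ => x xE; rewrite (restr_pairE sE xE).1.
  by have /je'[] : x \notin b by move: xE; rewrite inE => /andP[].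
- apply: on1 t2 c2 _ => x xE; rewrite (restr_pairE sE xE).2.
  by have /je'[] : x \notin b by move: xE; rewrite inE => /andP[].
Qed.

Lemma all_sum0 p : all_sum set0 p = 1.
Proof.
rewrite /all_sum (big_pred1 (1, 1)%g) => [|s]; last first.
  apply/and3P/eqP => [[h1 h2 _]|->] /=; last first.
    by rewrite !perm_on1; split => //; apply/forallP => x; rewrite inE.
  have xN (x : T) : x \notin set0 by rewrite inE.
  by rewrite [s]surjective_pairing; congr pair; apply/permP => x; rewrite perm1;
    [exact: out_perm h1 (xN x)|exact: out_perm h2 (xN x)].
rewrite /pair_weight odd_perm1 mul1r (_ : box_maps _ _ = [set [ffun=> None]]) ?cards1 //.
apply/setP => f; rewrite !inE; apply/forallP/eqP => [h|-> x]; last first.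
  by rewrite !ffunE inE !eqxx.
by apply/ffunP => x; have /and3P[/eqP e _ _] := h x; move: e; rewrite inE ffunE; case: (f x).
Qed.

End PairSums.

Section Transport.
Variables (T' T V : finType) (row col : V -> nat) (t : T' -> T).
Hypothesis t_inj : injective t.
Variables (D : {set T}) (p' : {perm T'}) (p : {perm T}).
Hypothesis tD : forall x, (x \in D) = (x \in codom t).
Hypothesis tp : forall y, p (t y) = t (p' y).

Definition pair_along (s : {perm T'} * {perm T'}) : {perm T} * {perm T} :=
  (perm_along t_inj s.1, perm_along t_inj s.2).

Lemma perm_on_along s : perm_on D (perm_along t_inj s).
Proof.
apply/subsetP => x; rewrite inE tD; apply: contraR => xt.
by rewrite perm_along_out.
Qed.

Lemma perm_on_alongP q : perm_on D q -> exists s, q = perm_along t_inj s.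
Proof.
by move=> h; apply: perm_along_surj => x xt; apply: (out_perm h); rewrite tD.
Qed.

Lemma factors_along s : factors D p (pair_along s) = factors setT p' s.
Proof.
rewrite /factors !perm_on_along /=.
have -> : perm_on setT s.1 by apply/subsetP => x _; rewrite inE.
have -> : perm_on setT s.2 by apply/subsetP => x _; rewrite inE.
apply/forallP/forallP => h y /=.
  by have := h (t y); rewrite tD codom_f !perm_alongE tp (inj_eq t_inj) inE.
apply/implyP; rewrite tD => /codomP[x ->]; have := h x.
by rewrite !perm_alongE tp (inj_eq t_inj) inE.
Qed.

Lemma stable_along (U : {set T}) s : U \subset D ->
  stable U (pair_along s) = stable (t @^-1: U) s.
Proof.
move=> sUD; apply/stableP/stableP => [h y|h x xU].
  by rewrite inE => /h /=; rewrite !perm_alongE !inE.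
have := subsetP sUD x xU; rewrite tD => /codomP[y e]; rewrite e in xU *.
by have := h y; rewrite !inE /= !perm_alongE; apply.
Qed.

Lemma connected_on_along s : connected_on D (pair_along s) = connected_on setT s.
Proof.
have imD : t @^-1: D = setT by apply/setP => y; rewrite !inE tD codom_f.
have Dim : D = t @: setT.
  apply/setP => x; rewrite tD; apply/codomP/imsetP => [[y ->]|[y _ ->]]; by exists y.
apply/forallP/forallP => h U; apply/implyP => /and3P[sU U0 stU].
  have sD : t @: U \subset D by rewrite Dim imsetS.
  have pre : t @^-1: (t @: U) = U.
    by apply/setP => y; rewrite inE mem_imset.
  have := h (t @: U); rewrite sD stable_along // pre stU andbT /= imset_eq0 U0 /=.
  by move=> /eqP e; rewrite -pre e imD.
have := h (t @^-1: U); rewrite subsetT /= -stable_along // stU andbT => h'.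
have : t @^-1: U == setT.
  apply: (implyP h'); have /set0Pn[x xU] := U0.
  have := subsetP sU x xU; rewrite tD => /codomP[y e].
  by apply/set0Pn; exists y; rewrite inE -e.
move=> /eqP e; rewrite eqEsubset sU /= Dim; apply/subsetP => _ /imsetP[y _ ->].
by have := in_setT y; rewrite -e inE.
Qed.

Lemma card_box_maps_along s :
  #|box_maps row col D (pair_along s)| = #|box_maps row col setT s|.
Proof.
pose h (f : {ffun T -> option V}) : {ffun T' -> option V} := [ffun y => f (t y)].
rewrite -(card_in_imset (f := h)); last first.
  move=> f f'; rewrite !inE => /forallP hf /forallP hf' /ffunP e; apply/ffunP => x.
  have [/codomP[y ->]|xt] := boolP (x \in codom t); first by have := e y; rewrite !ffunE.
  have /and3P[a _ _] := hf x; have /and3P[c _ _] := hf' x; move: a c.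
  by rewrite tD (negbTE xt); case: (f x); case: (f' x).
apply: eq_card => f'; apply/imsetP/idP => [[f + ->]|].
  rewrite !inE => /forallP hf; apply/forallP => y; rewrite !ffunE inE.
  by have := hf (t y); rewrite /= !perm_alongE tD codom_f.
rewrite inE => /forallP hf'.
pose f : {ffun T -> option V} := [ffun x => if [pick y | t y == x] is Some y then f' y else None].
have fE y : f (t y) = f' y.
  rewrite ffunE; case: pickP => [z /eqP /t_inj -> //|/(_ y)]; by rewrite eqxx.
have fN x : x \notin codom t -> f x = None.
  rewrite ffunE => xt; case: pickP => // y /eqP e; by case/negP: xt; rewrite -e codom_f.
exists f; last by apply/ffunP => y; rewrite ffunE fE.
rewrite inE; apply/forallP => x; rewrite tD.
have [/codomP[y ->]|xt] := boolP (x \in codom t); last first.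
  by rewrite /= !perm_along_out // fN // !eqxx.
by have := hf' y; rewrite /= !perm_alongE !fE inE.
Qed.

(** A subfamily of the cycle lengths is the same problem on a subset of the points,
up to the injection [t]. *)
Lemma connected_sum_along :
  connected_sum row col setT p' = connected_sum row col D p.
Proof.
pose un (q : {perm T}) : {perm T'} := odflt 1%g [pick s | perm_along t_inj s == q].
have unK s : un (perm_along t_inj s) = s.
  rewrite /un; case: pickP => [s' /eqP /perm_along_inj -> //|/(_ s)]; by rewrite eqxx.
rewrite /connected_sum [RHS](reindex_onto pair_along (fun s => (un s.1, un s.2))) /=.
  apply: eq_big => [[s1 s2]|[s1 s2] _].
    by rewrite factors_along connected_on_along !unK eqxx andbT.
  by rewrite /pair_weight card_box_maps_along /= odd_perm_along.
move=> [s1 s2] /andP[/and3P[/= h1 h2 _] _].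
by have [q1 ->] := perm_on_alongP h1; have [q2 ->] := perm_on_alongP h2; rewrite /pair_along /= !unK.
Qed.
End Transport.

(** * Cumulants and connected factorizations *)

Section BlockIndices.
Variables (V : finType) (row col : V -> nat) (ks : seq nat).
Hypothesis ks_pos : all (fun k => (1 <= k)%N) ks.
Local Notation N := (sumn ks).
Local Notation p := (block_cycle ks).

Definition block_index (x : 'I_N) : 'I_(size ks) := Ordinal (reshape_indexP (ltn_ord x)).

Definition blocks (S : {set 'I_(size ks)}) : {set 'I_N} := block_index @^-1: S.

Lemma eq_position (ls : seq nat) (x y : 'I_(sumn ls)) : reshape_index ls x = reshape_index ls y ->
  reshape_offset ls x = reshape_offset ls y -> x = y.
Proof.
move=> e1 e2; apply: val_inj; rewrite /= -(reshape_indexK ls x) -(reshape_indexK ls y).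
by rewrite e1 e2.
Qed.

Lemma block_cycle_position (ls : seq nat) (x : 'I_(sumn ls)) :
  (reshape_index ls (block_cycle ls x) = reshape_index ls x) *
  (reshape_offset ls (block_cycle ls x)
    = (reshape_offset ls x).+1 %% nth 0%N ls (reshape_index ls x))%N.
Proof.
have o := reshape_offsetP (ltn_ord x).
have m := ltn_pmod (reshape_offset ls x).+1 (leq_ltn_trans (leq0n _) o).
by rewrite permE /=; split; rewrite ?(flatten_indexKl m) ?(flatten_indexKr m).
Qed.

Lemma block_cycle_iter m x : let y := iter m p x in
  (reshape_index ks y = reshape_index ks x) *
  (reshape_offset ks y = (reshape_offset ks x + m) %% nth 0%N ks (reshape_index ks x))%N.
Proof.
elim: m => [|m [IH1 IH2]] /=.
  by rewrite addn0 modn_small //; apply: reshape_offsetP.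
by rewrite !block_cycle_position IH1 IH2 -addn1 modnDml addn1 addnS.
Qed.

Lemma closed_block_index (b : {set 'I_N}) x y : (forall z, z \in b -> p z \in b) ->
  x \in b -> block_index y = block_index x -> y \in b.
Proof.
move=> hb xb /(congr1 val) /= e.
have ox := reshape_offsetP (ltn_ord x); have oy := reshape_offsetP (ltn_ord y).
rewrite e in oy; set k := nth 0%N ks _ in ox oy.
have -> : y = iter (reshape_offset ks y + (k - reshape_offset ks x)) p x.
  apply: eq_position; rewrite block_cycle_iter // -/k.
  by rewrite addnCA subnKC ?(ltnW ox) // modnDr modn_small.
by elim: (_ + _)%N => //= m; apply: hb.
Qed.

Lemma closed_blocks (b : {set 'I_N}) : (forall z, z \in b -> p z \in b) ->
  blocks (block_index @: b) = b.
Proof.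
move=> hb; apply/setP => y; rewrite inE; apply/imsetP/idP => [[x xb e]|yb].
  exact: closed_block_index hb xb e.
by exists y.
Qed.

(** A set which carries a factorization of [p] is a union of cycles of [p]. *)
Lemma connected_sum_open (b : {set 'I_N}) : blocks (block_index @: b) != b ->
  connected_sum row col b p = 0.
Proof.
move=> nb; rewrite /connected_sum big_pred0 // => s; apply/negP => /andP[/and3P[h1 h2 /forallP h] _].
case/eqP: nb; apply: closed_blocks => z zb.
by have /implyP/(_ zb)/eqP <- := h z; rewrite !perm_closed.
Qed.

Lemma block_start (i : 'I_(size ks)) : exists x, block_index x = i.
Proof.
have ki : (0 < nth 0 ks i)%N by apply: (allP ks_pos); apply: mem_nth.
exists (Ordinal (flatten_indexP ki)); apply: val_inj; rewrite /=.
by rewrite flatten_indexKl.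
Qed.

Lemma blocksK (S : {set 'I_(size ks)}) : block_index @: blocks S = S.
Proof.
apply/setP => i; apply/imsetP/idP => [[x /[!inE] xS ->] //|iS].
by have [x e] := block_start i; exists x; rewrite // inE e.
Qed.

Lemma all_sum_blocks (S : {set 'I_(size ks)}) i : i \in S -> all_sum row col (blocks S) p =
  \sum_(S' : {set 'I_(size ks)} | (i \in S') && (S' \subset S))
    connected_sum row col (blocks S') p * all_sum row col (blocks (S :\: S')) p.
Proof.
move=> iS; have [x xi] := block_start i.
rewrite (@all_sum_rec _ _ _ _ _ _ x) ?inE ?xi //.
rewrite (bigID (fun b : {set 'I_N} => blocks (block_index @: b) == b)) /= addrC big1 ?add0r; last first.
  by move=> b /andP[_ nb]; rewrite connected_sum_open ?mul0r.
rewrite (reindex_onto blocks (fun b : {set 'I_N} => block_index @: b)) /=; last first.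
  by move=> b /andP[_ /eqP].
apply: eq_big => [S'|S' _]; last by rewrite /blocks preimsetD.
rewrite blocksK !eqxx !andbT inE xi; congr (_ && _).
apply/idP/idP => h; last by apply: preimsetS.
by rewrite -[S']blocksK -[S]blocksK imsetS.
Qed.

Lemma all_sum_partitions (S : {set 'I_(size ks)}) : all_sum row col (blocks S) p =
  \sum_(P : {set {set 'I_(size ks)}} | partition P S)
    \prod_(b in P) connected_sum row col (blocks b) p.
Proof.
have [n] := ubnP #|S|; elim: n S => // n IH S hS.
have [->|/set0Pn[i iS]] := eqVneq S set0.
  rewrite /blocks preimset0 all_sum0 (big_pred1 set0) ?big_set0 // => P.
  by rewrite partition_set0.
rewrite (sum_partition_rec _ iS) (all_sum_blocks iS); apply: eq_bigr => b /andP[ib bS].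
rewrite -IH // -ltnS (leq_trans _ hS) // ltnS; apply: proper_card.
rewrite properEneq subsetDl andbT; apply: contraTneq iS => <-; by rewrite inE ib.
Qed.

Section Subfamily.
Variable b : {set 'I_(size ks)}.
Local Notation ks' := (subfamily b).
Local Notation sel := (nth 0%N [seq val i | i <- enum b]).

Lemma nth_subfamily j : (j < #|b|)%N -> nth 0%N ks' j = nth 0%N ks (sel j).
Proof.
move=> hj; rewrite /subfamily; case: (enum b) (cardE b) => [|i s] e; first by rewrite e in hj.
by rewrite !(nth_map i) -?e.
Qed.

Lemma embed_proof (y : 'I_(sumn ks')) :
  (reshape_offset ks' y < nth 0%N ks (sel (reshape_index ks' y)))%N.
Proof.
rewrite -nth_subfamily; first exact: reshape_offsetP.
by rewrite -(size_subfamily b); apply: reshape_indexP.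
Qed.

(** Sends the blocks of a subfamily to the corresponding blocks of the family, with
the same offsets. *)
Definition embed (y : 'I_(sumn ks')) : 'I_N := Ordinal (flatten_indexP (embed_proof y)).

Lemma embed_position y :
  (reshape_index ks (embed y) = sel (reshape_index ks' y)) *
  (reshape_offset ks (embed y) = reshape_offset ks' y).
Proof.
by split; rewrite /= ?(flatten_indexKl (embed_proof y)) ?(flatten_indexKr (embed_proof y)).
Qed.

Lemma index_lt (y : 'I_(sumn ks')) : (reshape_index ks' y < #|b|)%N.
Proof. by rewrite -(size_subfamily b); apply: reshape_indexP. Qed.

Lemma embed_inj : injective embed.
Proof.
move=> y z e; apply: eq_position; last by rewrite -!embed_position e.
have := congr1 (fun x : 'I_N => reshape_index ks x) e; rewrite !embed_position => /eqP.
rewrite nth_uniq ?size_map -?cardE ?index_lt //; first by move/eqP.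
by rewrite (map_inj_uniq val_inj) enum_uniq.
Qed.

Lemma connected_sum_subfamily :
  connected_sum row col setT (block_cycle ks') = connected_sum row col (blocks b) p.
Proof.
apply: (connected_sum_along row col embed_inj) => [x|y]; last first.
  apply: eq_position; rewrite !(block_cycle_position, embed_position) //.
  by rewrite nth_subfamily // index_lt.
rewrite inE; apply/idP/codomP => [xb|[y ->]].
  pose j := index (block_index x) (enum b).
  have jb : (j < #|b|)%N by rewrite cardE index_mem mem_enum.
  have sj : sel j = reshape_index ks x.
    by rewrite (nth_map (block_index x)) ?nth_index ?mem_enum // -cardE.
  have o : (reshape_offset ks x < nth 0%N ks' j)%N.
    by rewrite nth_subfamily // sj; apply: reshape_offsetP.
  exists (Ordinal (flatten_indexP o)); apply: eq_position.
    by rewrite embed_position /= flatten_indexKl.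
  by rewrite embed_position /= flatten_indexKr.
have hy := index_lt y.
have -> : block_index (embed y) = nth (block_index (embed y)) (enum b) (reshape_index ks' y).
  apply: val_inj; rewrite /= -[RHS](nth_map _ 0%N) -?cardE //.
  by have [-> _] := embed_position y.
by rewrite -mem_enum mem_nth // -cardE.
Qed.
End Subfamily.
End BlockIndices.

Lemma subfamilyT (ks : seq nat) : @subfamily ks setT = ks.
Proof.
rewrite /subfamily enum_setT -enumT -[RHS](mkseq_nth 0%N) /mkseq -val_enum_ord.
by rewrite -map_comp.
Qed.

Lemma all_subfamily (P : pred nat) (ks : seq nat) (b : {set 'I_(size ks)}) :
  all P ks -> all P (subfamily b).
Proof.
move=> /allP h; apply/allP => _ /mapP[i _ ->]; apply: h; exact: mem_nth.
Qed.

(** Both families solve the moment-cumulant relation, which determines the term of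
the one-block partition from the others. *)
Lemma cumulant_connected (A : comNzRingType) (mom : seq nat -> A) (V : finType) (row col : V -> nat) :
  (forall ks, all (fun k => (1 <= k)%N) ks ->
    mom ks = (all_sum row col setT (block_cycle ks))%:~R) ->
  forall ks, ks != [::] -> all (fun k => (1 <= k)%N) ks ->
    cumulant mom ks = (connected_sum row col setT (block_cycle ks))%:~R.
Proof.
move=> hmom ks; have [n] := ubnP (size ks); elim: n ks => // n IH ks hn ks0 kp.
have BT : blocks (ks := ks) setT = setT by apply/setP => x; rewrite !inE.
have PT : partition [set setT] [set: 'I_(size ks)].
  apply/and3P; split; last by rewrite inE eq_sym -card_gt0 cardsT card_ord lt0n size_eq0.
    by rewrite /cover big_set1.
  by apply/trivIsetP => b c /set1P-> /set1P->; rewrite eqxx.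
have := moment_cumulantE mom ks0.
rewrite hmom // -[in X in X = _]BT (all_sum_partitions _ _ kp) rmorph_sum /=.
rewrite (bigD1 [set setT]) //= [in RHS](bigD1 [set setT]) //= !big_set1 subfamilyT BT.
set X := \sum_(i | _) _; set Y := \sum_(i | _) _; suff -> : X = Y by move/addIr.
apply: eq_bigr => P /andP[PP nP]; rewrite rmorph_prod; apply: eq_bigr => b bP.
have /andP[b0 bl] := card_block PP nP bP.
rewrite IH ?connected_sum_subfamily ?all_subfamily //.
  by rewrite size_subfamily -ltnS (leq_trans _ hn).
by rewrite -size_eq0 size_subfamily -lt0n.
Qed.

(** * Traces on principal ideals of a group algebra *)

Section IdealTrace.
Variables (F : numFieldType) (gT : finGroupType).
Local Notation G := [set: gT]%G.
Local Notation aG := (regular_repr F G).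
Variables (u : 'rV[F]_(gcard G)) (alpha : F).

Definition group_coef (g : gT) : F := u 0 (gring_index G g).
Local Notation c := group_coef.
Local Notation E := (enveloping_algebra_mx aG *m lin_mul_row u).

Lemma gring_index_inj : injective (gring_index G).
Proof. by move=> g h e; rewrite -(@gring_indexK _ G g) ?inE // e gring_indexK ?inE. Qed.

Lemma regular_entry h j : (u *m aG h) 0 j = c (enum_val j * h^-1)%g.
Proof.
rewrite !mxE (bigD1 (gring_index G (enum_val j * h^-1)%g)) //= big1 ?addr0.
  by rewrite !mxE eqxx /= gring_indexK ?inE // mulgKV gring_valK eqxx mulr1.
move=> k nk; rewrite !mxE /=; case: eqP => [e|_]; last by rewrite mulr0.
case/eqP: nk; rewrite e gring_indexK ?inE // mulgK gring_valK //.
Qed.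

Lemma ideal_row i : row i E = u *m aG (enum_val i).
Proof. by rewrite row_mul rowK mul_rV_lin1 /= mxvecK. Qed.

Lemma ideal_entry i j : E i j = c (enum_val j * (enum_val i)^-1)%g.
Proof. by rewrite -regular_entry -ideal_row [RHS]mxE. Qed.

Hypothesis cc : forall z, \sum_h c (z * h^-1)%g * c h = alpha * c z.
Hypothesis c1 : c 1%g = 1.

(** The hypothesis says that the element [u] of the group algebra satisfies
[u * u = alpha * u]; [E] is the matrix of the multiplication by [u]. *)
Lemma ideal_square : E *m E = alpha *: E.
Proof.
apply/matrixP => i j; rewrite mxE [RHS]mxE ideal_entry -cc.
rewrite (reindex (fun k : 'I_(gcard G) => (enum_val k * (enum_val i)^-1)%g : gT)) /=.
  apply: eq_bigr => k _; rewrite !ideal_entry mulrC; congr (c _ * _).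
  by rewrite invMg invgK mulgA mulgKV.
exists (fun h => gring_index G (h * enum_val i)%g) => [k _|h _].
  by rewrite mulgKV gring_valK.
by rewrite gring_indexK ?inE // mulgK.
Qed.

Lemma trace_ideal x : \tr (E *m aG x) = \sum_g c (g * x^-1 * g^-1)%g.
Proof.
rewrite /mxtrace (reindex (fun k : 'I_(gcard G) => enum_val k : gT)) /=.
  apply: eq_bigr => k _.
  have := congr1 (fun r : 'rV_(gcard G) => r 0 k) (row_mul k E (aG x)).
  rewrite /= [LHS]mxE => ->.
  rewrite ideal_row -mulmxA -repr_mxM ?inE // regular_entry invMg mulgA //.
exists (gring_index G) => [k _|h _]; first exact: gring_valK.
by rewrite gring_indexK ?inE.
Qed.

(** The matrix [E] is [alpha] times a projection onto the ideal. Write it as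
[Q *m P] with [P] a basis of the ideal; then [P *m Q] is the scalar [alpha], and
the trace of the restricted action is moved across the product. *)
Lemma trace_submod x :
  alpha * \tr (submod_repr (cyclic_mx_module aG u) x) = \sum_g c (g * x^-1 * g^-1)%g.
Proof.
rewrite -trace_ideal; set S := submod_repr _ x.
set U := cyclic_mx aG u.
have UE : (U :=: E)%MS by apply: genmxE.
have sq := ideal_square; move: (E) sq UE => E0 sq UE.
set P := row_base U.
have PE : P *m E0 = alpha *: P.
  have /submxP[Z eZ] : (P <= E0)%MS by rewrite /P eq_row_base UE.
  by rewrite eZ -mulmxA sq scalemxAr.
have /submxP[Q eQ] : (E0 <= P)%MS by rewrite /P eq_row_base UE.
have PQ : P *m Q = alpha%:M.
  apply: (row_free_inj (row_base_free U)).
  by rewrite -mulmxA -eQ PE mul_scalar_mx.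
have PS : P *m aG x = S *m P.
  have := val_submodJ (cyclic_mx_module aG u) 1%:M (in_setT x).
  by rewrite mul1mx /val_submod /= mul1mx => ->.
rewrite eQ -mulmxA PS [RHS]mxtrace_mulC -mulmxA PQ mul_mx_scalar mxtraceZ //.
Qed.

(** Taking the ratio with the identity element removes the constant [alpha]; it is
nonzero because its product with the rank is the order of the group. *)
Lemma trace_submod_ratio x :
  \tr (submod_repr (cyclic_mx_module aG u) x) / (\rank (cyclic_mx aG u))%:R
  = (\sum_g c (g * x^-1 * g^-1)%g) / #|gT|%:R.
Proof.
have := trace_submod 1; rewrite repr_mx1 mxtrace1.
under eq_bigr do rewrite invg1 mulg1 mulgV c1.
rewrite sumr_const => e.
have cG : (#|gT|%:R : F) != 0 by rewrite pnatr_eq0 -lt0n; apply/card_gt0P; exists 1%g.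
have e' : alpha * (\rank (cyclic_mx aG u))%:R = #|gT|%:R.
  exact: e.
have : alpha * (\rank (cyclic_mx aG u))%:R != 0 by rewrite e'.
rewrite mulf_eq0 negb_or => /andP[a0 d0].
apply: (mulfI a0); rewrite -trace_submod mulrA -e'.
by rewrite invfM mulrCA !mulrA mulfK // mulrC mulrAC mulrA.
Qed.
End IdealTrace.

(** * Young symmetrizers *)

Section YoungSymmetrizer.
Variables (F : numFieldType) (la : seq nat).
Hypothesis la_sorted : sorted geq la.
Local Notation n := (sumn la).
Local Notation ri := (reshape_index la).
Local Notation ro := (reshape_offset la).
Local Notation R := (row_stab la).
Local Notation C := (col_stab la).

Lemma row_stabP (p : 'S_n) : reflect (forall i, ri (p i) = ri i) (p \in R).
Proof. by rewrite inE; apply: (iffP forallP) => h i; apply/eqP/(h i). Qed.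

Lemma col_stabP (p : 'S_n) : reflect (forall i, ro (p i) = ro i) (p \in C).
Proof. by rewrite inE; apply: (iffP forallP) => h i; apply/eqP/(h i). Qed.

Lemma row_stabV (p : 'S_n) : (p^-1%g \in R) = (p \in R).
Proof.
apply/row_stabP/row_stabP => h i; first by rewrite -{2}(permK p i) h.
by rewrite -{2}(permKV p i) h.
Qed.

Lemma col_stabV (p : 'S_n) : (p^-1%g \in C) = (p \in C).
Proof.
apply/col_stabP/col_stabP => h i; first by rewrite -{2}(permK p i) h.
by rewrite -{2}(permKV p i) h.
Qed.

Lemma row_stabM (p q : 'S_n) : p \in R -> (p * q)%g \in R = (q \in R).
Proof.
move=> /row_stabP hp; apply/row_stabP/row_stabP => h i; last by rewrite permM h hp.
by have := h (p^-1%g i); rewrite permM permKV => ->; rewrite -hp permKV.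
Qed.

Lemma col_stabM (p q : 'S_n) : q \in C -> (p * q)%g \in C = (p \in C).
Proof.
move=> /col_stabP hq; apply/col_stabP/col_stabP => h i; last by rewrite permM hq h.
by rewrite -hq -permM h.
Qed.

Lemma row_col_stab1 (p : 'S_n) : p \in R -> p \in C -> p = 1%g.
Proof.
by move=> /row_stabP hr /col_stabP hc; apply/permP => i; rewrite perm1; apply: eq_position.
Qed.

Definition young_coef (g : 'S_n) : F :=
  \sum_(p in R) \sum_(q in C) (-1) ^+ odd_perm q * ((p * q)%g == g)%:R.

Lemma young_coefE g : group_coef (young_symmetrizer F la) g = young_coef g.
Proof.
rewrite /group_coef /young_symmetrizer summxE; apply: eq_bigr => p _.
rewrite summxE; apply: eq_bigr => q _; rewrite !mxE eqxx /=.
by rewrite eq_sym (inj_eq (@gring_index_inj _)).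
Qed.

Lemma young_coef_row (p g : 'S_n) : p \in R -> young_coef (p * g)%g = young_coef g.
Proof.
move=> pR; rewrite /young_coef (reindex_inj (mulgI p)) /=.
apply: eq_big => [p'|p' _]; first by rewrite row_stabM.
by apply: eq_bigr => q _; rewrite -mulgA (inj_eq (mulgI p)).
Qed.

Lemma young_coef_col (q g : 'S_n) : q \in C -> young_coef (g * q)%g = (-1) ^+ odd_perm q * young_coef g.
Proof.
move=> qC; rewrite /young_coef mulr_sumr; apply: eq_bigr => p _.
rewrite (reindex_inj (mulIg q)) /= mulr_sumr.
apply: eq_big => [q'|q' _]; first by rewrite col_stabM.
rewrite mulgA (inj_eq (mulIg q)) odd_permM signr_addb mulrA; congr (_ * _).
by rewrite mulrC.
Qed.

Lemma young_coef1 : young_coef 1%g = 1.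
Proof.
rewrite /young_coef (bigD1 1%g) /=; last by apply/row_stabP => i; rewrite perm1.
rewrite (bigD1 1%g) /=; last by apply/col_stabP => i; rewrite perm1.
rewrite mulg1 eqxx odd_perm1 expr0 mulr1 big1 => [|q /andP[qC nq]]; last first.
  by rewrite mul1g (negbTE nq) mulr0.
rewrite addr0 big1 ?addr0 // => p /andP[pR np]; rewrite big1 // => q qC.
case: eqP => [/eqP|_]; last by rewrite mulr0.
rewrite -eq_invg_mul => /eqP e; case/eqP: np; apply: row_col_stab1 pR _.
by rewrite -col_stabV e.
Qed.

Lemma col_initial i j : (j < nth 0 la i)%N = (i < find (fun k => k <= j)%N la)%N.
Proof.
have [ltf|lef] := ltnP i (find (fun k => k <= j)%N la).
  by have := before_find 0%N ltf; rewrite leqNgt => /negbFE.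
apply/negbTE; rewrite -leqNgt; have [iR|] := ltnP i (size la); last first.
  by move=> /(nth_default 0%N) ->.
have hs : has (fun k => k <= j)%N la by rewrite has_find (leq_ltn_trans lef).
apply: leq_trans (nth_find 0%N hs).
apply: (sorted_leq_nth (leT := geq)) => //; rewrite ?inE ?(leq_ltn_trans lef) //.
  by move=> a b c /= h1 h2; apply: leq_trans h2 h1.
by move=> a /=.
Qed.

Lemma box_exists (i j : nat) : (j < nth 0 la i)%N -> exists x : 'I_n, ri x = i /\ ro x = j.
Proof.
move=> h; exists (Ordinal (flatten_indexP h)).
by rewrite /= flatten_indexKl ?flatten_indexKr.
Qed.

Lemma ro_lt (x : 'I_n) : (ro x < nth 0 la (ri x))%N.
Proof. exact: reshape_offsetP. Qed.

(** Suppose that the column of [z x0], of height [r], does not reach the row of [x0].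
Among the boxes of the first [r] rows, those sent by [z] to a given column are at
most as many as the boxes of this column in these rows, and strictly fewer for
the column of [z x0], one box of which is the image of the lower box [x0]. But
both totals are the number of boxes of these rows. *)
Lemma straighten (z : 'S_n) :
  (forall x y : 'I_n, ri x = ri y -> ro (z x) = ro (z y) -> x = y) ->
  forall x : 'I_n, (ro (z x) < nth 0 la (ri x))%N.
Proof.
move=> hz x0; set j0 := ro (z x0); rewrite col_initial ltnNge; apply/negP => hx0.
set r := find _ la in hx0.
pose K := (\max_(y : 'I_n) ro y).+1.
have ltK (y : 'I_n) : (ro y < K)%N by rewrite ltnS; apply: (leq_bigmax y).
pose Aset (j : nat) := [set x : 'I_n | (ro (z x) == j) && (ri x < r)%N].
pose cnt (j : nat) := [set y : 'I_n | (ro y == j) && (ri y < r)%N].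
have tot (f : 'I_n -> 'I_n) : (\sum_(j < K) #|[set x : 'I_n | (ro (f x) == j) && (ri x < r)%N]|
    = #|[set x : 'I_n | (ri x < r)%N]|)%N.
  rewrite -sum1_card (partition_big (fun x => Ordinal (ltK (f x))) xpredT) //=.
  by apply: eq_bigr => j _; rewrite -sum1_card; apply: eq_bigl => x; rewrite !inE andbC.
have le j : (#|Aset j| <= #|cnt j|)%N.
  pose H := find (fun k => k <= j)%N la.
  have [rH|Hr] := leqP r H.
    have box (x : 'I_n) : exists y : 'I_n, (ri x < r)%N -> ri y = ri x /\ ro y = j.
      have [lt|] := ltnP (ri x) r; last by exists x.
      have /box_exists[y hy] : (j < nth 0 la (ri x))%N by rewrite col_initial (leq_trans lt).
      by exists y.
    have [b hb] := fin_all_exists box.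
    rewrite -(card_in_imset (f := b)); last first.
      move=> x y; rewrite !inE => /andP[/eqP cx rx] /andP[/eqP cy ry] e.
      have [e1 _] := hb x rx; have [e2 _] := hb y ry.
      by apply: hz; rewrite ?cx ?cy // -e1 -e2 e.
    apply/subset_leq_card/subsetP => _ /imsetP[x /[!inE] /andP[_ rx] ->].
    by have [-> ->] := hb x rx; rewrite eqxx.
  rewrite -(card_imset (Aset j) (@perm_inj _ z)).
  apply/subset_leq_card/subsetP => _ /imsetP[x /[!inE] /andP[cx _] ->].
  by rewrite cx (leq_trans _ (ltnW Hr)) // -col_initial -(eqP cx) ro_lt.
have lt0 : (#|Aset j0| < #|cnt j0|)%N.
  rewrite -(card_imset (Aset j0) (@perm_inj _ z)); apply: proper_card.
  apply/properP; split.
    apply/subsetP => _ /imsetP[x /[!inE] /andP[cx _] ->].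
    by rewrite cx -col_initial -(eqP cx) ro_lt.
  exists (z x0); first by rewrite inE eqxx -col_initial ro_lt.
  apply/imsetP => -[x /[!inE] /andP[_ rx] /perm_inj e].
  by move: rx; rewrite -e ltnNge hx0.
have := tot id; rewrite -(tot z) => /eqP; apply/negP; rewrite neq_ltn.
apply/orP; right; rewrite (bigD1 (Ordinal (ltK (z x0)))) //= [X in (_ < X)%N](bigD1 (Ordinal (ltK (z x0)))) //=.
rewrite -addSn; apply: leq_add; first exact: lt0.
by apply: leq_sum => j _; apply: le.
Qed.

(** The classical dichotomy of Young: a permutation is a product of a row and a
column permutation, unless some transposition of a row is conjugate to a
transposition of a column. *)
Lemma row_col_decomposition (z : 'S_n) :
  (exists p q, [/\ p \in R, q \in C & z = (p * q)%g]) \/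
  (exists x y : 'I_n, [/\ x != y, ri x = ri y & ro (z x) = ro (z y)]).
Proof.
have [/existsP[x /existsP[y /and3P[xy /eqP e1 /eqP e2]]]|] :=
  boolP [exists x : 'I_n, exists y : 'I_n, [&& x != y, ri x == ri y & ro (z x) == ro (z y)]].
  by right; exists x, y.
rewrite negb_exists => /forallP h; left.
have hz (x y : 'I_n) : ri x = ri y -> ro (z x) = ro (z y) -> x = y.
  move=> e1 e2; apply/eqP/negPn/negP => nxy; have := h x.
  by rewrite negb_exists => /forallP/(_ y); rewrite nxy e1 e2 !eqxx.
have box (x : 'I_n) : exists y : 'I_n, ri y = ri x /\ ro y = ro (z x).
  exact: box_exists (straighten hz x).
have [b hb] := fin_all_exists box.
have b_inj : injective b.
  move=> x y e; have [h1 h2] := hb x; have [h3 h4] := hb y.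
  by apply: hz; [rewrite -h1 e h3 | rewrite -h2 e h4].
exists (perm b_inj), ((perm b_inj)^-1 * z)%g; split; last by rewrite mulKVg.
  by apply/row_stabP => x; rewrite permE; have [] := hb x.
apply/col_stabP => x; rewrite permM -{2}(permKV (perm b_inj) x) [in RHS]permE.
by have [_ ->] := hb ((perm b_inj)^-1%g x).
Qed.

(** In the second case of [row_col_decomposition] the two transformation rules give
opposite signs to [f z]. *)
Lemma young_uniq (f : 'S_n -> F) :
  (forall p z, p \in R -> f (p * z)%g = f z) ->
  (forall q z, q \in C -> f (z * q)%g = (-1) ^+ odd_perm q * f z) ->
  forall z, f z = f 1%g * young_coef z.
Proof.
move=> fR fC z; case: (row_col_decomposition z) => [[p [q [pR qC ->]]]|[x [y [nxy e1 e2]]]].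
  rewrite fR // young_coef_row // -[q in LHS]mul1g -[q in RHS]mul1g fC // young_coef_col //.
  by rewrite young_coef1 mulr1 mulrC.
have vanish (f' : 'S_n -> F) : (forall p z, p \in R -> f' (p * z)%g = f' z) ->
  (forall q z, q \in C -> f' (z * q)%g = (-1) ^+ odd_perm q * f' z) -> f' z = 0.
  move=> fR' fC'; have tR : tperm x y \in R.
    by apply/row_stabP => i; case: tpermP => // ->.
  have tC : (tperm x y ^ z)%g \in C.
    by rewrite tpermJ; apply/col_stabP => i; case: tpermP => // ->.
  have := fC' _ z tC; rewrite conjgE mulKVg fR' // odd_permJ odd_tperm nxy expr1 mulN1r.
  by move=> /eqP; rewrite -addr_eq0 -mulr2n mulrn_eq0 => /eqP.
rewrite (vanish f) // (vanish young_coef) ?mulr0 //; [exact: young_coef_row|exact: young_coef_col].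
Qed.

(** The square of the Young symmetrizer satisfies the two transformation rules of
[young_uniq], hence is a multiple of it, and the trace on the ideal that it
generates follows from [trace_submod_ratio]. *)
Lemma specht_trace (x : 'S_n) :
  \tr (specht_repr F la x) / (specht_dim F la)%:R
  = (\sum_(g : 'S_n) young_coef (g * x^-1 * g^-1)%g) / (n`!)%:R.
Proof.
(* The coefficients of the square of the Young symmetrizer. *)
pose conv z := \sum_h young_coef (z * h^-1)%g * young_coef h.
have cc z : conv z = conv 1%g * young_coef z.
  apply: young_uniq => [p z' pR|q z' qC].
    by apply: eq_bigr => h _; rewrite -mulgA young_coef_row.
  rewrite /conv (reindex_inj (mulIg q)) /= mulr_sumr; apply: eq_bigr => h _.
  by rewrite invMg mulgA mulgK (young_coef_col _ qC) mulrCA.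
rewrite /specht_repr /specht_dim (@trace_submod_ratio _ _ _ (conv 1%g)).
- rewrite card_Sn; congr (_ / _).
  by apply: eq_bigr => g _; rewrite young_coefE.
- by move=> z; rewrite young_coefE -cc; apply: eq_bigr => h _; rewrite !young_coefE.
by rewrite young_coefE young_coef1.
Qed.
End YoungSymmetrizer.

(** * Normalized characters as signed placement counts *)

Lemma perm_extending (A T : finType) (t1 t2 : A -> T) :
  injective t1 -> injective t2 -> exists g : {perm T}, forall a, g (t1 a) = t2 a.
Proof.
move=> i1 i2; pose C1 := [set x | x \notin codom t1]; pose C2 := [set x | x \notin codom t2].
have cC : #|C1| = #|C2|.
  apply/eqP; rewrite -(eqn_add2l #|A|) -{1}(card_codom i1) -(card_codom i2).
  rewrite -[C1](_ : ~: [set x in codom t1] = C1); last by apply/setP => x; rewrite !inE.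
  rewrite -[C2](_ : ~: [set x in codom t2] = C2); last by apply/setP => x; rewrite !inE.
  have e (s : seq T) : (#|s| + #|~: [set x in s]| = #|T|)%N.
    by have := cardsC [set x in s]; rewrite cardsE.
  by rewrite !e.
pose f x := if @idP (x \in codom t1) is ReflectT h then t2 (iinv h)
            else nth x (enum C2) (index x (enum C1)).
have fin a : f (t1 a) = t2 a.
  rewrite /f; case: {-}_ / idP => h; last by case: h; apply: codom_f.
  by congr t2; apply: i1; rewrite f_iinv.
have fout x : x \notin codom t1 -> (f x \in C2) /\ index (f x) (enum C2) = index x (enum C1).
  move=> hx; rewrite /f; case: {-}_ / idP => h; first by rewrite h in hx.
  have lt : (index x (enum C1) < size (enum C2))%N.
    by rewrite -cardE -cC cardE index_mem mem_enum inE.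
  by rewrite -mem_enum mem_nth // index_uniq ?enum_uniq.
have f_inj : injective f.
  move=> x y; have [/codomP[a ->]|hx] := boolP (x \in codom t1);
    have [/codomP[b ->]|hy] := boolP (y \in codom t1).
  - by rewrite !fin => /i2 ->.
  - by rewrite fin => e; have [] := fout y hy; rewrite -e inE codom_f.
  - by rewrite fin => e; have [] := fout x hx; rewrite e inE codom_f.
  move=> e; have [_ e1] := fout x hx; have [_ e2] := fout y hy.
  have: index x (enum C1) = index y (enum C1) by rewrite -e1 -e2 e.
  have mem z : z \notin codom t1 -> z \in enum C1 by move=> hz; rewrite mem_enum inE.
  by move=> ei; rewrite -(nth_index x (mem x hx)) ei nth_index ?mem.
by exists (perm f_inj) => a; rewrite permE.
Qed.

Lemma card_box_maps_setT (la : seq nat) (T : finType) (s : {perm T} * {perm T}) :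
  #|box_maps (reshape_index la : 'I_(sumn la) -> nat) (reshape_offset la : 'I_(sumn la) -> nat) setT s|
  = box_count s.1 s.2 la.
Proof.
pose h (t : {ffun T -> 'I_(sumn la)}) : {ffun T -> option 'I_(sumn la)} := [ffun x => Some (t x)].
rewrite /box_count -[RHS](card_in_imset (f := h)); last first.
  by move=> t t' _ _ /ffunP e; apply/ffunP => x; have := e x; rewrite !ffunE => -[].
apply: eq_card => f; apply/idP/imsetP => [|[t + ->]]; last first.
  rewrite !inE => /andP[/forallP h1 /forallP h2]; apply/forallP => x.
  by rewrite !ffunE inE /= (eqP (h1 x)) (eqP (h2 x)) !eqxx.
rewrite inE => /forallP hf.
have fx x : {y | f x = Some y}.
  have /and3P[+ _ _] := hf x; rewrite inE; case: (f x) => // y _; by exists y.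
pose t : {ffun T -> 'I_(sumn la)} := [ffun x => sval (fx x)].
have ft x : f x = Some (t x) by rewrite [t x]ffunE; exact: svalP (fx x).
exists t; last by apply/ffunP => x; rewrite ffunE ft.
by rewrite inE; apply/andP; split; apply/forallP => x; have /and3P[_ h1 h2] := hf x;
  [move: h1|move: h2]; rewrite !ft /= => /eqP [->].
Qed.

Lemma pair_weight_layers (la : seq nat) (T : finType) (s : {perm T} * {perm T}) :
  sorted geq la ->
  pair_weight (reshape_index la : 'I_(sumn la) -> nat) (reshape_offset la : 'I_(sumn la) -> nat) setT s
  = (-1) ^+ odd_perm s.1 * (layer_count (porbits s.2) (cycles_inside s.1) la set0)%:Z.
Proof.
by move=> la_sorted; rewrite /pair_weight card_box_maps_setT box_count_layers.
Qed.

Section StanleyFormula.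
Variables (la : seq nat) (k : nat) (p : 'S_k).
Local Notation n := (sumn la).
Local Notation ri := (reshape_index la : 'I_n -> nat).
Local Notation ro := (reshape_offset la : 'I_n -> nat).

(** The contribution of one map [t] from points to boxes, without the requirement
that [t] is injective. *)
Definition placement_sum (t : {ffun 'I_k -> 'I_n}) : int :=
  \sum_(s : 'S_k * 'S_k | (s.2 * s.1 == p)%g)
    (-1) ^+ odd_perm s.1 *
    ([forall i, ri (t (s.2 i)) == ri (t i)] && [forall i, ro (t (s.1 i)) == ro (t i)])%:R.

(** Composing [s1] and [s2] with a transposition of two points that are sent to the
same box reverses the sign and nothing else. *)
Lemma placement_sum_not_inj (t : {ffun 'I_k -> 'I_n}) : ~~ injectiveb t -> placement_sum t = 0.
Proof.
move=> /injectivePn[i [j nij tij]]; set q := tperm i j.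
have tq x : t (q x) = t x by rewrite /q; case: tpermP => // ->.
suff: placement_sum t = - placement_sum t by lia.
rewrite {1}/placement_sum (reindex_inj (h := fun s : 'S_k * 'S_k => (q * s.1, s.2 * q)%g)) /=.
  rewrite -sumrN; apply: eq_big => [s|s _].
    by rewrite mulgA -(mulgA s.2) /q tperm2 mulg1.
  rewrite odd_permM odd_tperm nij signr_addb expr1 mulN1r mulNr; congr (- (_ * _%:R)).
  congr (_ && _); first by apply: eq_forallb => x; rewrite permM tq.
  apply/forallP/forallP => h x.
    by have := h (q x); rewrite permM /q tpermK -/q tq.
  by rewrite permM -(tq x) h.
by move=> [a b] [c d] /= [/mulgI -> /mulIg ->].
Qed.

Lemma all_sum_placements : all_sum ri ro setT p = \sum_t placement_sum t.
Proof.
rewrite exchange_big /=; apply: eq_big => [s|s _].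
  rewrite /factors; have -> : perm_on setT s.1 by apply/subsetP => x _; rewrite inE.
  have -> : perm_on setT s.2 by apply/subsetP => x _; rewrite inE.
  apply/forallP/eqP => [h|<- x]; last by rewrite permM eqxx implybT.
  by apply/permP => x; rewrite permM; apply/eqP; have := h x; rewrite inE.
rewrite -mulr_sumr; congr (_ * _).
rewrite -natr_sum natz card_box_maps_setT /box_count; congr Posz.
rewrite -sum1_card [LHS]big_mkcond /=; apply: eq_bigr => t _.
by rewrite inE /respects_rows /respects_cols; case: (_ && _).
Qed.

Variable F : numFieldType.
Local Notation c := (@young_coef F la).

(** A factorization of a permutation supported on the image of [t] into a row
permutation and a column permutation is supported there as well, because a box
is determined by its row and its column. *)
Lemma young_coef_placement (t : {ffun 'I_k -> 'I_n}) (t_inj : injective t) :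
  c (perm_along t_inj p) = (placement_sum t)%:~R.
Proof.
rewrite /young_coef pair_big /= (bigID (fun PQ : 'S_n * 'S_n => (PQ.1 * PQ.2)%g == perm_along t_inj p)) /=.
rewrite [X in _ + X]big1 ?addr0 => [|PQ /andP[_ /negbTE->]]; last by rewrite mulr0.
pose un (q : 'S_n) : 'S_k := odflt 1%g [pick s | perm_along t_inj s == q].
have unK s : un (perm_along t_inj s) = s.
  rewrite /un; case: pickP => [s' /eqP /perm_along_inj -> //|/(_ s)]; by rewrite eqxx.
rewrite (reindex_onto (fun s : 'S_k * 'S_k => (perm_along t_inj s.2, perm_along t_inj s.1))
  (fun PQ => (un PQ.2, un PQ.1))) /=.
  rewrite /placement_sum rmorph_sum /= [RHS]big_mkcond /= big_mkcond /=.
  apply: eq_bigr => -[s1 s2] _ /=; rewrite !unK eqxx andbT -perm_alongM (inj_eq (@perm_along_inj _ _ _ _)).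
  case: ifP => [/andP[/andP[hR hC] /eqP <-]|h].
    rewrite eqxx odd_perm_along rmorphM rmorph_sign /= mulr1.
    have -> : [forall i, ri (t (s2 i)) == ri (t i)].
      by apply/forallP => i; move/row_stabP: hR => /(_ (t i)); rewrite perm_alongE => ->.
    have -> : [forall i, ro (t (s1 i)) == ro (t i)].
      by apply/forallP => i; move/col_stabP: hC => /(_ (t i)); rewrite perm_alongE => ->.
    by rewrite mulr1.
  case: ifP => // e; rewrite e andbT in h; symmetry.
  case: andP => [[/forallP h1 /forallP h2]|_]; last by rewrite mulr0 rmorph0.
  case/negP: (negbT h); apply/andP; split; [apply/row_stabP|apply/col_stabP] => x;
    (have [/codomP[i ->]|xt] := boolP (x \in codom t);
      [by rewrite perm_alongE; apply/eqP; rewrite ?(h1 i) ?(h2 i) | by rewrite perm_along_out]).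
move=> [P Q] /= /andP[/andP[/row_stabP hR /col_stabP hC] /eqP e].
have PQx x : x \notin codom t -> P x = x /\ Q x = x.
  move=> xt; have := perm_along_out t_inj p xt; rewrite -e permM => ex.
  have Px : P x = x by apply: eq_position; rewrite ?hR // -{2}ex hC.
  by split=> //; rewrite -{1}Px.
have [s2 es2] := perm_along_surj t_inj (fun x hx => (PQx x hx).1).
have [s1 es1] := perm_along_surj t_inj (fun x hx => (PQx x hx).2).
by rewrite es1 es2 !unK.
Qed.

Lemma young_coef_conj_inv (x : 'S_n) :
  \sum_(g : 'S_n) c (g * x^-1 * g^-1)%g = \sum_(g : 'S_n) c (g^-1 * x * g)%g.
Proof.
rewrite (reindex_inj invg_inj) /=; under eq_bigr do rewrite invgK.
rewrite /young_coef exchange_big [RHS]exchange_big /=.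
rewrite (reindex_inj invg_inj) /=; apply: eq_big => [P|P _]; first exact: row_stabV.
rewrite exchange_big [RHS]exchange_big /=.
rewrite (reindex_inj invg_inj) /=; apply: eq_big => [Q|Q _]; first exact: col_stabV.
rewrite odd_permV -!mulr_sumr; congr (_ * _).
rewrite [RHS](reindex_inj (mulIg P^-1%g)) /=; apply: eq_bigr => g _; congr (_%:R).
congr nat_of_bool; rewrite -[LHS](inj_eq invg_inj) !invMg !invgK.
by rewrite -(inj_eq (mulgI P)) -(inj_eq (mulIg P^-1%g)) !mulgA mulgK.
Qed.

Hypothesis la_sorted : sorted geq la.

Section Restriction.
Hypothesis le_kn : (k <= n)%N.
Local Notation w := (widen_ord le_kn).

Definition restriction (g : 'S_n) : {ffun 'I_k -> 'I_n} := [ffun i => g (w i)].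

Lemma restriction_inj g : injective (restriction g).
Proof. by move=> i j; rewrite !ffunE => /perm_inj /(congr1 val) /= /val_inj. Qed.

Lemma conj_ext_perm g : (g^-1 * ext_perm le_kn p * g)%g = perm_along (@restriction_inj g) p.
Proof.
apply: perm_alongP => [i|u ut].
  rewrite !permM ffunE permK permE /ext_fun.
  case: insubP => [j _ ej|]; last by rewrite /= ltn_ord.
  by rewrite ffunE; congr (g (w (p _))); apply: val_inj; rewrite ej.
rewrite !permM permE /ext_fun; case: insubP => [j _ ej|_]; last by rewrite permKV.
case/negP: ut; apply/codomP; exists j; rewrite ffunE -[LHS](permKV g).
by congr (g _); apply: val_inj; rewrite /= ej.
Qed.

Lemma card_restriction_fiber (t : {ffun 'I_k -> 'I_n}) : injectiveb t ->
  #|[set g : 'S_n | restriction g == t]| = #|[set g : 'S_n | restriction g == [ffun i => w i]]|.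
Proof.
move=> /injectiveP t_inj; have w_inj : injective w by move=> i j /(congr1 val) /= /val_inj.
have [g0 g0E] := perm_extending w_inj t_inj.
rewrite -[RHS](card_imset _ (@mulIg _ g0)); apply: eq_card => g; rewrite inE.
apply/eqP/imsetP => [e|[h /[!inE] /eqP e ->]]; last first.
  apply/ffunP => i; rewrite ffunE permM.
  by have := congr1 (fun f : {ffun 'I_k -> 'I_n} => f i) e; rewrite !ffunE => ->.
exists (g * g0^-1)%g; last by rewrite mulgKV.
rewrite inE; apply/eqP/ffunP => i; rewrite !ffunE permM.
have := congr1 (fun f : {ffun 'I_k -> 'I_n} => f i) e; rewrite ffunE => ->.
by rewrite -g0E permK.
Qed.

(** Each injective map is the restriction of the same number of permutations. *)
Lemma sum_restrictions (f : {ffun 'I_k -> 'I_n} -> F) :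
  (n ^_ k)%:R * ((\sum_(g : 'S_n) f (restriction g)) / n`!%:R)
  = \sum_(t : {ffun 'I_k -> 'I_n} | injectiveb t) f t.
Proof.
pose m := #|[set g : 'S_n | restriction g == [ffun i => w i]]|.
have part (f' : {ffun 'I_k -> 'I_n} -> F) : \sum_(g : 'S_n) f' (restriction g)
    = (\sum_(t : {ffun 'I_k -> 'I_n} | injectiveb t) f' t) * m%:R.
  rewrite (partition_big restriction (fun t : {ffun 'I_k -> 'I_n} => injectiveb t)) /=; last first.
    by move=> g _; apply/injectiveP/restriction_inj.
  rewrite mulr_suml; apply: eq_bigr => t t_inj.
  rewrite (eq_bigr (fun=> f' t)) => [|g /eqP -> //].
  have em : #|[pred g : 'S_n | restriction g == t]| = m.
    by rewrite /m -(card_restriction_fiber t_inj); apply: eq_card => g; rewrite inE.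
  by rewrite sumr_const mulr_natr -em.
have e1 : (n`!)%:R = (n ^_ k)%:R * m%:R :> F.
  have := part (fun=> 1); rewrite !sumr_const card_Sn => ->; congr (_%:R * _).
  have := card_inj_ffuns 'I_k 'I_n; rewrite !card_ord => <-.
  by apply: eq_card => t; rewrite inE.
have nz : (n`!)%:R != 0 :> F by rewrite pnatr_eq0 -lt0n fact_gt0.
have := nz; rewrite part e1 mulf_eq0 negb_or => /andP[a0 m0].
by field; rewrite a0 m0.
Qed.
End Restriction.

(** The conjugates of the extension of [p] correspond to the injective placements of
the points, so that the trace of [specht_trace] is an average over these; the
other placements can be added for free by [placement_sum_not_inj]. When [k > n]
there is no injective placement, which agrees with the convention for the
character. *)
Lemma norm_character_placements : norm_character F la p = (all_sum ri ro setT p)%:~R.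
Proof.
rewrite all_sum_placements rmorph_sum /= (bigID (fun t : {ffun 'I_k -> 'I_n} => injectiveb t)) /=.
rewrite [X in _ + X]big1 ?addr0 => [|t nt]; last by rewrite placement_sum_not_inj.
rewrite /norm_character; case: {-}_ / idP => [le_kn|/negP nle].
  rewrite specht_trace // young_coef_conj_inv -(sum_restrictions le_kn).
  congr (_ * (_ / _)); apply: eq_bigr => g _.
  by rewrite conj_ext_perm young_coef_placement.
rewrite big_pred0 // => t; apply/negP => /injectiveP t_inj.
by have := leq_card t t_inj; rewrite !card_ord (negbTE nle).
Qed.

End StanleyFormula.

(** * Lagrange inversion for free cumulants *)

Section Lagrange.
Variable F : numFieldType.
Implicit Types (p q U H : {poly F}).

Lemma eqmod_sym n p q : eqmod n p q -> eqmod n q p.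
Proof. by move=> e i /e. Qed.

Lemma eqmod_trans n p q r : eqmod n p q -> eqmod n q r -> eqmod n p r.
Proof. by move=> e e' i lin; rewrite e ?e'. Qed.

Lemma eqmod_leq m n p q : (m <= n)%N -> eqmod n p q -> eqmod m p q.
Proof. by move=> lmn e i lim; apply: e (leq_trans lim lmn). Qed.

Lemma eqmod_deriv n p q : eqmod n.+1 p q -> eqmod n (deriv p) (deriv q).
Proof. by move=> e i lin; rewrite !coef_deriv e. Qed.

Lemma eqmod_mulX n p q : eqmod n.+1 ('X * p) ('X * q) -> eqmod n p q.
Proof. by move=> e i lin; have := e i.+1 lin; rewrite !coefXM. Qed.

Lemma coef_exp_deriv p k n : (p ^+ k)`_n.+1 *+ n.+1 = (p ^+ k.-1 * deriv p)`_n *+ k.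
Proof. by rewrite -coef_deriv deriv_exp -coefMn mulrC. Qed.

Lemma eqmod_refl n p : eqmod n p p. Proof. by []. Qed.

Lemma exp_log_deriv p n : (p ^+ n.+1)`_n.+1 = (p ^+ n * deriv p)`_n.
Proof.
by apply: (@pmulrnI F n.+1) => //; have := coef_exp_deriv p n.+1 n.
Qed.

(** With [H = 'X / U] the product rule turns the coefficient into that of
[U ^ n - U ^ n.-1 * deriv U * 'X], whose two terms have equal coefficients in
degree [n] because the second one comes from the derivative of [U ^ n]. *)
Lemma lagrange_residue U H n : U`_0 = 1 -> H`_0 = 0 -> eqmod n.+2 (U * H) 'X ->
  (U ^+ n.+1 * deriv H)`_n = (n == 0%N)%:R.
Proof.
move=> U0 H0 UH.
have UH' : eqmod n.+1 (U * deriv H) (1 - deriv U * H).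
  move=> i lin; have := eqmod_deriv UH lin.
  by rewrite derivM derivX coefD coefB => <-; rewrite addrC addKr.
transitivity ((U ^+ n * (1 - deriv U * H))`_n).
  rewrite exprSr -mulrA; apply: (eqmodM (@eqmod_refl n.+1 _) UH'); exact: ltnSn.
case: n UH {UH'} => [|n] UH.
  by rewrite expr0 mul1r coefB coef1 coef0M H0 mulr0 subr0.
rewrite mulrBr mulr1 coefB exp_log_deriv [in X in _ - X]exprSr.
have -> : U ^+ n * U * (deriv U * H) = U ^+ n * deriv U * (U * H) by ring.
have -> : (U ^+ n * deriv U * (U * H))`_n.+1 = (U ^+ n * deriv U * 'X)`_n.+1.
  by apply: (eqmodM (@eqmod_refl n.+3 _) UH); rewrite ltnW.
by rewrite coefMX subrr.
Qed.

Lemma lagrange_residue_pow U H n j : U`_0 = 1 -> H`_0 = 0 -> eqmod n.+2 (U * H) 'X ->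
  (U ^+ n.+1 * (H ^+ j * deriv H))`_n = (j == n)%:R.
Proof.
move=> U0 H0 UH; have [ltnj|lejn] := ltnP n j.
  rewrite gtn_eqF // mulrCA.
  transitivity ((0 * (U ^+ n.+1 * deriv H))`_n); last by rewrite mul0r coef0.
  apply: (@eqmodM F n.+1 _ _ _ _ _ (@eqmod_refl n.+1 _) n (ltnSn n)) => i lin.
  by rewrite coef0 coef_pow_lt // (leq_trans lin).
have -> : U ^+ n.+1 * (H ^+ j * deriv H) =
    (U * H) ^+ j * (U ^+ (n - j).+1 * deriv H).
  by rewrite -[in LHS](subnKC lejn) -addnS exprD exprMn; ring.
rewrite (_ : _`_n = ('X ^+ j * (U ^+ (n - j).+1 * deriv H))`_n); last first.
  apply: (eqmodM _ (@eqmod_refl n.+2 _)) => //; exact: eqmodX.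
rewrite coefXnM ltnNge lejn /= lagrange_residue //; last first.
  by apply: eqmod_leq UH; rewrite !ltnS leq_subr.
by rewrite subn_eq0 eqn_leq lejn.
Qed.

(** The defining relations say that [E \Po (S \Po H)] is [U], where [E] is the
exponential, [S] the logarithm of [g / 'X], [H] the inverse of [g] and
[U = 'X / H]. Hence [deriv U = U * deriv (S \Po H)], and [lagrange_residue_pow]
extracts the coefficients of [S] from the powers of [U]. *)
Lemma free_cumulants_lagrange (sg g r : nat -> F) n : sg 0%N = 0 ->
  g =1 fps_mul (fps_X F) (fps_exp sg) -> is_free_cumulants g r -> (0 < n)%N ->
  n%:R * sg n = fps_pow (fun i => fps_one F i + r i) n n.
Proof.
move=> sg0 gE [r0 _ [h [h0 gh _] hU]]; case: n => // n _.
pose N := n.+3; pose tr (f : nat -> F) : {poly F} := \poly_(i < N) f i.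
have trE (f : nat -> F) i : (i < N)%N -> (tr f)`_i = f i by rewrite coef_poly => ->.
pose S := tr sg; pose H := tr h; pose U := tr (fun i => fps_one F i + r i).
pose E : {poly F} := tr (fun k => (k`!%:R)^-1).
have H0 : H`_0 = 0 by rewrite trE.
have U0 : U`_0 = 1 by rewrite trE //= r0 addr0.
have S0 : S`_0 = 0 by rewrite trE.
have L0 : (S \Po H)`_0 = 0 by rewrite coef_compr0.
have UH : eqmod N (U * H) 'X.
  move=> i lin; rewrite mulrC -fps_mul_trunc // hU coefX /fps_X.
  by case: i lin => [|[]].
have GE : eqmod N (tr g) ('X * (E \Po S)).
  move=> i lin; rewrite trE // gE (fps_mul_trunc _ _ lin) /N trunc_X.
  apply: (eqmodM (@eqmod_refl N _) _ lin) => j ljN.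
  by rewrite coef_poly ljN /fps_exp (fps_comp_trunc _ sg0 ljN).
have GH : eqmod N (tr g \Po H) 'X.
  move=> i lin; rewrite -(fps_comp_trunc g h0 lin) gh coefX /fps_X.
  by case: i lin => [|[]].
have EU : eqmod n.+2 (E \Po (S \Po H)) U.
  apply: eqmod_mulX; rewrite comp_polyA.
  have HE : eqmod N (H * ((E \Po S) \Po H)) 'X.
    have := eqmod_comp H0 GE (@eqmod_refl N H); rewrite comp_polyM comp_polyX.
    by move=> /eqmod_sym/eqmod_trans; apply.
  apply: eqmod_trans (eqmodM (eqmod_sym UH) (@eqmod_refl N _)) _.
  rewrite -mulrA ['X * U]mulrC; exact: (eqmodM (@eqmod_refl N _) HE).
have E' : eqmod n.+2 (deriv E) E.
  move=> i lin; rewrite coef_deriv !trE // ?(leq_trans lin) // factS natrM invfM.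
  by rewrite -[LHS]mulr_natr mulrAC mulVf ?mul1r // pnatr_eq0.
have U' : eqmod n.+1 (deriv U) (U * deriv (S \Po H)).
  apply: eqmod_trans (eqmod_deriv (eqmod_sym EU)) _; rewrite deriv_comp.
  apply: eqmodM => //; apply: eqmod_trans (eqmod_leq (leqnSn _) EU).
  exact: eqmod_leq (leqnSn _) (eqmod_comp L0 E' (@eqmod_refl _ _)).
have lnN : (n.+1 < N)%N by rewrite ltnW.
rewrite (fps_pow_trunc _ _ lnN) -/(tr _) -/U exp_log_deriv.
rewrite (eqmodM (@eqmod_refl n.+1 _) U' (ltnSn n)) mulrA -exprSr deriv_comp.
rewrite comp_polyE mulr_suml mulr_sumr coef_sum.
transitivity (\sum_(j < size (deriv S)) (deriv S)`_j * (j == n :> nat)%:R); last first.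
  apply: eq_bigr => j _; rewrite -scalerAl -scalerAr coefZ lagrange_residue_pow //.
  exact: eqmod_leq (leqnSn _) UH.
have sizeS : (n < size (deriv S))%N \/ (deriv S)`_n = 0.
  by case: ltnP => [|/(nth_default 0)]; [left|right].
have SnE : (deriv S)`_n = n.+1%:R * sg n.+1 by rewrite coef_deriv trE // mulr_natl.
case: sizeS => [ln|Sn].
  rewrite (bigD1 (Ordinal ln)) //= eqxx mulr1 big1 ?addr0 ?SnE // => j.
  by rewrite -val_eqE /= => /negPf->; rewrite mulr0.
rewrite -SnE Sn big1 // => j _; case: eqP => [->|]; rewrite ?Sn ?mul0r ?mulr0 //.
Qed.
End Lagrange.

(** * Polynomials in the free cumulants *)

Section Expressible.
Variable F : numFieldType.

(** A linear combination of products of values of a function of two indices; the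
pair [(l, e)] stands for the complete bipartite graph with [l] black and [e]
white vertices. *)
Definition monomial_combo := seq (F * seq (nat * nat)).

Definition combo_value (A : comAlgType F) (zeta : nat -> nat -> A)
    (c : monomial_combo) : A :=
  \sum_(t <- c) t.1 *: \prod_(p <- t.2) zeta p.1 p.2.

(** A graph without black vertices is complete before the first row, and its layer
count is not a power sum. *)
Definition proper_combo (c : monomial_combo) : bool :=
  all (fun t => all (fun p => 0 < p.1)%N t.2) c.

(** [r] is the sequence of free cumulants whose [n]-th moment is the sum on the right
divided by [n]. *)
Definition lagrange_related (A : comAlgType F) (zeta : nat -> nat -> A)
    (r : nat -> A) : Prop :=
  [/\ r 0%N = 0, r 1%N = 0 & forall n, (1 < n)%N ->
    ((\poly_(i < n.+1) ((i == 0%N)%:R + r i)) ^+ n)`_n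
    = \sum_(l < n | (0 < l)%N) ((-1) ^+ l.-1 * 'C(n, l)%:R) *: zeta l (n - l)%N].

(** The combination has to be the same for all algebras: it will be evaluated both
on the numbers attached to a diagram and on formal variables. *)
Definition expressible (f : forall A : comAlgType F, (nat -> A) -> A) : Prop :=
  exists2 c, proper_combo c & forall (A : comAlgType F) zeta r,
    lagrange_related zeta r -> f A r = combo_value zeta c.

Lemma expressible_eq f f' :
  (forall (A : comAlgType F) zeta r, lagrange_related zeta r -> f A r = f' A r) ->
  expressible f -> expressible f'.
Proof. by move=> ff' [c pc cE]; exists c => // A z r zr; rewrite -(ff' A z) ?(cE A z). Qed.

Lemma expressibleD f f' : expressible f -> expressible f' ->
  expressible (fun A r => f A r + f' A r).
Proof.
move=> [c pc cE] [c' pc' cE']; exists (c ++ c'); first by rewrite /proper_combo all_cat; apply/andP.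
by move=> A z r zr; rewrite (cE A z) ?(cE' A z) // /combo_value big_cat.
Qed.

Lemma expressibleZ a f : expressible f -> expressible (fun A r => a *: f A r).
Proof.
move=> [c pc cE]; exists [seq (a * t.1, t.2) | t <- c].
  by rewrite /proper_combo all_map; apply: sub_all pc.
move=> A z r zr; rewrite (cE A z) // /combo_value big_map scaler_sumr.
by apply: eq_bigr => t _; rewrite scalerA.
Qed.

Lemma expressibleM f f' : expressible f -> expressible f' ->
  expressible (fun A r => f A r * f' A r).
Proof.
move=> [c pc cE] [c' pc' cE'].
exists [seq (t.1 * t'.1, t.2 ++ t'.2) | t <- c, t' <- c'].
  apply/allP => _ /allpairsP[[t t'] /= [tc tc' ->]] /=.
  by rewrite all_cat (allP pc _ tc) (allP pc' _ tc').
move=> A z r zr; rewrite (cE A z) ?(cE' A z) // /combo_value big_allpairs_dep mulr_suml.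
apply: eq_bigr => t _; rewrite mulr_sumr; apply: eq_bigr => t' _.
by rewrite big_cat -scalerAl -scalerAr scalerA.
Qed.

Lemma expressible1 : expressible (fun A r => 1).
Proof.
exists [:: (1, [::])] => // A z r _.
by rewrite /combo_value big_seq1 big_nil scale1r.
Qed.

Lemma expressible0 : expressible (fun A r => 0).
Proof. by exists [::] => // A z r _; rewrite /combo_value big_nil. Qed.

Lemma expressible_sum (I : Type) (s : seq I) (f : I -> forall A : comAlgType F, (nat -> A) -> A) :
  (forall i, expressible (f i)) -> expressible (fun A r => \sum_(i <- s) f i A r).
Proof.
move=> ef; elim: s => [|i s IH].
  by apply: expressible_eq expressible0 => A z r _; rewrite big_nil.
by apply: expressible_eq (expressibleD (ef i) IH) => A z r _; rewrite big_cons.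
Qed.

Lemma expressible_prod (I : Type) (s : seq I) (f : I -> forall A : comAlgType F, (nat -> A) -> A) :
  (forall i, expressible (f i)) -> expressible (fun A r => \prod_(i <- s) f i A r).
Proof.
move=> ef; elim: s => [|i s IH].
  by apply: expressible_eq expressible1 => A z r _; rewrite big_nil.
by apply: expressible_eq (expressibleM (ef i) IH) => A z r _; rewrite big_cons.
Qed.

Lemma expressibleX n f : expressible f -> expressible (fun A r => f A r ^+ n).
Proof.
move=> ef; apply: expressible_eq (expressible_prod (index_iota 0 n) (fun=> ef)) => A z r _ /=.
by rewrite prodr_const_nat subn0.
Qed.

Lemma expressible_coef_exp (u : nat -> forall A : comAlgType F, (nat -> A) -> A) n k m :
  (forall i, (i < n)%N -> expressible (u i)) ->
  expressible (fun A r => ((\poly_(i < n) u i A r) ^+ k)`_m).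
Proof.
move=> eu; have ecoef i : expressible (fun A r => (\poly_(i < n) u i A r)`_i).
  apply: (@expressible_eq (fun A r => if (i < n)%N then u i A r else 0)).
    by move=> A z r _; rewrite coef_poly.
  by case: (ltnP i n) => [lin|_]; [apply: eu|apply: expressible0].
elim: k m => [|k IH] m.
  apply: (@expressible_eq (fun A r => (m == 0%N)%:R)).
    by move=> A z r _; rewrite expr0 coef1.
  by case: (m == 0%N); [apply: expressible1|apply: expressible0].
apply: expressible_eq (expressible_sum (iota 0 m.+1)
    (fun i => expressibleM (ecoef i) (IH (m - i)%N))) => A z r _ /=.
by rewrite exprS coefM -(big_mkord xpredT (fun i => (\poly_(i < n) u i A r)`_i *
   ((\poly_(i0 < n) u i0 A r) ^+ k)`_(m - i))).
Qed.

(** The last coefficient of the series enters the equation linearly, which allows to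
solve for it. *)
Lemma coef_exp_last (A : comNzRingType) (u : nat -> A) n : (0 < n)%N -> u 0%N = 1 ->
  ((\poly_(i < n.+1) u i) ^+ n)`_n = ((\poly_(i < n) u i) ^+ n)`_n + u n *+ n.
Proof.
case: n => // n _ u0; set V := \poly_(i < n.+1) u i.
have -> : \poly_(i < n.+2) u i = V + u n.+1 *: 'X^(n.+1).
  apply/polyP => i; rewrite coefD !coef_poly coefZ coefXn !ltnS.
  case: (ltngtP i n.+1) => [lin|lni|->].
  - by rewrite -ltnS lin mulr0 addr0.
  - by rewrite leqNgt (ltnW lni) mulr0 addr0.
  - by rewrite ltnn mulr1 add0r.
rewrite exprDn coef_sum big_ord_recl big_ord_recl big1 => [|i _].
  rewrite addr0 /= expr0 mulr1 bin0 bin1 mulr1n subn0; congr (_ + _).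
  rewrite subn1 coefMn -scalerAr coefZ coefMXn ltnn subnn -horner_coef0 horner_exp.
  by rewrite horner_coef0 coef_poly u0 expr1n mulr1.
rewrite coefMn exprZn -exprM -scalerAr coefZ coefMXn ifT ?mulr0 ?mul0rn //.
by rewrite /= /bump !leq0n !add1n; nia.
Qed.

Lemma expressible_free_cumulant n : expressible (fun A r => r n).
Proof.
elim/ltn_ind: n => n IH; have [n1|n1] := leqP n 1.
  apply: expressible_eq expressible0 => A z r [r0 r1 _].
  by case: n n1 {IH} => [|[]].
have n0 : (0 < n)%N by apply: ltnW.
have [c pc cE] : expressible (fun A r =>
     - n%:R^-1 *: ((\poly_(i < n) ((i == 0%N)%:R + r i)) ^+ n)`_n).
  apply: expressibleZ; apply: (@expressible_coef_exp (fun i A r => (i == 0%N)%:R + r i)).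
  move=> i lin; apply: expressibleD (IH i lin).
  by case: eqP => _; [apply: expressible1|apply: expressible0].
exists ([seq (n%:R^-1 * ((-1) ^+ l.-1 * 'C(n, l)%:R), [:: (l, (n - l)%N)]) |
          l <- iota 1 n.-1] ++ c).
  rewrite /proper_combo all_cat all_map; apply/andP; split=> //; apply/allP => l.
  by rewrite mem_iota /= andbT => /andP[].
move=> A z r zr; have [r0 r1 rE] := zr.
rewrite /combo_value big_cat -/(combo_value z c) -(cE A z r zr) big_map /=.
have := rE n n1; rewrite (@coef_exp_last A (fun i => (i == 0%N)%:R + r i)) ?eqxx ?r0 ?addr0 //.
rewrite (gtn_eqF n0) add0r => e.
transitivity (n%:R^-1 *: (r n *+ n)).
  by rewrite -scaler_nat scalerA mulVf ?scale1r // pnatr_eq0 -lt0n.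
rewrite -[r n *+ n](addKr (((\poly_(i < n) ((i == 0%N)%:R + r i)) ^+ n)`_n)) e.
rewrite addrC scalerDr scalerN scaleNr; congr (_ + _).
rewrite scaler_sumr; transitivity (\sum_(1 <= l < n)
  (n%:R^-1 * ((-1) ^+ l.-1 * 'C(n, l)%:R)) *: z l (n - l)%N); last first.
  by rewrite /index_iota subn1; apply: eq_bigr => l _; rewrite big_seq1.
rewrite big_add1 big_mkord big_mkcond; case: n n1 {IH n0 c pc cE rE e} => // n _.
rewrite big_ord_recl /= add0r; apply: eq_bigr => l _; rewrite scalerA.
by rewrite /bump leq0n add1n.
Qed.

Definition poly_value (A : comAlgType F) (K : {malg int[{cmonom nat}]})
    (r : nat -> A) : A :=
  \sum_(m <- msupp K) (K@_m)%:~R * \prod_(j <- finsupp m) r j.+2 ^+ m j.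

Lemma expressible_poly K : expressible (fun A r => poly_value K r).
Proof.
apply: expressible_sum => m; apply: expressibleM; last first.
  apply: expressible_prod => j; apply: expressibleX; exact: expressible_free_cumulant.
apply: (@expressible_eq (fun A r => (K@_m)%:~R *: 1)).
  by move=> A z r _; rewrite scaler_int.
by apply: expressibleZ; exact: expressible1.
Qed.

End Expressible.

(** * From Young diagrams to formal variables *)

Section ShapeBlocks.
Variable u : seq (nat * nat).
Local Notation width := (\sum_(p <- u) p.1)%N.

Definition shape_blocks (i : 'I_(size u)) : {set 'I_width} :=
  [set j : 'I_width | (j < (nth (0, 0)%N u i).1)%N].

Definition shape_degrees (i : 'I_(size u)) : nat := (nth (0, 0)%N u i).2.

Lemma card_shape_blocks i : #|shape_blocks i| = (nth (0, 0)%N u i).1.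
Proof.
set m := _.1; have mw : (m <= width)%N.
  by rewrite (big_nth (0, 0)%N) big_mkord (bigD1 i) //= leq_addr.
have winj : injective (widen_ord mw) by move=> a b /(congr1 val) /= /val_inj.
rewrite -[RHS]card_ord -(card_imset _ winj).
apply: eq_card => j; rewrite inE; apply/idP/imsetP => [jm|[j' _ ->]] /=; last exact: ltn_ord.
by exists (Ordinal jm) => //; apply: val_inj.
Qed.

Hypothesis u_pos : all (fun p => 0 < p.1)%N u.

Lemma shape_blocks_neq0 i : shape_blocks i != set0.
Proof.
rewrite -card_gt0 card_shape_blocks; apply: (allP u_pos).
exact: mem_nth.
Qed.

Lemma layer_count_shape_blocks la :
  layer_count (full (bipartite_union shape_blocks shape_degrees))
    (bipartite_union shape_blocks shape_degrees) la set0
  = (\prod_(p <- u) power_sum_shape p.1 p.2 la)%N.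
Proof.
rewrite layer_count_union; last by move=> i; apply: bipartite_height_mono.
rewrite [RHS](big_nth (0, 0)%N) big_mkord; apply: eq_bigr => i _.
have -> : slice (set0 : {set 'I_(size u) * 'I_width}) i = set0.
  by apply/setP => j; rewrite !inE.
rewrite layer_count_bipartite ?sub0set // eq_sym (negPf (shape_blocks_neq0 i)).
by rewrite setD0 card_shape_blocks.
Qed.

End ShapeBlocks.

Section GraphExpansion.
Variables (N : nat) (F : numFieldType).
Local Notation pairs := ('S_N * 'S_N)%type.

(** The two sides of the relation: disjoint unions of complete bipartite graphs for
the products of moments, and the graphs of factorizations. *)
Definition graph_family (j : seq (nat * nat) + pairs) : set_function :=
  match j with
  | inl u => bipartite_union (@shape_blocks u) (@shape_degrees u)
  | inr s => perm_graph s.1 s.2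
  end.

Definition empty_state (j : seq (nat * nat) + pairs) : state graph_family :=
  State (set0 : {set ground (graph_family j)}).

(** Move both sides of the hypothesis to one side: this relation between layer
counts is transferred by [vanishes_chi] to the weights computed by [chi_union]
and [chi_connected]. *)
Lemma graph_expansion (A : comAlgType F) (c : monomial_combo F)
    (ss : seq (F * pairs)) M (x : nat -> A) : (0 < N)%N ->
  proper_combo c ->
  all (fun t => [transitive <<[set t.2.1; t.2.2]>>%g, on [set: 'I_N] | 'P]) ss ->
  (forall la, sorted geq la && (0%N \notin la) ->
    \sum_(t <- c) t.1 * (\prod_(p <- t.2) power_sum_shape p.1 p.2 la)%N%:R
    = \sum_(t <- ss) t.1 *
        (layer_count (porbits t.2.2) (cycles_inside t.2.1) la set0)%:R) ->
  x 0%N = 0 ->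
  combo_value (fun l e => - ((\poly_(i < M.+1) x i) ^+ l)`_e) c
  = - \sum_(t <- ss) t.1 *: \sum_(k : {ffun {set 'I_N} -> 'I_M.+1} |
        [&& supported (porbits t.2.2) k, total k (porbits t.2.2) == #|porbits t.2.1|
          & strict_coloring (S := perm_graph t.2.1 t.2.2) k])
      \prod_(b in porbits t.2.2) x (k b).
Proof.
move=> N0 pc pss cE x0.
pose cc : combo graph_family F :=
  [seq (t.1, empty_state (inl t.2)) | t <- c] ++
  [seq (- t.1, empty_state (inr t.2)) | t <- ss].
have van : vanishes cc.
  move=> la laP; rewrite /cc big_cat !big_map /=.
  rewrite (eq_big_all (P := fun t : F * seq (nat * nat) => all (fun p => 0 < p.1)%N t.2)
    (f' := fun t => t.1 * (\prod_(p <- t.2) power_sum_shape p.1 p.2 la)%N%:R) pc); last first.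
    by move=> t pt; congr (_ * _%:R); apply: layer_count_shape_blocks.
  by rewrite (cE la laP) -big_split big1 //= => t _; rewrite mulNr subrr.
have h0 : all (fun aG => state_height aG.2 == 0%N) cc.
  rewrite /cc all_cat !all_map; apply/andP; split.
    apply: sub_all pc => t pt /=; rewrite /state_height /= /union_height.
    rewrite big1 // => i _; rewrite /bipartite_height ifN //.
    have -> : slice (set0 : {set 'I_(size t.2) * 'I_(\sum_(p <- t.2) p.1)}) i = set0.
      by apply/setP => j; rewrite !inE.
    by rewrite subset0 shape_blocks_neq0.
  by apply/allP => t _ /=; rewrite /state_height /= cycles_inside0.
have [n hn] := all_bounded (fun aG : F * state graph_family => #|full (state_fun aG.2)|) cc.
have := vanishes_chi (\poly_(i < M.+1) x i) n 0 van h0.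
move: hn; rewrite /cc all_cat !all_map big_cat !big_map /= => /andP[hc hs] /eqP.
rewrite addr_eq0 => /eqP e.
transitivity (\sum_(t <- c) t.1 *: chi (\poly_(i < M.+1) x i) n (empty_state (inl t.2)) 0).
  have pch := allP pc; have hch := allP hc; rewrite /combo_value !(big_seq _ _ c).
  apply: eq_bigr => t tc; congr (_ *: _).
  rewrite (@chi_union _ graph_family F A M x (inl t.2) _ _ (@shape_blocks t.2)
    (@shape_degrees t.2)) //; last exact: ltnW (hch t tc); last first.
    by move=> i; apply: shape_blocks_neq0; apply: pch.
  rewrite (big_nth (0, 0)%N) big_mkord; apply: eq_bigr => i _.
  by rewrite card_shape_blocks.
rewrite e; congr (- _).
rewrite !(big_seq _ _ ss); apply: eq_bigr => t ts.
have tr := allP pss t ts.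
rewrite (@chi_connected _ graph_family F A M x (inr t.2)) /=.
- rewrite scaleNr scalerN opprK; congr (_ *: _).
  by apply: eq_bigl => k; rewrite cycles_inside_full.
- apply/set0Pn; exists (porbit t.2.2 (Ordinal N0)); exact: porbit_in.
- exact: cycles_inside0.
- exact: cycles_inside_super.
- exact: cycles_inside_conn.
- exact: ltnW (allP hs t ts).
Qed.
End GraphExpansion.

(** * Evaluation at indeterminates *)

Lemma eq_coef_exp (A : comNzRingType) n (p q : {poly A}) k :
  (forall i, (i <= n)%N -> p`_i = q`_i) ->
  forall i, (i <= n)%N -> (p ^+ k)`_i = (q ^+ k)`_i.
Proof.
move=> pq; elim: k => [|k IH] i lin; first by rewrite !expr0.
rewrite !exprS !coefM; apply: eq_bigr => j _.
by rewrite pq ?IH // (leq_trans _ lin) ?leq_subr // -ltnS.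
Qed.

Lemma coef_expN_mulX (A : comNzRingType) (X : {poly A}) l n : (l <= n)%N ->
  ((- ('X * X)) ^+ l)`_n = (-1) ^+ l * (X ^+ l)`_(n - l).
Proof.
move=> ln; rewrite (exprNn ('X * X)) exprMn -signr_odd mulr_sign.
have e : ('X^l * X ^+ l)`_n = (X ^+ l)`_(n - l) by rewrite coefXnM ltnNge ln.
by rewrite -[in RHS]signr_odd mulr_sign; case: odd; rewrite ?coefN e.
Qed.

Lemma sum_delta_seq (V : nmodType) (I : eqType) (r : seq I) (f : I -> V) j : uniq r ->
  \sum_(i <- r) (if i == j then f i else 0) = if j \in r then f j else 0.
Proof.
move=> ur; case: ifP => jr; last first.
  by rewrite big_seq big1 // => i ir; case: eqP => // ij; rewrite -ij ir in jr.
by rewrite (bigD1_seq j) //= eqxx big1 ?addr0 // => i /negPf->.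
Qed.

Section Indeterminates.
Variable F : numFieldType.

Definition truncated_cumulants (A : comAlgType F) M (x : nat -> A) (j : nat) : A :=
  if (j <= M.+1)%N then x j.-1 else 0.

(** The series [1 + 'X * x] has [x] shifted by one as cumulants. The sign changes
come from [chi_union], where a complete bipartite graph has weight
[- (X ^+ l)`_e]. *)
Lemma lagrange_related_truncated (A : comAlgType F) M (x : nat -> A) : x 0%N = 0 ->
  lagrange_related (fun l e => - ((\poly_(i < M.+1) - x i) ^+ l)`_e)
    (truncated_cumulants M x).
Proof.
move=> x0; split=> //= [n n1]; set X := \poly_(i < M.+1) - x i.
transitivity (((1 - 'X * X) ^+ n)`_n).
  apply: (@eq_coef_exp _ n) (leqnn n) => i lin.
  rewrite coef_poly ltnS lin coefB coef1 coefXM coef_poly /truncated_cumulants.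
  by case: i lin => [|i] _ /=; rewrite ?x0 ?subr0 ?addr0 // !ltnS; case: ifP => _; rewrite ?opprK ?oppr0.
have termE l : (l <= n)%N -> (1 ^+ (n - l) * (- ('X * X)) ^+ l *+ 'C(n, l))`_n
    = ((-1) ^+ l * 'C(n, l)%:R) *: (X ^+ l)`_(n - l).
  move=> ln; rewrite expr1n mul1r coefMn coef_expN_mulX // -signr_odd mulr_sign.
  rewrite -[in RHS]signr_odd mulrC -scalerA scaler_sign scaler_nat.
  by case: odd; rewrite ?mulNrn.
rewrite exprDn coef_sum big_ord_recr /= termE // subnn.
have -> : (X ^+ n)`_0 = 0.
  by rewrite -horner_coef0 horner_exp horner_coef0 coef_poly /= x0 oppr0 expr0n gtn_eqF // ltnW.
rewrite scaler0 addr0 [RHS]big_mkcond; apply: eq_bigr => -[[|l] ln] _ /=.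
  by rewrite termE // expr0 coef1 subn0 gtn_eqF ?scaler0 // ltnW.
by rewrite termE 1?ltnW // exprS mulN1r mulNr scaleNr scalerN.
Qed.

(** The color [j + 1] corresponds to the free cumulant of index [j + 2], which is the
indeterminate of index [j]; the color 0 has weight zero. *)
Definition variable (j : nat) : {malg F[{cmonom nat}]} :=
  if j is i.+1 then << ucm i >> else 0.

Lemma malgU_mul (k1 k2 : {cmonom nat}) :
  << mmul k1 k2 >> = << k1 >> * << k2 >> :> {malg F[{cmonom nat}]}.
Proof. by rewrite malgM_def fgmulUU mulr1. Qed.

Lemma malgU_prod (I : Type) (r : seq I) (P : pred I) (k : I -> {cmonom nat}) :
  \prod_(i <- r | P i) << k i >> =
  << (\big[mmul/mone]_(i <- r | P i) k i) >> :> {malg F[{cmonom nat}]}.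
Proof. by apply/esym/(big_morph (fun m => << m >>) malgU_mul). Qed.

Lemma cmonom_prodE (I : Type) (r : seq I) (P : pred I) (k : I -> {cmonom nat}) (j : nat) :
  (\big[mmul/mone]_(i <- r | P i) k i : {cmonom nat}) j = (\sum_(i <- r | P i) k i j)%N.
Proof. by apply: (big_morph (fun m : {cmonom nat} => m j)) => [m m'|]; rewrite ?cmM ?cm1. Qed.

Lemma malg_intr_mul (c : int) (m : {cmonom nat}) :
  c%:~R * << m >> = << c%:~R *g m >> :> {malg F[{cmonom nat}]}.
Proof.
rewrite -[c%:~R](rmorph_int (@malgC {cmonom nat} F)).
rewrite mul_malgC; apply/malgP => k; rewrite mcoeffZ.
by rewrite [X in _ * X = _](mcoeffU m 1) [RHS](mcoeffU m) mulr_natr.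
Qed.

Lemma poly_value_coef M (K : {malg int[{cmonom nat}]}) (s : {cmonom nat}) :
  (forall m j, m \in msupp K -> j \in finsupp m -> (j < M)%N) ->
  (poly_value K (truncated_cumulants M variable))@_s = (K@_s)%:~R :> F.
Proof.
move=> hM; have -> : poly_value K (truncated_cumulants M variable)
    = \sum_(m <- msupp K) << (K@_m)%:~R *g m >>.
  rewrite /poly_value !big_seq; apply: eq_bigr => m mK.
  have -> : \prod_(j <- finsupp m) truncated_cumulants M variable j.+2 ^+ m j = << m >>.
    transitivity (\prod_(j <- finsupp m) << \big[mmul/mone]_(i < m j) ucm j >> : {malg F[{cmonom nat}]}).
      rewrite !big_seq; apply: eq_bigr => j jm.
      by rewrite -malgU_prod prodr_const card_ord /truncated_cumulants ltnS (hM m j).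
    rewrite malgU_prod; congr << _ >>; apply/eqP/cmP => j; rewrite cmonom_prodE.
    transitivity (\sum_(i <- finsupp m) if i == j then m i else 0)%N.
      apply: eq_bigr => i _; rewrite cmonom_prodE sum_nat_const card_ord cmU.
      by case: eqP; rewrite ?muln1 ?muln0.
    rewrite [LHS](@sum_delta_seq nat) ?fset_uniq //.
    by case: mdomP.
  exact: malg_intr_mul.
rewrite raddf_sum /= (eq_bigr (fun m => if m == s then (K@_m)%:~R else 0)) => [|m _].
  rewrite sum_delta_seq ?fset_uniq //.
  by case: msuppP => // sK; rewrite mcoeff_outdom.
by rewrite mcoeffU; case: eqP => [->|]; rewrite ?mulr1n ?mulr0n.
Qed.

Lemma coef_prod_variables (T : finType) (B : {set T}) (k : T -> nat) (s : {cmonom nat}) :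
  (\prod_(b in B) variable (k b))@_s =
  ([forall b in B, (0 < k b)%N] &&
    ((\big[mmul/mone]_(b in B) ucm (k b).-1 : {cmonom nat}) == s))%:R :> F.
Proof.
case: forallP => [h|/forallP]; last first.
  rewrite negb_forall => /existsP[b]; rewrite negb_imply -leqNgt leqn0 => /andP[bB /eqP kb].
  by rewrite (bigD1 b) //= kb mul0r mcoeff0.
rewrite -mcoeffU1 -malgU_prod; congr (_@__); apply: eq_bigr => b bB.
by have := implyP (h b) bB; case: (k b).
Qed.

Lemma variables_monomE (T : finType) (B : {set T}) (k : T -> nat) (s : {cmonom nat}) :
  [forall b in B, (0 < k b)%N] ->
  reflect (forall j : nat, #|[set b in B | k b == j.+1]| = s j)
    ((\big[mmul/mone]_(b in B) ucm (k b).-1 : {cmonom nat}) == s).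
Proof.
move=> /forallP h; have e j : (\big[mmul/mone]_(b in B) ucm (k b).-1 : {cmonom nat}) j
    = #|[set b in B | k b == j.+1]|.
  rewrite cmonom_prodE -sum1_card big_mkcond [RHS]big_mkcond; apply: eq_bigr => b _.
  rewrite inE cmU; case: ifP => // bB; have := implyP (h b) bB.
  by case: (k b) => // i _ /=; rewrite eqSS; case: eqP.
by apply: (iffP (cmP _ _)) => hj j; rewrite -hj e.
Qed.

End Indeterminates.

(** * Signs and transitivity of factorizations *)

Lemma card_porbits_block_cycle ks : all (fun k => (1 <= k)%N) ks ->
  #|porbits (block_cycle ks)| = size ks.
Proof.
move=> kp; set p := block_cycle ks.
have e x : porbit p x = [set y | block_index y == block_index x].
  apply/setP => y; rewrite inE; apply/idP/eqP => [/porbitP[i ->]|yx].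
    by apply: val_inj; rewrite /= permX block_cycle_iter.
  apply: (closed_block_index _ (porbit_id p x) yx) => z.
  by case/porbitP => i ->; rewrite -permM -expgSr mem_porbit.
have -> : porbits p = [set [set y | block_index y == i] | i in setT].
  apply/setP => c; apply/imsetP/imsetP => [[x _ ->]|[i _ ->]].
    by exists (block_index x); rewrite ?inE ?e.
  by have [x xi] := block_start kp i; exists x; rewrite ?inE ?e ?xi.
rewrite card_imset ?cardsT ?card_ord // => i j /setP h.
by have [x xi] := block_start kp i; have := h x; rewrite !inE xi eqxx => /esym/eqP.
Qed.

Lemma odd_perm_porbits (T : finType) (s : {perm T}) :
  odd_perm s = odd #|T| (+) odd #|porbits s|.
Proof. by []. Qed.

Lemma connected_transitive (T : finType) (s : {perm T} * {perm T}) : (0 < #|T|)%N ->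
  connected_on setT s = [transitive <<[set s.1; s.2]>>%g, on [set: T] | 'P].
Proof.
move=> T0; apply/forallP/idP => [h|tr U].
  have [x _] := card_gt0P T0.
  apply/imsetP; exists x => //; apply/esym/eqP.
  have /implyP := h (orbit 'P <<[set s.1; s.2]>>%g x); apply.
  rewrite subsetT -card_gt0 (cardD1 x) orbit_refl /=; apply/stableP => y yx.
  have gen a : a \in [set s.1; s.2] -> a y \in orbit 'P <<[set s.1; s.2]>>%g x.
    by move=> aS; rewrite -[a y]/('P%act y a) orbit_actr ?mem_gen.
  by split; apply: gen; rewrite !inE eqxx ?orbT.
apply/implyP => /and3P[_ U0 /stableP hU]; apply/eqP.
by apply: transitive_invariant tr _ _ U0 => x /hU[].
Qed.

(** * Coefficients of Kerov polynomials *)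

Lemma mul_sign_mcoeff (F : numFieldType) (n : nat) (g : {malg F[{cmonom nat}]}) s :
  ((-1) ^+ n * g)@_s = (-1) ^+ n * g@_s.
Proof. by rewrite -signr_odd mulr_sign -[in RHS]signr_odd mulr_sign; case: odd; rewrite ?mcoeffN. Qed.

Section Coefficient.
Variables (F : numFieldType) (ks : seq nat) (K : {malg int[{cmonom nat}]}).
Local Notation N := (sumn ks).
Local Notation pairs := ('S_N * 'S_N)%type.
Hypothesis ks0 : ks != [::].
Hypothesis ks_pos : all (fun k => (1 <= k)%N) ks.

Definition connected_factorization (t : pairs) : bool :=
  ((t.2 * t.1)%g == block_cycle ks) &&
  [transitive <<[set t.1; t.2]>>%g, on [set: 'I_N] | 'P].

Lemma sumn_pos : (0 < N)%N.
Proof. by move: ks0 ks_pos; case: ks => //= k ls _ /andP[k0 _]; rewrite addn_gt0 k0. Qed.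

(** The parities of [N - #|porbits s|] for the two factors add up to that of their
product, which has [size ks] cycles. *)
Lemma factorization_sign (t : pairs) : connected_factorization t ->
  (-1) ^+ (size ks).-1 * (-1) ^+ odd_perm t.1 * (-1) ^+ #|porbits t.2| = -1 :> F.
Proof.
move=> /andP[/eqP e _]; rewrite -signr_odd -(signr_odd _ #|_|) -!signr_addb.
have := congr1 (@odd_perm _) e; rewrite odd_permM.
rewrite !odd_perm_porbits (card_porbits_block_cycle ks_pos).
have : (0 < size ks)%N by rewrite lt0n size_eq0.
case: (size ks) => // l _ /=; move: (odd #|_|) => a.
by move: (odd #|porbits t.1|) (odd #|porbits t.2|) (odd l) => [] [] [] //; case: a.
Qed.

(** Triples with the coloring shifted by one, so that it counts what a cycle of
[s2] contributes to condition (e), and with colors bounded by [M] to obtain a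
finite type. *)
Definition colored_factorizations M (s : {cmonom nat}) :
    {set pairs * {ffun {set 'I_N} -> 'I_M.+1}} :=
  [set tk : pairs * {ffun {set 'I_N} -> 'I_M.+1} |
    let B := porbits tk.1.2 in
    [&& connected_factorization tk.1,
        [&& supported B tk.2, total tk.2 B == #|porbits tk.1.1|
          & strict_coloring (S := perm_graph tk.1.1 tk.1.2) tk.2],
        [forall b in B, (0 < tk.2 b)%N]
      & (\big[mmul/mone]_(b in B) ucm (tk.2 b).-1 : {cmonom nat}) == s]].

Hypothesis K_shapes : forall la, sorted geq la && (0%N \notin la) ->
  exists2 r : nat -> F^o,
    lagrange_related (A := F^o) (fun l e => (power_sum_shape l e la)%:R) r &
    poly_value (A := F^o) K r = (-1) ^+ (size ks).-1 *
      \sum_(t : pairs | connected_factorization t) (-1) ^+ odd_perm t.1 *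
        (layer_count (porbits t.2) (cycles_inside t.1) la set0)%:R.

(** The same combination of products of moments expresses the polynomial on
diagrams and on indeterminates; [graph_expansion] carries the first evaluation
to the second. *)
Lemma coefficient_colored_factorizations M (s : {cmonom nat}) :
  (forall m j, m \in msupp K -> j \in finsupp m -> (j < M)%N) ->
  (K@_s)%:~R = #|colored_factorizations M s|%:R :> F.
Proof.
move=> hM; rewrite -(poly_value_coef F s hM).
have [c pc cE] := expressible_poly F K.
pose A : comAlgType F := {malg F[{cmonom nat}]}.
rewrite (cE A _ _ (@lagrange_related_truncated F A M (variable F) erefl)).
pose ss := [seq ((-1) ^+ (size ks).-1 * (-1) ^+ odd_perm t.1 : F, t) |
  t : pairs <- index_enum _ & connected_factorization t].
rewrite (@graph_expansion N F A c ss M (fun i => - variable F i) sumn_pos pc); first last.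
- exact: oppr0.
- move=> la laP; have [r rel] := K_shapes laP.
  rewrite (cE _ _ _ rel) big_map big_filter mulr_sumr => e.
  transitivity (combo_value (A := F^o) (fun l e => (power_sum_shape l e la)%:R) c).
    by apply: eq_bigr => t _; rewrite natr_prod.
  by rewrite e; apply: eq_bigr => t _; rewrite mulrA.
- by apply/allP => _ /mapP[t /[!mem_filter] /andP[/andP[_ tr] _] ->].
rewrite big_map big_filter mcoeffN raddf_sum /= -sumrN.
transitivity (\sum_(t : pairs | connected_factorization t)
  \sum_(k : {ffun {set 'I_N} -> 'I_M.+1} | [&& supported (porbits t.2) k,
      total k (porbits t.2) == #|porbits t.1|
      & strict_coloring (S := perm_graph t.1 t.2) k])
    ([forall b in porbits t.2, (0 < k b)%N] &&
     ((\big[mmul/mone]_(b in porbits t.2) ucm (k b).-1 : {cmonom nat}) == s))%:R : F); last first.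
  rewrite pair_big_dep /= -natr_sum; congr _%:R; rewrite -sum1_card.
  rewrite [LHS]big_mkcond [RHS]big_mkcond; apply: eq_bigr => -[t k] _ /=.
  by rewrite inE /=; case: connected_factorization => //=; case: and3P => //= _; case: ifP.
apply: eq_bigr => t ct; rewrite mcoeffZ raddf_sum /= mulr_sumr -sumrN.
apply: eq_bigr => k _; rewrite -coef_prod_variables prodrN mul_sign_mcoeff.
by rewrite mulrA factorization_sign // mulN1r opprK.
Qed.
End Coefficient.
Arguments connected_factorization : clear implicits.

(** * Triples as colored factorizations *)

(** Group the cycles by color. *)
Lemma color_sum (T : finType) (B : {set T}) (k : T -> nat) (s : {cmonom nat}) (f : nat -> nat) :
  (forall b, b \in B -> 0 < k b)%N ->
  (forall j : nat, #|[set b in B | k b == j.+1]| = s j) ->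
  (\sum_(b in B) f (k b).-1 = \sum_(j <- finsupp s) f j * s j)%N.
Proof.
move=> kpos ks.
transitivity (\sum_(j <- finsupp s) \sum_(b in B) if j == (k b).-1 then f j else 0)%N; last first.
  apply: eq_bigr => j _; rewrite -ks -sum1_card big_distrr /= [RHS]big_mkcond [LHS]big_mkcond.
  apply: eq_bigr => b _; rewrite inE muln1; case: ifP => //= bB.
  by have := kpos b bB; case: (k b) => // i _ /=; rewrite eqSS eq_sym.
rewrite exchange_big /=; apply: eq_bigr => b bB.
rewrite [RHS](@sum_delta_seq nat) ?fset_uniq // ifT // -cmE_neq0 -ks -lt0n card_gt0.
by apply/set0Pn; exists b; rewrite inE bB; have := kpos b bB; case: (k b) => /=.
Qed.

Section Triples.
Variables (ks : seq nat) (M : nat) (s : {cmonom nat}).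
Local Notation N := (sumn ks).
Local Notation pairs := ('S_N * 'S_N)%type.
Implicit Types (t : pairs) (k : {ffun {set 'I_N} -> 'I_M.+1}).

Definition cycle_coloring t k : {ffun {set 'I_N} -> nat} :=
  [ffun c => if c \in porbits t.2 then (k c).+1 else 0%N].

Lemma strict_coloring_meeting t k : total k (porbits t.2) = #|porbits t.1| ->
  strict_coloring (S := perm_graph t.1 t.2) k ->
  forall A : {set {set 'I_N}}, A \subset porbits t.2 -> A != set0 -> A != porbits t.2 ->
  (total k A < #|[set d in porbits t.1 | d :&: cover A != set0]|)%N.
Proof.
move=> kB /forallP h A sAB nA0 nAB; have := card_cycles_meeting t.1 sAB.
have /implyP := h (porbits t.2 :\: A); rewrite /= subsetDl setD_eq0.
have -> : ~~ (porbits t.2 \subset A) by apply: contra nAB => sBA; rewrite eqEsubset sAB.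
have -> : porbits t.2 :\: A != porbits t.2.
  apply: contra nA0 => /eqP e; rewrite -subset0; apply/subsetP => c cA.
  by have := subsetP sAB c cA; rewrite -e inE cA.
move=> /(_ isT); rewrite -kB (totalD k sAB); move: (total k _) (total k _) (cycles_inside _ _) #|_|.
by clear; lia.
Qed.

Lemma meeting_strict_coloring t k : total k (porbits t.2) = #|porbits t.1| ->
  (forall A : {set {set 'I_N}}, A \subset porbits t.2 -> A != set0 -> A != porbits t.2 ->
    (total k A < #|[set d in porbits t.1 | d :&: cover A != set0]|)%N) ->
  strict_coloring (S := perm_graph t.1 t.2) k.
Proof.
move=> kB h; apply/forallP => A; apply/implyP => /and3P[/= sAB nA0 nAB].
have sDB : porbits t.2 :\: A \subset porbits t.2 by apply: subsetDl.
have := card_cycles_meeting t.1 sDB; rewrite setDDr setDv set0U (setIidPr sAB).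
have := h _ sDB; rewrite setD_eq0.
have -> : ~~ (porbits t.2 \subset A) by apply: contra nAB => sBA; rewrite eqEsubset sAB.
have -> : porbits t.2 :\: A != porbits t.2.
  apply: contra nA0 => /eqP e; rewrite -subset0; apply/subsetP => c cA.
  by have := subsetP sAB c cA; rewrite -e inE cA.
move=> /(_ isT isT); rewrite -kB (totalD k sAB).
move: (total k _) (total k _) (cycles_inside _ _) #|_|.
by clear; lia.
Qed.

Lemma colored_factorization_triple t k : (t, k) \in colored_factorizations ks M s ->
  is_kerov_triple s t.1 t.2 (cycle_coloring t k).
Proof.
rewrite inE /= => /and4P[/andP[/eqP tp tr] /and3P[sk /eqP kB strict] /forallP kpos' mon].
have kpos b : b \in porbits t.2 -> (0 < k b)%N by move/(implyP (kpos' b)).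
have colors := elimT (variables_monomE s (introT forallP kpos')) mon.
have csum f := color_sum f kpos colors.
split=> //.
- by rewrite -sum1_card (csum (fun=> 1%N)); apply: eq_bigr => j _; rewrite mul1n.
- rewrite -(csum (fun j => j.+2)) -kB -sum1_card -big_split /=.
  by apply: eq_bigr => b bB; rewrite addn1; have := kpos b bB; case: (nat_of_ord (k b)).
- apply/pffun_onP; split=> [|c /imageP[b bB ->]]; last first.
    by rewrite ffunE bB unfold_in; have := kpos b bB; lia.
  by apply/subsetP => c; rewrite unfold_in /= ffunE; case: (c \in porbits t.2).
- move=> j; rewrite -colors; apply: eq_card => c; rewrite !inE ffunE.
  by case: (c \in porbits t.2); rewrite //= eqSS.
move=> A sAB nA0 nAB; apply: leq_ltn_trans (strict_coloring_meeting kB strict sAB nA0 nAB).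
rewrite leq_eqVlt; apply/orP; left; apply/eqP; apply: eq_bigr => c cA.
by rewrite ffunE (subsetP sAB c cA) subn1.
Qed.

Lemma triple_colored_factorization t q : (forall j, j \in finsupp s -> (j < M)%N) ->
  is_kerov_triple s t.1 t.2 q ->
  exists2 k, (t, k) \in colored_factorizations ks M s & q = cycle_coloring t k.
Proof.
move=> sM [tp tr c2 c12 /pffun_onP[qsupp qpos] colors meet].
pose k : {ffun {set 'I_N} -> 'I_M.+1} := [ffun c => inord (q c).-1].
have q2 c : c \in porbits t.2 -> (2 <= q c)%N.
  by move=> cB; apply: (qpos (q c)); apply: image_f.
have kE c : c \in porbits t.2 -> (k c).+1 = q c.
  move=> cB; have := q2 c cB; case e : (q c) => [|[|j]] // _.
  rewrite ffunE e inordK // ltnS; apply: sM; rewrite -cmE_neq0 -colors -lt0n card_gt0.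
  by apply/set0Pn; exists c; rewrite inE cB e /=.
have q0 c : c \notin porbits t.2 -> q c = 0%N.
  by move=> cB; apply/eqP; apply: contraNT cB => qc; apply: (subsetP qsupp).
exists k; last first.
  by apply/ffunP => c; rewrite ffunE; case: ifP => [/kE//|/negbT/q0].
have kpos b : b \in porbits t.2 -> (0 < k b)%N.
  by move=> bB; have := q2 b bB; rewrite -kE.
have colors' (j : nat) : #|[set b in porbits t.2 | k b == j.+1 :> nat]| = s j.
  rewrite -colors; apply: eq_card => c; rewrite !inE; case cB : (c \in porbits t.2) => //=.
  by rewrite -kE // eqSS.
have totE (A : {set {set 'I_N}}) : A \subset porbits t.2 -> total k A = (\sum_(c in A) (q c - 1))%N.
  by move=> sAB; apply: eq_bigr => c cA; rewrite -kE ?(subsetP sAB) // subn1.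
have kB : total k (porbits t.2) = #|porbits t.1|.
  apply/eqP; rewrite -(eqn_add2r #|porbits t.2|) c12 -(color_sum (fun j => j.+2) kpos colors').
  rewrite -sum1_card -big_split /=; apply/eqP; apply: eq_bigr => b bB.
  by rewrite addn1; have := kpos b bB; case: (nat_of_ord (k b)).
have kpos' : [forall b in porbits t.2, (0 < k b)%N] by apply/forallP => b; apply/implyP/kpos.
rewrite inE /=; apply/and4P; split=> //.
- by rewrite /connected_factorization tp eqxx.
- apply/and3P; split; [|exact/eqP|].
    by apply/supportedP => c cB; apply: val_inj; rewrite ffunE q0 //= inordK.
  by apply: meeting_strict_coloring => // A sAB; rewrite totE //; apply: meet.
- exact/(variables_monomE s kpos').
Qed.

Lemma cycle_coloring_inj t k k' : supported (porbits t.2) k -> supported (porbits t.2) k' ->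
  cycle_coloring t k = cycle_coloring t k' -> k = k'.
Proof.
move=> /supportedP sk /supportedP sk' /ffunP e; apply/ffunP => c; apply: val_inj.
have := e c; rewrite !ffunE; case: ifP => [_ []//|/negbT cB _].
by rewrite sk ?sk'.
Qed.

End Triples.

(** * Moments of Young diagrams *)

Section Integrals.
Import numFieldNormedType.Exports.
Variable R : realType.
Local Notation mu := (@lebesgue_measure R).
Local Open Scope classical_set_scope.

Lemma integral_deriv_poly (P : {poly R}) (a b : R) : a <= b ->
  (\int[mu]_(x in `]a, b[) (P^`().[x])%:E = (P.[b] - P.[a])%:E)%E.
Proof.
rewrite le_eqVlt => /orP[/eqP->|ab].
  by rewrite set_itv_ge ?bnd_simp ?ltxx // integral_set0 subrr.
have mP : measurable_fun [set: R] (fun x : R => (P^`().[x] : R)%:E).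
  apply/measurable_EFinP; apply: continuous_measurable_fun; exact: continuous_horner.
rewrite -(@integral_itv_bndoo _ a b _ true false); last first.
  by apply: measurable_funS mP.
rewrite (@continuous_FTC2 _ _ (horner P)) //.
- exact/continuous_subspaceT/continuous_horner.
- split=> [x _| |]; first exact: derivable_horner.
  + by apply: cvg_at_right_filter; exact: continuous_horner.
  + by apply: cvg_at_left_filter; exact: continuous_horner.
- by move=> x _; rewrite -derive.derivE.
Qed.

Lemma horner_subX_exp (a x : R) n : (('X - a%:P) ^+ n).[x] = (x - a) ^+ n.
Proof. by rewrite horner_exp hornerXsubC. Qed.

Lemma horner_Xsub_exp (a x : R) n : ((a%:P - 'X) ^+ n).[x] = (a - x) ^+ n.
Proof. by rewrite horner_exp hornerD hornerN hornerC hornerX. Qed.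

Lemma deriv_subX_exp (a : R) n :
  deriv (('X - a%:P) ^+ n.+1) = n.+1%:R *: ('X - a%:P) ^+ n.
Proof. by rewrite deriv_exp derivXsubC mul1r scaler_nat. Qed.

Lemma deriv_Xsub_exp (a : R) n :
  deriv ((a%:P - 'X) ^+ n.+1) = - n.+1%:R *: (a%:P - 'X) ^+ n.
Proof. by rewrite deriv_exp derivB derivC derivX sub0r mulN1r mulNrn scaleNr scaler_nat. Qed.

(** Fubini, and the fundamental theorem of calculus in each variable; the
antiderivatives are polynomials. *)
Lemma integral_rectangle m (q a b : R) : 0 <= q -> a <= b ->
  (\int[mu \x mu]_(p in `]0%R, q[ `*` `]a, b[) ((p.1 - p.2) ^+ m)%:E
   = ((((q - a) ^+ m.+2 - (- a) ^+ m.+2) - ((q - b) ^+ m.+2 - (- b) ^+ m.+2))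
       / (m.+1%:R * m.+2%:R))%:E)%E.
Proof.
move=> q0 ab; set D := _ `*` _.
have mD : measurable D by apply: measurableX; exact: measurable_itv.
have mf : measurable_fun [set: R * R] (fun p : R * R => (p.1 - p.2) ^+ m).
  by apply: measurable_funX; apply: measurable_funB.
have intf : (mu \x mu)%E.-integrable D (EFin \o (fun p : R * R => (p.1 - p.2) ^+ m)).
  apply: measurable_bounded_integrable => //.
  - suff fin : (mu `]0%R, q[ * mu `]a, b[ < +oo)%E.
      apply: le_lt_trans fin; rewrite le_eqVlt; apply/orP; left; apply/eqP.
      by apply: product_measure1E; exact: measurable_itv.
    by rewrite !lebesgue_measure_itv /=; case: ifP; case: ifP => _ _;
      rewrite ?mule0 ?mul0e ?ltry // -!EFinB -EFinM ltry.
  - exact: measurable_funS mf.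
  exists ((`|q| + `|a| + `|b|) ^+ m); split; first exact: num_real.
  move=> M hM p [/=]; rewrite !in_itv /= => /andP[p1 p2] /andP[p3 p4].
  rewrite normrX (le_trans _ (ltW hM)) // lerXn2r // ?nnegrE ?addr_ge0 //.
  have := ler_norm q; have := ler_norm (- a); have := ler_norm b.
  have := ler_norm a; have := ler_norm (- b); rewrite !normrN.
  have := normr_ge0 q; rewrite ler_norml; lra.
rewrite integral_mkcond.
have intg : (mu \x mu)%E.-integrable [set: R * R] ((EFin \o (fun p : R * R => (p.1 - p.2) ^+ m)) \_ D).
  by rewrite -integrable_mkcond.
rewrite -(integral12_prod_meas1 intg) /fubini_F.
have m1 : m.+1%:R != 0 :> R by rewrite pnatr_eq0.
have m2 : m.+2%:R != 0 :> R by rewrite pnatr_eq0.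
pose P : {poly R} := (('X - a%:P) ^+ m.+2 - ('X - b%:P) ^+ m.+2) * (m.+1%:R * m.+2%:R)^-1%:P.
transitivity (\int[mu]_(x in `]0%R, q[) (P^`().[x])%:E)%E; last first.
  rewrite integral_deriv_poly // /P; congr EFin.
  rewrite !(hornerM, hornerC) !(hornerD, hornerN) !horner_subX_exp !sub0r.
  by move: m1 m2; move: (m.+1%:R : R) (m.+2%:R : R) (m.+2)%N => c d k c0 d0; field; rewrite c0 d0.
rewrite [RHS]integral_mkcond; apply: eq_integral => x _.
rewrite patchE; case: ifPn => [|] hx; last first.
  rewrite integral0_eq // => y _; rewrite patchE ifN //.
  by apply: contra hx; rewrite !in_setE => -[].
pose Q : {poly R} := (x%:P - 'X) ^+ m.+1 * (- (m.+1%:R)^-1)%:P.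
transitivity (\int[mu]_(y in `]a, b[) (Q^`().[y])%:E)%E; last first.
  rewrite integral_deriv_poly // /Q /P; congr EFin.
  rewrite derivM derivC mulr0 addr0 derivB !deriv_subX_exp.
  rewrite !(hornerM, hornerC) ?(hornerZ, hornerD, hornerN, hornerM, hornerC) ?(horner_subX_exp, horner_Xsub_exp) /=.
  move: m1 m2.
  move: (m.+1%:R : R) (m.+2%:R : R) ((x - a) ^+ m.+1) ((x - b) ^+ m.+1) => c d u v c0 d0.
  by field; rewrite c0 d0.
rewrite [RHS]integral_mkcond; apply: eq_integral => y _; rewrite !patchE.
have -> : ((x, y) \in D) = (y \in `]a, b[%classic).
  by rewrite /D classical_sets.in_setX; move: hx => ->.
case: ifP => // _; congr EFin.
rewrite /Q derivM derivC mulr0 addr0 deriv_Xsub_exp.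
rewrite !(hornerM, hornerC) ?(hornerZ, hornerD, hornerN, hornerM, hornerC) ?(horner_subX_exp, horner_Xsub_exp) /=.
move: m1; move: (m.+1%:R : R) ((x - y) ^+ m) => c u c0.
by field; rewrite c0.
Qed.

(** The extreme terms of the binomial expansions cancel. *)
Lemma rectangle_binomial n (q r : nat) : (1 < n)%N ->
  ((q%:R - r%:R) ^+ n - (- r%:R) ^+ n)
    - ((q%:R - r.+1%:R) ^+ n - (- r.+1%:R) ^+ n)
  = \sum_(l < n | (0 < l)%N) (-1) ^+ l.-1 * 'C(n, l)%:R
      * ((r.+1 ^ l - r ^ l) * q ^ (n - l))%:R :> R.
Proof.
case: n => [//|n] n1; rewrite !exprDn !(big_ord_recr n.+1) /= subnn binn !expr0 !mul1r !mulr1n.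
rewrite !addrK -sumrB [RHS]big_mkcond; apply: eq_bigr => -[[|l] /= ln] _.
  by rewrite subrr.
rewrite (exprNn (r%:R) l.+1) (exprNn r.+1%:R l.+1) natrM natrB; last first.
  by rewrite leq_exp2r.
rewrite !natrX -mulrnBl -mulr_natl exprS.
by ring.
Qed.

Lemma young_regionE (la : seq nat) : @young_region R la =
  \big[classical_sets.setU/classical_sets.set0]_(r <- iota 0 (size la))
    (`]0%R, (nth 0%N la r)%:R[ `*` `](r%:R : R), r.+1%:R[).
Proof.
rewrite -classical_sets.bigcup_seq; apply/seteqP; split=> [p [j [/andP[p1 p2] p34]]|p [j /= js]].
  exists j; first rewrite /= mem_iota add0n ltnNge; last first.
    by split; rewrite /= in_itv /= ?p1 ?p34.
  apply/negP => sj; have := lt_trans p1 p2.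
  by rewrite nth_default // ltxx.
by rewrite !in_itv /= => -[/= p1 p2]; exists j.
Qed.

(** Cut the diagram into its rows; the binomial expansion of the integral over a row
produces the embeddings of the complete bipartite graphs with [n] vertices. *)
Lemma shape_functionalE (la : seq nat) n : shape_functional R la n =
  \sum_(l < n | (0 < l)%N) (-1) ^+ l.-1 / n%:R * 'C(n, l)%:R
     * (power_sum_shape l (n - l) la)%:R.
Proof.
have [n1|n1] := leqP n 1.
  rewrite big1 => [|[[|l] /= ln] //]; last by move: (leq_trans ln n1).
  by rewrite /shape_functional; case: n n1 => [|[]] // _; rewrite mul0r.
rewrite /shape_functional young_regionE /Rintegral.
rewrite integral_bigsetU_EFin /=; last 4 first.
- by move=> i; apply: measurableX; exact: measurable_itv.
- exact: iota_uniq.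
- move=> i j _ _ [p [[_ /= pi] [_ /= pj]]]; move: pi pj.
  rewrite !in_itv /= => /andP[ip pi] /andP[jp pj].
  have := lt_trans ip pj; have := lt_trans jp pi; rewrite !ltr_nat; lia.
- apply/measurable_EFinP; apply: measurable_funS (measurableT) _ _ => //.
  by apply: measurable_funX; apply: measurable_funB.
rewrite (eq_bigr (fun r => ((\sum_(l < n | (0 < l)%N) (-1) ^+ l.-1 * 'C(n, l)%:R
      * ((r.+1 ^ l - r ^ l) * nth 0%N la r ^ (n - l))%:R) / (n.-1%:R * n%:R))%:E)).
  rewrite sumEFin /= -mulr_suml.
  have nz : n%:R != 0 :> R by rewrite pnatr_eq0 -lt0n ltnW.
  have nz' : n.-1%:R != 0 :> R by rewrite pnatr_eq0 -lt0n -subn1 subn_gt0.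
  rewrite mulrC -mulrA invfM mulrAC mulVf // mul1r.
  rewrite exchange_big /= mulr_suml; apply: eq_bigr => l _.
  rewrite -mulr_sumr -natr_sum.
  rewrite /power_sum_shape -(big_mkord xpredT (fun r => (r.+1 ^ l - r ^ l) * nth 0 la r ^ (n - l)))%N /index_iota subn0.
  by move: (n%:R^-1 : R) => c; ring.
move=> r _; rewrite integral_rectangle ?ler_nat //.
case: n n1 => [|[|m]] // _; rewrite subSS subSS subn0 -rectangle_binomial //=.
Qed.

End Integrals.

(** * Kerov polynomials of Young diagrams *)

Section Glue.
Variable R : realType.

Lemma lagrange_related_free_cumulant (la : seq nat) :
  lagrange_related (A := R^o) (fun l e => (power_sum_shape l e la)%:R)
    (free_cumulant R la).
Proof.
have fcP := free_cumulantP R la; have [r0 r1 _] := fcP; split=> // n n1.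
have S0 : shape_functional R la 0 = 0 by rewrite /shape_functional mul0r.
have := free_cumulants_lagrange S0 (fun _ => erefl) fcP (ltnW n1).
rewrite (fps_pow_trunc _ _ (ltnSn n)) => <-; rewrite shape_functionalE mulr_sumr.
have n0 : n%:R != 0 :> R by rewrite pnatr_eq0 gtn_eqF // ltnW.
apply: eq_bigr => l _; rewrite -[RHS]/(((-1) ^+ l.-1 * 'C(n, l)%:R) * (power_sum_shape l (n - l) la)%:R).
move: (n%:R : R) n0 ((-1) ^+ l.-1 : R) ('C(n, l)%:R : R) ((power_sum_shape l (n - l) la)%:R : R).
by move=> a a0 b c d; field.
Qed.

Lemma kerov_eval_poly_value K (r : nat -> R) :
  kerov_eval K r = poly_value (A := R^o) K r.
Proof. by []. Qed.

Lemma connected_sum_factorizations ks la : ks != [::] -> all (fun k => (1 <= k)%N) ks ->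
  sorted geq la ->
  (connected_sum (reshape_index la : 'I_(sumn la) -> nat)
     (reshape_offset la : 'I_(sumn la) -> nat) setT (block_cycle ks))%:~R
  = \sum_(t | connected_factorization ks t) (-1) ^+ odd_perm t.1 *
        (layer_count (porbits t.2) (cycles_inside t.1) la set0)%:R :> R.
Proof.
move=> ks0 kp la_s; rewrite /connected_sum rmorph_sum /=.
apply: eq_big => [t|t _]; last first.
  by rewrite pair_weight_layers // rmorphM rmorphXn /= rmorphN1.
rewrite /connected_factorization -connected_transitive ?card_ord ?sumn_pos //.
congr (_ && _); rewrite /factors /perm_on; apply/and3P/eqP => [[_ _ /forallP h]|e].
  by apply/permP => x; rewrite permM; apply/eqP; have := h x; rewrite inE.
split; try (by apply/fintype.subsetP => x _; rewrite inE).
by apply/forallP => x; rewrite inE -e permM eqxx.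
Qed.

Lemma kerov_polynomial_shapes ks K : ks != [::] -> all (fun k => (1 <= k)%N) ks ->
  is_kerov_polynomial R ks K ->
  forall la, sorted geq la && (0%N \notin la) ->
  poly_value (A := R^o) K (free_cumulant R la) = (-1) ^+ (size ks).-1 *
      \sum_(t | connected_factorization ks t) (-1) ^+ odd_perm t.1 *
        (layer_count (porbits t.2) (cycles_inside t.1) la set0)%:R.
Proof.
move=> ks0 kp KP la laP; have [la_s _] := andP laP.
rewrite -kerov_eval_poly_value -connected_sum_factorizations //.
have := KP la laP.
rewrite (cumulant_connected (row := reshape_index la : 'I_(sumn la) -> nat)
   (col := reshape_offset la : 'I_(sumn la) -> nat)) //; last first.
  by move=> ks' _; apply: norm_character_placements.
move=> e; apply: (@fmorph_inj _ _ (real_complex R)); rewrite -[RHS]/(_%:C)%C.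
rewrite -[LHS]/((kerov_eval K (free_cumulant R la))%:C)%C -e.
by rewrite rmorphM rmorphXn /= rmorphN1 rmorph_int.
Qed.

Lemma kerov_coefficient ks K s M : ks != [::] -> all (fun k => (1 <= k)%N) ks ->
  is_kerov_polynomial R ks K ->
  (forall m j, m \in msupp K -> j \in finsupp m -> (j < M)%N) ->
  K@_s = #|colored_factorizations ks M s|%:Z.
Proof.
move=> ks0 kp KP hM; apply/eqP; rewrite -(@eqr_int R).
rewrite (coefficient_colored_factorizations (F := R) ks0 kp _ s hM) //.
move=> la laP; exists (free_cumulant R la).
  exact: lagrange_related_free_cumulant.
exact: kerov_polynomial_shapes.
Qed.
End Glue.

(** * Counting the triples *)

Lemma kerov_triples_card ks M (s : {cmonom nat}) :
  (forall j, j \in finsupp s -> (j < M)%N) ->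
  (kerov_triples ks s #= `I_(#|colored_factorizations ks M s|))%card.
Proof.
move=> sM; pose D := colored_factorizations ks M s.
pose x0 : 'S_(sumn ks) * 'S_(sumn ks) * {ffun {set 'I_(sumn ks)} -> 'I_M.+1} :=
  ((1%g, 1%g), [ffun=> ord0]).
pose tk (i : nat) := nth x0 (enum D) i.
pose g i := ((tk i).1, cycle_coloring (tk i).1 (tk i).2).
have tkD i : (i < #|D|)%N -> tk i \in D.
  by move=> iD; rewrite -mem_enum mem_nth // -cardE.
have -> : kerov_triples ks s = classical_sets.image `I_(#|D|) g.
  apply/seteqP; split=> [[t q] /= triple|_ [i /= iD <-]].
    have [k kD ->] := @triple_colored_factorization ks M s t q sM triple.
    exists (index (t, k) (enum D)); first by rewrite /= cardE index_mem mem_enum.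
    by rewrite /g /tk nth_index ?mem_enum.
  by apply: (@colored_factorization_triple ks M s (tk i).1 (tk i).2); rewrite -surjective_pairing tkD.
apply: inj_card_eq => i j /set_mem /= iD /set_mem /= jD [t_eq].
have := tkD i iD; have := tkD j jD; rewrite /g.
case ei : (tk i) t_eq => [t k] /=; case ej : (tk j) => [t' k'] /= e; rewrite -e.
rewrite !inE /= => /and4P[_ /and3P[sk' _ _] _ _] /and4P[_ /and3P[sk _ _] _ _].
move=> /(cycle_coloring_inj sk sk') kk; apply/eqP.
by rewrite -(nth_uniq x0 (s := enum D)) ?enum_uniq -?cardE // -/(tk i) -/(tk j) ei ej e kk.
Qed.

Lemma exponent_bound (K : {malg int[{cmonom nat}]}) (s : {cmonom nat}) :
  exists M, (forall j, j \in finsupp s -> (j < M)%N) /\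
    (forall m j, m \in msupp K -> j \in finsupp m -> (j < M)%N).
Proof.
have hb (m : {cmonom nat}) (j : nat) : j \in finsupp m -> (j < (\max_(i <- finsupp m) i).+1)%N.
  by move=> jm; rewrite ltnS; apply: (@leq_bigmax_seq _ _ xpredT id).
exists (maxn (\max_(i <- finsupp s) i).+1 (\max_(m <- msupp K) (\max_(i <- finsupp m) i).+1)).
split=> [j js|m j mK jm]; first by rewrite leq_max hb.
rewrite leq_max; apply/orP; right; apply: leq_trans (hb m j jm) _.
exact: (leq_bigmax_seq (F := fun m : {cmonom nat} => (\max_(i <- finsupp m) i).+1) m mK isT).
Qed.

Theorem theorem1p6 (R : realType) (ks : seq nat)
    (K : {malg int[{cmonom nat}]}) (s : {cmonom nat}) :
  ks != [::] -> all (fun k => (1 <= k)%N) ks -> is_kerov_polynomial R ks K ->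
  exists2 m : nat, (kerov_triples ks s #= `I_m)%card & K@_s = m%:Z.
Proof.
move=> ks0 ks_pos KP; have [M [sM KM]] := exponent_bound K s.
exists #|colored_factorizations ks M s|; first exact: kerov_triples_card.
exact: kerov_coefficient ks0 ks_pos KP KM.
Qed.
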